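(* Let $(\Lambda,d)$ be a finitely aligned $k$-graph such that for each $v\in\Lambda^0$ there exists a boundary path $x\in v\Lambda^{\le\infty}$ such that whenever $\lambda,\mu\in\Lambda$ satisfy $s(\lambda)=s(\mu)=v$ and $\lambda\neq\mu$, we have $\lambda x\neq\mu x$. Then there exists a Cuntz-Krieger $\Lambda$-family $\{t_\lambda:\lambda\in\Lambda\}$ such that $t_v\neq0$ for all $v\in\Lambda^0$. Furthermore, any two such families generate canonically isomorphic $C^*$-algebras; that is, if $\{t_\lambda\}$ and $\{t'_\lambda\}$ are two such families, there is an isomorphism $C^*(\{t_\lambda:\lambda\in\Lambda\})\to C^*(\{t'_\lambda:\lambda\in\Lambda\})$ carrying $t_\lambda$ to $t'_\lambda$ for every $\lambda\in\Lambda$.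
   Context: Conventions: $0\in\mathbb{N}$; $\mathbb{N}^k$ is a semigroup with generators $e_1,\dots,e_k$, coordinatewise partial order $\le$, and $m\vee n$ denotes the coordinatewise maximum. A $k$-graph $(\Lambda,d)$ is a countable small category $\Lambda$ with a functor $d:\Lambda\to\mathbb{N}^k$ satisfying the factorisation property: if $d(\lambda)=m+n$ there are unique $\mu,\sigma\in\Lambda$ with $d(\mu)=m$, $d(\sigma)=n$, $\lambda=\mu\sigma$. Morphisms are called paths, objects vertices; $s$ and $r$ are the domain and codomain maps, so $\lambda\mu$ is defined when $s(\lambda)=r(\mu)$. $\Lambda^n:=\{\lambda:d(\lambda)=n\}$, and objects are identified with $\Lambda^0$. For $v\in\Lambda^0$, $v\Lambda:=\{\lambda\in\Lambda:r(\lambda)=v\}$ and $v\Lambda^{n}:=v\Lambda\cap\Lambda^n$. For $\lambda,\mu\in\Lambda$, $\Lambda^{\min}(\lambda,\mu):=\{(\alpha,\beta):\lambda\alpha=\mu\beta,\ d(\lambda\alpha)=d(\lambda)\vee d(\mu)\}$. $\Lambda$ is finitely aligned if every $\Lambda^{\min}(\lambda,\mu)$ is finite (possibly empty). A set $E\subset v\Lambda$ is exhaustive if for every $\mu\in v\Lambda$ there is $\lambda\in E$ with $\Lambda^{\min}(\lambda,\mu)\ne\emptyset$. A Cuntz-Krieger $\Lambda$-family is a collection $\{t_\lambda:\lambda\in\Lambda\}$ of partial isometries in a $C^*$-algebra such that (i) $\{t_v:v\in\Lambda^0\}$ are mutually orthogonal projections; (ii) $t_\lambda t_\mu=t_{\lambda\mu}$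 whenever $s(\lambda)=r(\mu)$; (iii) $t_\lambda^*t_\mu=\sum_{(\alpha,\beta)\in\Lambda^{\min}(\lambda,\mu)}t_\alpha t_\beta^*$ for all $\lambda,\mu\in\Lambda$; (iv) $\prod_{\lambda\in E}(t_v-t_\lambda t_\lambda^* )=0$ for all $v\in\Lambda^0$ and all finite exhaustive $E\subset v\Lambda$. Boundary paths: for $m\in(\mathbb{N}\cup\{\infty\})^k$, $\Omega_{k,m}$ is the $k$-graph with objects $\{p\in\mathbb{N}^k:p\le m\}$, morphisms $\{(p,q):p\le q\}$ ($p,q$ objects), $r(p,q)=p$, $s(p,q)=q$, $d(p,q)=q-p$. A graph morphism is a degree-preserving functor. A boundary path of $\Lambda$ is a graph morphism $x:\Omega_{k,m}\to\Lambda$, for some $m\in(\mathbb{N}\cup\{\infty\})^k$, for which there is $n_x\in\mathbb{N}^k$ with $n_x\le m$ such that: whenever $n\in\mathbb{N}^k$, $n_x\le n\le m$ and $n_i=m_i$, one has $x(n)\Lambda^{e_i}=\emptyset$. Put $r(x):=x(0)$ and $d(x):=m$. $\Lambda^{\le\infty}$ is the set of all boundary paths and $v\Lambda^{\le\infty}:=\{x\in\Lambda^{\le\infty}:r(x)=v\}$. If $s(\lambda)=r(x)$, $\lambda x:\Omega_{k,m+d(\lambda)}\to\Lambda$ is the unique graph morphism with $(\lambda x)(0,d(\lambda))=\lambda$ and $(\lambda x)(d(\lambda),n)=x(0,n-d(\lambda))$ for all $n\in\mathbb{N}^k$ with $d(\lambda)\le n\le m+d(\lambda)$. *)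

(* Defs.v *)
From HB Require Import structures.
From mathcomp Require Import all_boot all_order all_algebra.
From mathcomp Require Import finmap.
From mathcomp Require Import all_classical all_reals all_analysis.
From mathcomp Require Import complex zify.

Set Implicit Arguments.
Unset Strict Implicit.
Unset Printing Implicit Defensive.

Import Order.TTheory GRing.Theory Num.Theory.
Import numFieldNormedType.Exports.

Local Open Scope classical_set_scope.
Local Open Scope ring_scope.

(* {ffun 'I_k -> nat} carries the pointwise addition of the library, but no
   pointwise order.  In a degree in (N u {oo})^k, None stands for oo. *)
Notation degree k := {ffun 'I_k -> nat}.
Notation xdegree k := {ffun 'I_k -> option nat}.

Section Degrees.
Variable k : nat.
Implicit Types m n p q : degree k.

Definition dle m n : bool := [forall i, m i <= n i]%N.
Definition dmax m n : degree k := [ffun i => maxn (m i) (n i)].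
Definition dsub m n : degree k := [ffun i => m i - n i]%N.
Definition dgen (i : 'I_k) : degree k := [ffun j => nat_of_bool (j == i)].

Definition dlex m (M : xdegree k) : bool :=
  [forall i, if M i is Some b then (m i <= b)%N else true].
Definition daddx (M : xdegree k) m : xdegree k :=
  [ffun i => omap (fun b => (b + m i)%N) (M i)].

Lemma dleP m n : reflect (forall i, (m i <= n i)%N) (dle m n).
Proof. exact: forallP. Qed.

Lemma dlexP m (M : xdegree k) :
  reflect (forall i b, M i = Some b -> (m i <= b)%N) (dlex m M).
Proof.
apply: (iffP forallP) => [h i b e|h i]; first by have := h i; rewrite e.
by case e : (M i) => [b|] //; exact: h e.
Qed.

Lemma dlexx m : dle m m. Proof. exact/dleP. Qed.

Lemma dle_trans n m p : dle m n -> dle n p -> dle m p.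
Proof. by move=> /dleP h1 /dleP h2; apply/dleP => i; apply: leq_trans (h2 i). Qed.

Lemma dle_dlex n m (M : xdegree k) : dle m n -> dlex n M -> dlex m M.
Proof.
by move=> /dleP h1 /dlexP h2; apply/dlexP => i b /h2; apply: leq_trans.
Qed.

Lemma dle0 m : dle 0 m. Proof. by apply/dleP => i; rewrite ffunE. Qed.

Lemma dlex0 (M : xdegree k) : dlex 0 M.
Proof. by apply/dlexP => i b _; rewrite ffunE. Qed.

Lemma dsubKC m n : dle m n -> n = m + dsub n m.
Proof. by move=> /dleP h; apply/ffunP => i; rewrite !ffunE; exact/esym/subnKC. Qed.

Lemma daddI m n p : m + n = m + p -> n = p.
Proof.
move=> /ffunP e; apply/ffunP => i; have := e i.
by rewrite !ffunE /GRing.add /=; lia.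
Qed.

Lemma dsubDd p q r : dle p q -> dle q r -> dsub q p + dsub r q = dsub r p.
Proof.
move=> /dleP h1 /dleP h2; apply/ffunP => i; rewrite !ffunE.
by have := h1 i; have := h2 i; rewrite /GRing.add /=; lia.
Qed.
End Degrees.

(* Morphisms compose as in the paths convention: [ccomp l m] is the composite
   l m, meaningful only when src l = rng m; its value is arbitrary otherwise,
   and every axiom below is restricted to composable pairs. *)
Record category := Category {
  mor :> countType;
  obj : countType;
  src : mor -> obj;
  rng : mor -> obj;
  idm : obj -> mor;
  ccomp : mor -> mor -> mor;
  src_idm : forall v, src (idm v) = v;
  rng_idm : forall v, rng (idm v) = v;
  src_comp : forall l m, src l = rng m -> src (ccomp l m) = src m;
  rng_comp : forall l m, src l = rng m -> rng (ccomp l m) = rng l;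
  compA : forall l m n, src l = rng m -> src m = rng n ->
    ccomp l (ccomp m n) = ccomp (ccomp l m) n;
  comp_idl : forall l, ccomp (idm (rng l)) l = l;
  comp_idr : forall l, ccomp l (idm (src l)) = l }.

Record kgraph (k : nat) := KGraph {
  kcat :> category;
  deg : kcat -> degree k;
  deg_idm : forall v, deg (idm v) = 0;
  deg_comp : forall l m : kcat, src l = rng m -> deg (ccomp l m) = deg l + deg m;
  factorisation : forall (l : kcat) (m n : degree k), deg l = m + n ->
    exists! p : kcat * kcat,
      [/\ deg p.1 = m, deg p.2 = n, src p.1 = rng p.2 & l = ccomp p.1 p.2] }.

Record graph_morphism (k : nat) (G L : kgraph k) := GraphMorphism {
  gobj : obj G -> obj L;
  gmor :> G -> L;
  gmor_src : forall f, src (gmor f) = gobj (src f);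
  gmor_rng : forall f, rng (gmor f) = gobj (rng f);
  gmor_idm : forall v, gmor (idm v) = idm (gobj v);
  gmor_comp : forall f g, src f = rng g -> gmor (ccomp f g) = ccomp (gmor f) (gmor g);
  gmor_deg : forall f, deg (gmor f) = deg f }.

Section Omega.
Variables (k : nat) (M : xdegree k).

Definition omega_obj := {p : degree k | dlex p M}.
Definition omega_mor :=
  {f : degree k * degree k | dle f.1 f.2 && dlex f.2 M}.
Implicit Types (p : omega_obj) (f g h : omega_mor).

Lemma omega_rng_subproof f : dlex (val f).1 M.
Proof. by case/andP: (valP f); exact: dle_dlex. Qed.
Lemma omega_src_subproof f : dlex (val f).2 M.
Proof. by case/andP: (valP f). Qed.
Lemma omega_idm_subproof p : dle (val p) (val p) && dlex (val p) M.
Proof. by rewrite dlexx (valP p). Qed.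

Definition omega_rng f : omega_obj := exist _ (val f).1 (omega_rng_subproof f).
Definition omega_src f : omega_obj := exist _ (val f).2 (omega_src_subproof f).
Definition omega_idm p : omega_mor :=
  exist _ (val p, val p) (omega_idm_subproof p).
(* insubd returns its default f on a non-composable pair *)
Definition omega_comp f g : omega_mor := insubd f ((val f).1, (val g).2).
Definition omega_deg f : degree k := dsub (val f).2 (val f).1.

Lemma val_omega_comp f g : omega_src f = omega_rng g ->
  val (omega_comp f g) = ((val f).1, (val g).2).
Proof.
move=> /(congr1 val) /= e; rewrite insubdK // unfold_in /=.
case/andP: (valP f) => h1 _; case/andP: (valP g) => h2 ->; rewrite andbT.
by apply: dle_trans h1 _; rewrite e.
Qed.

Lemma omega_src_idm p : omega_src (omega_idm p) = p.
Proof. exact: val_inj. Qed.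
Lemma omega_rng_idm p : omega_rng (omega_idm p) = p.
Proof. exact: val_inj. Qed.
Lemma omega_src_comp f g : omega_src f = omega_rng g ->
  omega_src (omega_comp f g) = omega_src g.
Proof. by move=> e; apply: val_inj; rewrite /= val_omega_comp. Qed.
Lemma omega_rng_comp f g : omega_src f = omega_rng g ->
  omega_rng (omega_comp f g) = omega_rng f.
Proof. by move=> e; apply: val_inj; rewrite /= val_omega_comp. Qed.
Lemma omega_compA f g h : omega_src f = omega_rng g ->
  omega_src g = omega_rng h ->
  omega_comp f (omega_comp g h) = omega_comp (omega_comp f g) h.
Proof.
move=> e1 e2; apply: val_inj.
by rewrite !val_omega_comp ?omega_src_comp ?omega_rng_comp.
Qed.
Lemma omega_comp_idl f : omega_comp (omega_idm (omega_rng f)) f = f.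
Proof.
by apply: val_inj; rewrite val_omega_comp ?omega_src_idm //=; case: (val f).
Qed.
Lemma omega_comp_idr f : omega_comp f (omega_idm (omega_src f)) = f.
Proof.
by apply: val_inj; rewrite val_omega_comp ?omega_rng_idm //=; case: (val f).
Qed.

Definition omega_cat : category :=
  @Category omega_mor omega_obj omega_src omega_rng omega_idm omega_comp
    omega_src_idm omega_rng_idm omega_src_comp omega_rng_comp omega_compA
    omega_comp_idl omega_comp_idr.

Lemma omega_deg_idm p : omega_deg (omega_idm p) = 0.
Proof. by apply/ffunP => i; rewrite !ffunE subnn. Qed.

Lemma omega_deg_comp f g : omega_src f = omega_rng g ->
  omega_deg (omega_comp f g) = omega_deg f + omega_deg g.
Proof.
move=> e; rewrite /omega_deg val_omega_comp //=.
have {}e : (val f).2 = (val g).1 by case: e.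
case/andP: (valP f) => h1 _.
by case/andP: (valP g) => h2 _; rewrite -e dsubDd // e.
Qed.

Lemma omega_factorisation f (m n : degree k) : omega_deg f = m + n ->
  exists! p : omega_mor * omega_mor,
    [/\ omega_deg p.1 = m, omega_deg p.2 = n, omega_src p.1 = omega_rng p.2
      & f = omega_comp p.1 p.2].
Proof.
case: f => -[p q] h; have /= /andP[/dleP hpq hq] := h.
rewrite /omega_deg /= => /ffunP e.
have h1 : dle p (p + m) && dlex (p + m) M.
  apply/andP; split; first by apply/dleP => i; rewrite ffunE leq_addr.
  apply: (@dle_dlex _ q) => //; apply/dleP => i.
  by have := e i; have := hpq i; rewrite !ffunE /GRing.add /=; lia.
have h2 : dle (p + m) q && dlex q M.
  rewrite hq andbT; apply/dleP => i.
  by have := e i; have := hpq i; rewrite !ffunE /GRing.add /=; lia.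
exists (exist _ (p, p + m) h1, exist _ (p + m, q) h2); split.
  have es : omega_src (exist _ (p, p + m) h1) =
            omega_rng (exist _ (p + m, q) h2) by exact: val_inj.
  split => //=.
  - by apply/ffunP => i; rewrite !ffunE /GRing.add /=; lia.
  - apply/ffunP => i; have := e i; have := hpq i.
    by rewrite !ffunE /GRing.add /=; lia.
  - by apply: val_inj; rewrite val_omega_comp.
move=> [f g] /= [d1 d2 efg /(congr1 val)]; rewrite val_omega_comp //= => -[].
move: efg => /(congr1 val) /=.
case: f d1 => -[f1 f2] hf d1; case: g d2 => -[g1 g2] hg d2 /= e1 e2 e3.
case/andP: (hf) => /= hf1 _.
rewrite /omega_deg /= in d1; have ef := dsubKC hf1.
rewrite d1 -e2 in ef.
by congr (_, _); apply: val_inj => /=; rewrite -?e1 ef e2 ?e3.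
Qed.

Definition Omega : kgraph k :=
  @KGraph k omega_cat omega_deg omega_deg_idm omega_deg_comp
    omega_factorisation.
End Omega.

(* A graph morphism Omega_{k,m} -> L, bundled with its degree m. *)
Record gpath (k : nat) (L : kgraph k) := GPath {
  gdeg : xdegree k;
  gpath_mor :> graph_morphism (Omega gdeg) L }.

HB.instance Definition _ k (L : kgraph k) := gen_eqMixin (gpath L).
HB.instance Definition _ k (L : kgraph k) := gen_choiceMixin (gpath L).

Section Paths.
Variables (k : nat) (L : kgraph k).
Implicit Types (l m : L) (v : obj L) (x y z : gpath L).

Definition omega0 (M : xdegree k) : obj (Omega M) := exist _ 0 (dlex0 M).

Definition grng x : obj L := gobj x (omega0 (gdeg x)).

Definition is_boundary_path x : Prop :=
  exists2 nx : degree k, dlex nx (gdeg x) &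
    forall (n : obj (Omega (gdeg x))) (i : 'I_k),
      dle nx (val n) -> gdeg x i = Some (val n i) ->
      [set l | rng l = gobj x n /\ deg l = dgen i] = set0.

(* y is the path l x; x(p, q) is gmor x f for the f whose value is (p, q) *)
Definition is_concat l x y : Prop :=
  [/\ gdeg y = daddx (gdeg x) (deg l),
      forall f : Omega (gdeg y), val f = (0, deg l) -> y f = l
    & forall (n : degree k) (f : Omega (gdeg y)) (g : Omega (gdeg x)),
        val f = (deg l, n) -> val g = (0, dsub n (deg l)) -> y f = x g].

(* Equal to x by default, when src l != grng x; see concatP, is_concat_uniq. *)
Definition concat l x : gpath L := xget x [set y | is_concat l x y].

End Paths.

Section Factorisation.
Variables (k : nat) (L : kgraph k).
Implicit Types (l m a b c w : L) (v : obj L).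

Lemma comp_deg_inj a a' b b' : src a = rng b -> src a' = rng b' ->
  deg a = deg a' -> ccomp a b = ccomp a' b' -> a = a' /\ b = b'.
Proof.
move=> h h' e ec.
have d : deg (ccomp a b) = deg a + deg b by rewrite deg_comp.
have d' : deg b' = deg b.
  by move: d; rewrite ec deg_comp // -e => /daddI.
have [p [_ u]] := factorisation d.
have E : (a, b) = (a', b') by rewrite -(u (a, b)) // -(u (a', b')).
by case: E.
Qed.

Lemma deg0_idm a : deg a = 0 -> a = idm (rng a).
Proof.
move=> d.
have [] // := @comp_deg_inj a (idm (rng a)) (idm (src a)) a.
- by rewrite rng_idm.
- by rewrite src_idm.
- by rewrite d deg_idm.
- by rewrite comp_idl comp_idr.
Qed.

Definition midseg w (p q : degree k) b : Prop :=
  exists a c, [/\ src a = rng b, src b = rng c, w = ccomp a (ccomp b c),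
                  deg a = p & deg b = dsub q p].

Lemma midseg_exists w p q : dle p q -> dle q (deg w) -> exists b, midseg w p q b.
Proof.
move=> pq qw.
have d : deg w = p + dsub (deg w) p.
  by apply: dsubKC; exact: dle_trans qw.
have [[a u] [[/= da du s e] _]] := factorisation d.
rewrite -(dsubDd pq qw) in du.
have [[b c] [[/= db dc s' e'] _]] := factorisation du.
exists b, a, c; split => //; last by rewrite e e'.
by rewrite s e' rng_comp.
Qed.

Lemma midseg_uniq w p q b b' : midseg w p q b -> midseg w p q b' -> b = b'.
Proof.
move=> [a [c [s1 s2 -> da db]]] [a' [c' [s1' s2' e da' db']]].
have [_ e2] : a = a' /\ ccomp b c = ccomp b' c'.
  by apply: comp_deg_inj; rewrite ?rng_comp ?da ?da'.
by have [] : b = b' /\ c = c' by apply: comp_deg_inj; rewrite ?db ?db'.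
Qed.

Lemma midseg_compr w u p q b : src w = rng u -> midseg w p q b ->
  midseg (ccomp w u) p q b.
Proof.
move=> s [a [c [s1 s2 e da db]]].
have sc : src c = rng u by rewrite -s e !src_comp ?rng_comp.
exists a, (ccomp c u); split => //; first by rewrite rng_comp.
by rewrite e -!compA ?rng_comp ?src_comp.
Qed.

Lemma midseg_comp w p q r b c : dle p q -> dle q r ->
  midseg w p q b -> midseg w q r c ->
  src b = rng c /\ midseg w p r (ccomp b c).
Proof.
move=> pq qr [a [u [s1 s2 e da db]]] [a' [u' [s1' s2' e' da' db']]].
have e2 : ccomp (ccomp a b) u = ccomp a' (ccomp c u').
  by rewrite -e' -compA.
have [e3 e4] : ccomp a b = a' /\ u = ccomp c u'.
  by apply: comp_deg_inj; rewrite ?src_comp ?rng_comp ?deg_comp ?da ?db ?da' -?dsubKC.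
have s : src b = rng c by rewrite s2 e4 rng_comp.
split=> //; exists a, u'; split => //; rewrite ?rng_comp ?src_comp //.
- by rewrite -compA // e e4.
- by rewrite deg_comp // db db' dsubDd.
Qed.

Lemma midseg_idl w p q b : midseg w p q b -> midseg w p p (idm (rng b)).
Proof.
move=> [a [c [s1 s2 e da db]]]; exists a, (ccomp b c).
split; rewrite ?rng_idm ?src_idm ?rng_comp //.
- by rewrite -(rng_comp s2) comp_idl.
- by rewrite deg_idm; apply/ffunP => i; rewrite !ffunE subnn.
Qed.

Lemma midseg_idr w p q b : dle p q -> midseg w p q b ->
  midseg w q q (idm (src b)).
Proof.
move=> pq [a [c [s1 s2 e da db]]]; exists (ccomp a b), c.
split; rewrite ?rng_idm ?src_idm ?src_comp //.
- by rewrite s2 comp_idl -compA.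
- by rewrite deg_comp // da db -dsubKC.
- by rewrite deg_idm; apply/ffunP => i; rewrite !ffunE subnn.
Qed.

Lemma graph_morphism_ext (G : kgraph k) (f g : graph_morphism G L) :
  gmor f =1 gmor g -> f = g.
Proof.
case: f g => [fo fm fs fr fi fc fd] [go gm gs gr gi gc gd] /= /funext e.
move: gs gr gi gc gd; rewrite -e => gs gr gi gc gd.
have eo : fo = go.
  by apply: funext => v; rewrite -[v]src_idm -fs -gs.
move: gs gr gi gc gd; rewrite -eo => gs gr gi gc gd.
by congr GraphMorphism; exact: Prop_irrelevance.
Qed.

End Factorisation.

Section Concat.
Variables (k : nat) (L : kgraph k) (l : L) (x : gpath L).
Hypothesis lx : src l = grng x.

Let M := gdeg x.
Let N := daddx M (deg l).

Definition omk (K : xdegree k) (p q : degree k) (h : dle p q)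
  (h' : dlex q K) : Omega K := exist _ (p, q) (introT andP (conj h h')).

Lemma gmor_omk (K : xdegree k) (y : graph_morphism (Omega K) L) (p q r : degree k)
    (hpq : dle p q) (hqr : dle q r) (hpr : dle p r)
    (hq : dlex q K) (hr : dlex r K) :
  src (y (omk hpq hq)) = rng (y (omk hqr hr)) /\
  y (omk hpr hr) = ccomp (y (omk hpq hq)) (y (omk hqr hr)).
Proof.
have s : src (omk hpq hq : Omega K) = rng (omk hqr hr : Omega K).
  exact: val_inj.
split; first by rewrite gmor_src gmor_rng s.
rewrite -gmor_comp //; congr (y _); apply: val_inj => /=.
by rewrite val_omega_comp.
Qed.

Let otop (q : degree k) : degree k := dsub q (deg l).

Let otop_le (p q : degree k) : dle p q -> dle (otop p) (otop q).
Proof.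
by move=> /dleP h; apply/dleP => i; rewrite !ffunE; apply: leq_sub2r.
Qed.

Let otop_lex q : dlex q N -> dlex (otop q) M.
Proof.
move=> /dlexP h; apply/dlexP => i b e; rewrite !ffunE.
by have := h i (b + deg l i)%N; rewrite ffunE e /= => /(_ erefl); lia.
Qed.

Let stem (q : omega_obj N) : L :=
  ccomp l (x (omk (dle0 (otop (val q))) (otop_lex (valP q)))).

Let stem_src (q : omega_obj N) :
  src l = rng (x (omk (dle0 (otop (val q))) (otop_lex (valP q)))).
Proof. by rewrite lx gmor_rng /grng; congr gobj; exact: val_inj. Qed.

Let stem_deg (q : omega_obj N) : dle (val q) (deg (stem q)).
Proof.
apply/dleP => i; rewrite /stem deg_comp ?gmor_deg; last exact: stem_src.
by rewrite ffunE [deg (omk _ _)]/= /omega_deg !ffunE /GRing.add /=; lia.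
Qed.

Let stem_comp (p q : omega_obj N) : dle (val p) (val q) ->
  exists u, src (stem p) = rng u /\ stem q = ccomp (stem p) u.
Proof.
move=> pq; rewrite /stem.
have [s e] := gmor_omk x (dle0 (otop (val p))) (otop_le pq)
  (dle0 (otop (val q))) (otop_lex (valP p)) (otop_lex (valP q)).
exists (x (omk (otop_le pq) (otop_lex (valP q)))).
by rewrite e compA ?src_comp ?stem_src.
Qed.

Let seg_exists (f : omega_mor N) :
  exists b, midseg (stem (omega_src f)) (val f).1 (val f).2 b.
Proof.
case/andP: (valP f) => pq _.
by apply: midseg_exists => //; exact: (stem_deg (omega_src f)).
Qed.

Let seg (f : omega_mor N) : L := sval (cid (seg_exists f)).

Let segP (f : omega_mor N) :
  midseg (stem (omega_src f)) (val f).1 (val f).2 (seg f).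
Proof. exact: svalP (cid (seg_exists f)). Qed.

Let segW (f : omega_mor N) (q : omega_obj N) : dle (val f).2 (val q) ->
  midseg (stem q) (val f).1 (val f).2 (seg f).
Proof.
move=> fq; have [u [s ->]] := @stem_comp (omega_src f) q fq.
by apply: midseg_compr => //; exact: segP.
Qed.

Let seg_rng_idm (f : omega_mor N) : seg (omega_idm (omega_rng f)) = idm (rng (seg f)).
Proof.
apply: midseg_uniq (midseg_idl (segP f)).
by apply: segW; case/andP: (valP f).
Qed.

Let seg_src_idm (f : omega_mor N) : seg (omega_idm (omega_src f)) = idm (src (seg f)).
Proof.
case/andP: (valP f) => pq _.
apply: midseg_uniq (midseg_idr pq (segP f)).
by apply: segW; exact: dlexx.
Qed.

Let sobj (p : omega_obj N) : obj L := rng (seg (omega_idm p)).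

Let seg_rng f : rng (seg f) = sobj (omega_rng f).
Proof. by rewrite /sobj seg_rng_idm rng_idm. Qed.

Let seg_src f : src (seg f) = sobj (omega_src f).
Proof. by rewrite /sobj seg_src_idm rng_idm. Qed.

Let seg_idm p : seg (omega_idm p) = idm (sobj p).
Proof. by rewrite /sobj -seg_rng_idm omega_rng_idm. Qed.

Let seg_comp f g : omega_src f = omega_rng g ->
  seg (omega_comp f g) = ccomp (seg f) (seg g).
Proof.
move=> s; have e : (val f).2 = (val g).1 by case: s.
case/andP: (valP f) => pq _; case/andP: (valP g) => qr _.
apply: midseg_uniq (segP _) _; rewrite omega_src_comp // val_omega_comp //=.
have sg : midseg (stem (omega_src g)) (val f).2 (val g).2 (seg g).
  by rewrite e; exact: segP.
have sf : midseg (stem (omega_src g)) (val f).1 (val f).2 (seg f).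
  by apply: segW => /=; rewrite e.
by have [] := midseg_comp pq _ sf sg; rewrite ?e.
Qed.

Let seg_deg f : deg (seg f) = omega_deg f.
Proof. by have [a [c []]] := segP f. Qed.

Let concat_mor : graph_morphism (Omega N) L :=
  @GraphMorphism k (Omega N) L sobj seg seg_src seg_rng seg_idm seg_comp seg_deg.

Lemma concat_exists : exists y, is_concat l x y.
Proof.
exists (GPath concat_mor); split => //=.
- move=> f ef; apply: midseg_uniq (segP f) _.
  have -> : val (f : omega_mor N) = (0, deg l) by exact: ef.
  exists (idm (rng l)), (x (omk (dle0 (otop (val (omega_src f))))
                              (otop_lex (valP (omega_src f))))).
  split; rewrite ?src_idm ?deg_idm //.
    by rewrite -(rng_comp (stem_src (omega_src f))) comp_idl.
  by apply/ffunP => i; rewrite !ffunE subn0.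
- move=> n f g ef eg; apply: midseg_uniq (segP f) _.
  have e : val (f : omega_mor N) = (deg l, n) by exact: ef.
  have [e1 e2] : (val (f : omega_mor N)).1 = deg l /\ (val (f : omega_mor N)).2 = n by rewrite e.
  rewrite e1 e2.
  have -> : g = omk (dle0 (otop (val (omega_src f)))) (otop_lex (valP (omega_src f))).
    by apply: val_inj; rewrite [LHS]eg /= e2.
  exists l, (idm (src (x (omk (dle0 (otop (val (omega_src f))))
                              (otop_lex (valP (omega_src f))))))).
  split; rewrite ?rng_idm ?comp_idr //.
  by rewrite gmor_deg -e2; apply/ffunP => i; rewrite ffunE [X in (_ - X)%N]ffunE subn0.
Qed.

Let concat_mid (y : graph_morphism (Omega N) L) (f : omega_mor N) :
  is_concat l x (GPath y) -> midseg (stem (omega_src f)) (val f).1 (val f).2 (y f).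
Proof.
case=> _ /= y1 y2; case/andP: (valP f) => pq qN.
set q := (val f).2.
have [qt dt] : dle q (dmax q (deg l)) /\ dle (deg l) (dmax q (deg l)).
  by split; apply/dleP => i; rewrite ffunE ?leq_maxl ?leq_maxr.
have tN : dlex (dmax q (deg l)) N.
  apply/dlexP => i b; rewrite /N ffunE.
  case E: (M i) => [c|] //= -[<-]; rewrite ffunE geq_max leq_addl andbT.
  by have /dlexP := qN; apply; rewrite /N ffunE E.
have lN : dlex (deg l) N by exact: dle_dlex tN.
have [_ e1] := gmor_omk y (dle0 _) dt (dle0 _) lN tN.
have [s2 e2] := gmor_omk y pq qt (dle_trans pq qt) qN tN.
have [s3 e3] := gmor_omk y (dle0 _) (dle_trans pq qt) (dle0 _)
  (dle_dlex pq qN) tN.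
have -> : f = omk pq qN by apply: val_inj; rewrite /=; case: (val f).
exists (y (omk (dle0 _) (dle_dlex pq qN))), (y (omk qt tN)).
split=> //.
- by rewrite s3 e2 rng_comp.
- rewrite -e2 -e3 e1 (y1 (omk _ _)) // /stem; congr ccomp.
  apply/esym/(y2 (dmax q (deg l))) => //=; congr (_, _).
  by apply/ffunP => i; rewrite !ffunE /=; rewrite -/q; lia.
- by rewrite gmor_deg /= /omega_deg /=; apply/ffunP => i; rewrite !ffunE subn0.
- by rewrite gmor_deg.
Qed.

Lemma is_concat_uniq y z : is_concat l x y -> is_concat l x z -> y = z.
Proof.
case: y => K y yc; have [/= eK _ _] := yc; subst K.
case: z => K z zc; have [/= eK _ _] := zc; subst K.
congr GPath; apply: graph_morphism_ext => f.
exact: midseg_uniq (concat_mid f yc) (concat_mid f zc).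
Qed.

Lemma concatP : is_concat l x (concat l x).
Proof. by have [y yc] := concat_exists; exact: (@xgetPex _ x _ (ex_intro _ y yc)). Qed.

End Concat.

Section CuntzKrieger.
Variables (k : nat) (L : kgraph k).
Implicit Types (l m : L) (v : obj L).

Definition Lmin l m : set (L * L) :=
  [set p | [/\ src l = rng p.1, src m = rng p.2, ccomp l p.1 = ccomp m p.2
             & deg (ccomp l p.1) = dmax (deg l) (deg m)]].

Definition finitely_aligned : Prop := forall l m, finite_set (Lmin l m).

Definition exhaustive v (E : set L) : Prop :=
  E `<=` [set l | rng l = v] /\
  forall m, rng m = v -> exists2 l, E l & Lmin l m !=set0.
End CuntzKrieger.

(* C*-algebras need not be unital, hence are not instances of the library's
   ring and algebra structures. *)
HB.mixin Record NormedModule_isCStar (R : realType) A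
    of CompleteNormedModule R[i] A := {
  cmul : A -> A -> A;
  cadj : A -> A;
  cmulA : associative cmul;
  cmulDl : left_distributive cmul +%R;
  cmulDr : right_distributive cmul +%R;
  cmulZl : forall (z : R[i]) (a b : A), cmul (z *: a) b = z *: cmul a b;
  cmulZr : forall (z : R[i]) (a b : A), cmul a (z *: b) = z *: cmul a b;
  cnormM : forall a b : A, `|cmul a b| <= `|a| * `|b|;
  cadjK : involutive cadj;
  cadjD : {morph cadj : a b / a + b};
  cadjZ : forall (z : R[i]) (a : A), cadj (z *: a) = z^* *: cadj a;
  cadjM : forall a b : A, cadj (cmul a b) = cmul (cadj b) (cadj a);
  cnorm_adj : forall a : A, `|cmul (cadj a) a| = `|a| ^+ 2 }.

#[short(type="cstarAlgType")]
HB.structure Definition CStarAlgebra (R : realType) :=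
  { A of CompleteNormedModule R[i] A & NormedModule_isCStar R A }.

Notation "a ** b" := (cmul a b) (at level 40, left associativity).
Notation "a ^†" := (cadj a) (at level 2, format "a ^†").

Section CStar.
Variable R : realType.
Implicit Types A B : cstarAlgType R.

Definition is_cstar_subalgebra A (S : set A) : Prop :=
  [/\ closed S,
      S 0,
      (forall (z : R[i]) a b, S a -> S b -> S (z *: a + b)),
      (forall a b, S a -> S b -> S (a ** b))
    & (forall a, S a -> S (a^†))].

Definition cstar_generated A (G : set A) : set A :=
  smallest (@is_cstar_subalgebra A) G.

(* *-isomorphism of the C*-subalgebra S onto the C*-subalgebra T; the values
   of phi outside S are irrelevant. *)
Definition is_cstar_iso A B (S : set A) (T : set B) (phi : A -> B) : Prop :=
  [/\ set_bij S T phi,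
      (forall (z : R[i]) a b, S a -> S b -> phi (z *: a + b) = z *: phi a + phi b),
      (forall a b, S a -> S b -> phi (a ** b) = phi a ** phi b)
    & (forall a, S a -> phi (a^†) = (phi a)^†)].

Definition is_projection A (a : A) : Prop := a^† = a /\ a ** a = a.

Definition is_partial_isometry A (a : A) : Prop := a ** a^† ** a = a.

(* Product of a nonempty sequence.  There is no unit to give the empty product;
   the value 0 is never used below, as the empty set is not exhaustive. *)
Definition cprod A (s : seq A) : A :=
  if s is a :: s' then foldl cmul a s' else 0.

(* The sum in CK_min is a finite one when L is finitely aligned. *)
Record CK_family (k : nat) (L : kgraph k) A (t : L -> A) : Prop := {
  CK_pisom : forall l, is_partial_isometry (t l);
  CK_proj : forall v, is_projection (t (idm v));
  CK_orth : forall v w, v <> w -> t (idm v) ** t (idm w) = 0;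
  CK_comp : forall l m, src l = rng m -> t l ** t m = t (ccomp l m);
  CK_min : forall l m,
    (t l)^† ** t m = \sum_(p \in Lmin l m) (t p.1 ** (t p.2)^†);
  CK_exhaustive : forall v (E : {fset L}), exhaustive v [set` E] ->
    cprod [seq t (idm v) - t l ** (t l)^† | l <- enum_fset E] = 0 }.
End CStar.

(* Main.v *)
(* Uniqueness.  For finite sums a of elements t_l t_m^* the norm of a is shown
   not to depend on the family.  Let N, N' be the norms coming from two families
   with non-zero vertex projections, and let a_n be the part of a of degree n.
   Then N(a_n) <= N'(a): the element x = a_n^* a_n is of degree 0, hence acts on
   the finitely many products t_b R, where b runs over a finite set of paths
   closed under minimal common extensions and R is the projection off the proper
   extensions of b in that set.  If R is non-zero, relation (iv) yields a path c
   off these extensions; aperiodicity lets us choose d so that the partial isometries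
   V_b = t'_(b c d) have orthogonal ranges, and x has the same matrix on the
   t_b R and on the V_b, where compressions by projections bound it by N'(a)^2.
   So N(x^q) <= C N'(a)^(2q) with C independent of q, and for self-adjoint x and
   q a power of 2 the C*-identity removes C.
   For h = a^* a, the number of degrees occurring in h^m grows polynomially, so
   N(h)^m <= sum_n N((h^m)_n) <= poly(m) N'(h)^m, and again N(h) <= N'(h).
   This replaces gauge actions, conditional expectations and functional calculus.

   Existence.  The operators delta_U |-> delta_(l U) on the l^2-space of the
   tight filters U of paths form a Cuntz-Krieger family; the initial segments of
   a boundary path form such a filter, so the vertex projections do not vanish. *)

From HB Require Import structures.
From mathcomp Require Import all_boot all_order all_algebra.
From mathcomp Require Import finmap.
From mathcomp Require Import all_classical all_reals all_analysis.
From mathcomp Require Import complex zify ring lra.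
Require Import Defs.

Set Implicit Arguments.
Unset Strict Implicit.
Unset Printing Implicit Defensive.

Import Order.TTheory GRing.Theory Num.Theory.
Import numFieldNormedType.Exports.

Local Open Scope classical_set_scope.
Local Open Scope ring_scope.

(** * Degrees and paths *)

(** The finite set of paths needs more than minimal common extensions: if m e is a minimal extension
    of m and s, and l has the source and degree of m, then l e must belong to it too. Then the
    extensions removed by R depend only on the source and degree of b, so a term t_g t_d^* with g
    and d of equal degree sends t_b R to 0 or to t_c R with the same R. The closure stays finite
    because its steps never leave the box of degrees below a common bound. The component a_n is
    reached through the whole sum a: on the span of the V_b, a_n is a compressed between the
    projection onto that span and the projection onto the vectors of degree deg b + n. Aperiodicity
    has to separate the paths in both ranges, hence also the images of the b under all terms of a.
    For existence, filters are plain sets of paths, so removing and adding an initial segment are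
    mutually inverse partial bijections of sets, free of the dependence of a graph morphism on its
    degree. *)

Section Degrees.
Variable k : nat.
Implicit Types m n p q : degree k.

Lemma daddE m n i : (m + n) i = (m i + n i)%N.
Proof. by rewrite ffunE. Qed.

Lemma dle_addr m n : dle m (m + n).
Proof. by apply/dleP => i; rewrite daddE leq_addr. Qed.

Lemma dle_maxl m n : dle m (dmax m n).
Proof. by apply/dleP => i; rewrite ffunE leq_maxl. Qed.

Lemma dle_maxr m n : dle n (dmax m n).
Proof. by apply/dleP => i; rewrite ffunE leq_maxr. Qed.

Lemma dmax_le m n p : dle m p -> dle n p -> dle (dmax m n) p.
Proof.
by move=> /dleP h1 /dleP h2; apply/dleP => i; rewrite ffunE geq_max h1 h2.
Qed.

Lemma dle_anti m n : dle m n -> dle n m -> m = n.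
Proof.
move=> /dleP h1 /dleP h2; apply/ffunP => i.
by apply/eqP; rewrite eqn_leq h1 h2.
Qed.

Lemma dmaxC m n : dmax m n = dmax n m.
Proof. by apply/ffunP => i; rewrite !ffunE maxnC. Qed.

Lemma dmax_idPr m n : dle m n -> dmax m n = n.
Proof.
by move=> h; apply: dle_anti; rewrite ?dle_maxr// dmax_le// dlexx.
Qed.

Lemma daddIr m n p : m + p = n + p -> m = n.
Proof. by rewrite addrC (addrC n) => /daddI. Qed.

Definition dsum n : nat := \sum_i n i.

Lemma dsumD m n : dsum (m + n) = (dsum m + dsum n)%N.
Proof. by rewrite /dsum -big_split; apply: eq_bigr => i _; rewrite daddE. Qed.

Lemma dsum_le m n : dle m n -> (dsum m <= dsum n)%N.
Proof. by move=> /dleP h; exact: leq_sum. Qed.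

Lemma dsum0P n : dsum n = 0%N -> n = 0.
Proof.
move=> /eqP; rewrite sum_nat_eq0 => /forallP h; apply/ffunP => i.
by rewrite ffunE; apply/eqP/h.
Qed.

Lemma finite_dle m : finite_set [set p | dle p m].
Proof.
pose M := (dsum m).+1.
pose f (g : {ffun 'I_k -> 'I_M}) : degree k := [ffun i => nat_of_ord (g i)].
apply: (@sub_finite_set _ _ (range f)); last first.
  exact/finite_image/finite_finset.
move=> p /= /dleP h.
have hM i : (p i < M)%N.
  by rewrite ltnS (leq_trans (h i))// /dsum (bigD1 i)//= leq_addr.
by exists [ffun i => Ordinal (hM i)] => //; apply/ffunP => i; rewrite !ffunE.
Qed.
End Degrees.

(** * Initial segments and minimal common extensions *)

Section Paths.
Variables (k : nat) (L : kgraph k).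
Implicit Types (a b c d e l m w z : L) (v : obj L).

Lemma ccompI a b b' : src a = rng b -> src a = rng b' ->
  ccomp a b = ccomp a b' -> b = b'.
Proof. by move=> h h' /(comp_deg_inj h h' erefl)[]. Qed.

Lemma ccompIr a a' b : src a = rng b -> src a' = rng b ->
  ccomp a b = ccomp a' b -> a = a'.
Proof.
move=> h h' E; have [|//] := comp_deg_inj h h' _ E.
by have := congr1 (@deg _ _) E; rewrite !deg_comp// => /daddIr.
Qed.

Lemma deg_compl a b : src a = rng b -> dle (deg a) (deg (ccomp a b)).
Proof. by move=> h; rewrite deg_comp// dle_addr. Qed.

Lemma deg_ccomp0 a b : src a = rng b -> deg (ccomp a b) = deg a ->
  b = idm (src a).
Proof.
move=> h; rewrite deg_comp// -[RHS]addr0 => /daddI /deg0_idm ->.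
by rewrite h.
Qed.

Definition initial a w := exists2 b, src a = rng b & w = ccomp a b.

Lemma initial_ccomp a b : src a = rng b -> initial a (ccomp a b).
Proof. by exists b. Qed.

Lemma initial_refl a : initial a a.
Proof. by exists (idm (src a)); rewrite ?rng_idm ?comp_idr. Qed.

Lemma initial_idm a : initial (idm (rng a)) a.
Proof. by exists a; rewrite ?src_idm ?comp_idl. Qed.

Lemma initial_trans a b c : initial a b -> initial b c -> initial a c.
Proof.
move=> [d h ->] [e]; rewrite src_comp// => h' ->.
by exists (ccomp d e); rewrite ?rng_comp ?compA.
Qed.

Lemma initial_rng a w : initial a w -> rng w = rng a.
Proof. by move=> [b h ->]; rewrite rng_comp. Qed.

Lemma initial_deg a w : initial a w -> dle (deg a) (deg w).
Proof. by move=> [b h ->]; exact: deg_compl. Qed.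

Lemma initial_exists w p : dle p (deg w) -> exists2 a, deg a = p & initial a w.
Proof.
move=> /dsubKC /factorisation[[a b] [[/= da _ h ->] _]].
by exists a => //; exists b.
Qed.

Lemma initial_uniq a a' w : initial a w -> initial a' w -> deg a = deg a' ->
  a = a'.
Proof. by move=> [b h ->] [b' h' E] /(comp_deg_inj h h')[]. Qed.

Lemma initial_le a b w : initial a w -> initial b w -> dle (deg a) (deg b) ->
  initial a b.
Proof.
move=> aw bw /initial_exists[a' da' a'b].
by rewrite (initial_uniq aw (initial_trans a'b bw)).
Qed.

Lemma initial_cancel a b c : src a = rng b -> src a = rng c ->
  initial (ccomp a b) (ccomp a c) -> initial b c.
Proof.
move=> ab ac [d]; rewrite src_comp// => bd.
rewrite -compA// => /ccompI -> //; first exact: initial_ccomp.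
by rewrite rng_comp.
Qed.

Lemma initial_ccompl a b c : src a = rng c -> initial b c ->
  initial (ccomp a b) (ccomp a c).
Proof.
move=> ac bc; have ab : src a = rng b by rewrite ac (initial_rng bc).
case: bc => d bd ->; rewrite compA//.
by apply: initial_ccomp; rewrite src_comp.
Qed.

(** The initial segment of w whose degree is the join of deg l and deg m extends both paths, so
    every common extension contains a minimal one. *)
Lemma initial_min l m w : initial l w -> initial m w ->
  exists e z, Lmin l m (e, z) /\ initial (ccomp l e) w.
Proof.
move=> lw mw.
have [c dc cw] := initial_exists (dmax_le (initial_deg lw) (initial_deg mw)).
have [e le ce] : initial l c by apply: (initial_le lw cw); rewrite dc dle_maxl.
have [z mz cz] : initial m c by apply: (initial_le mw cw); rewrite dc dle_maxr.
by exists e, z; split; first split; rewrite /= -?ce -?cz.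
Qed.

(** Equivalent to [Lmin l m !=set0]; with the degree left free, it passes to initial segments by
    transitivity alone. *)
Definition compatible l m := exists2 w, initial l w & initial m w.

Lemma Lmin_compatible l m p : Lmin l m p -> compatible l m.
Proof.
move=> [h1 h2 E _]; exists (ccomp l p.1); first exact: initial_ccomp.
by rewrite E; exact: initial_ccomp.
Qed.

Lemma compatible_Lmin l m : compatible l m -> Lmin l m !=set0.
Proof. by move=> [w h1 h2]; have [e [z []]] := initial_min h1 h2; exists (e, z). Qed.

Lemma incompatible_Lmin l m : ~ compatible l m -> Lmin l m = set0.
Proof. by move=> h; rewrite -subset0 => p /Lmin_compatible. Qed.

Lemma compatible_initial l m c : compatible l m -> initial c m -> compatible l c.
Proof. by move=> [w h1 h2] h; exists w => //; exact: initial_trans h2. Qed.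

Lemma Lmin_sym l m e z : Lmin l m (e, z) -> Lmin m l (z, e).
Proof. by case=> /= h1 h2 E d; split => //=; rewrite -E dmaxC. Qed.

Lemma Lmin_initial d c : src d = rng c ->
  Lmin d (ccomp d c) = [set (c, idm (src c))].
Proof.
move=> dc; apply/seteqP; split => [[e z] [/= h1 h2 E D]|p -> /=].
  have zE : z = idm (src c).
    rewrite -(src_comp dc); apply: deg_ccomp0 => //.
    by rewrite -E D dmax_idPr// deg_compl.
  congr pair => //; apply: (ccompI h1 dc).
  by rewrite E zE -(src_comp dc) comp_idr.
split; rewrite /= ?rng_idm ?src_comp//.
  by rewrite -(src_comp dc) comp_idr.
by rewrite dmax_idPr// deg_compl.
Qed.

Lemma Lmin_refl d : Lmin d d = [set (idm (src d), idm (src d))].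
Proof.
by rewrite -{2}(comp_idr d) Lmin_initial ?rng_idm// src_idm.
Qed.

Lemma compatible_ccompl a b c : src a = rng b -> src a = rng c ->
  compatible (ccomp a b) (ccomp a c) -> compatible b c.
Proof.
move=> ab ac [w]; move=> bw cw.
have [d ad wE] : initial a w.
  by apply: initial_trans bw; exact: initial_ccomp.
move: bw cw; rewrite wE => /initial_cancel bw /initial_cancel cw.
by exists d; [exact: bw|exact: cw].
Qed.

End Paths.

(** * Finite sets closed under minimal common extensions *)

Section MinClosure.
Variables (k : nat) (L : kgraph k) (hfa : finitely_aligned L).
Implicit Types (a b c e l m s t w x y z : L).

(** The case l = m is closure under minimal common extensions. If z is a vertex, then s = m e, and
    closure says that an initial segment m of s may be replaced by l; this keeps the paths stable
    under t_l t_m^*. *)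
Definition min_closed (G : set L) := forall l m s e z, G l -> G m -> G s ->
  src l = src m -> deg l = deg m -> Lmin m s (e, z) -> G (ccomp l e).

(** A suffix is determined by the degree of the prefix it completes, and finitely many degrees lie
    below that of e. *)
Lemma finite_suffix e : finite_set [set z | exists2 w, src w = rng z & e = ccomp w z].
Proof.
pose f p := xget e [set z | exists w, [/\ deg w = p, src w = rng z & e = ccomp w z]].
apply: (@sub_finite_set _ _ (f @` [set p | dle p (deg e)])); last first.
  exact/finite_image/finite_dle.
move=> z [w wz ez]; exists (deg w) => /=; first by rewrite ez deg_compl.
rewrite /f; case: xgetP => [y -> [w' [dw w'y ey]]|/(_ z)]; last first.
  by move=> [] //; exists w.
by have [] := comp_deg_inj w'y wz dw (etrans (esym ey) ez).
Qed.

Lemma Lmin_deg m s e z : Lmin m s (e, z) ->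
  deg (ccomp m e) = dmax (deg m) (deg s).
Proof. by case. Qed.

Lemma Lmin_src m s e z : Lmin m s (e, z) -> src m = rng e.
Proof. by case. Qed.

Let closed_below (d : nat) (H : set L) := forall l m s e z, H l -> H m -> H s ->
  src l = src m -> deg l = deg m -> Lmin m s (e, z) ->
  (dsum (deg (ccomp l e)) < d)%N -> H (ccomp l e).

Let deg_swap l m e : src l = src m -> deg l = deg m -> src m = rng e ->
  deg (ccomp l e) = deg (ccomp m e).
Proof. by move=> h h' h2; rewrite !deg_comp ?h ?h'. Qed.

(* [H] is a closure of the paths of [E] of total degree below [d].  The paths
   of total degree [d] to be added are those of [E] (set [Ed]), their images
   when an initial segment in a lower pair is replaced ([T]), and the common
   extensions of two lower paths ([K]); no further path of total degree [d]
   arises from these. *)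
Lemma min_closure_step (E H : set L) (N : degree k) (d : nat) :
  finite_set E -> E `<=` [set e | dle (deg e) N] ->
  finite_set H -> H `<=` [set e | dle (deg e) N] ->
  H `<=` [set e | (dsum (deg e) < d)%N] ->
  E `&` [set e | (dsum (deg e) < d)%N] `<=` H ->
  closed_below d H ->
  exists H' : set L, [/\ finite_set H', H' `<=` [set e | dle (deg e) N],
    H' `<=` [set e | (dsum (deg e) < d.+1)%N],
    E `&` [set e | (dsum (deg e) < d.+1)%N] `<=` H' & closed_below d.+1 H'].
Proof.
move=> finE EN finH HN Hd EH Hcl.
pose Ed := E `&` [set e | dsum (deg e) = d].
pose T := [set x | exists y z w, [/\ H y, src y = rng z, src w = rng z,
  deg y = deg w & Ed (ccomp w z) /\ x = ccomp y z]].
pose K := [set x | exists t s y b c, [/\ H t, H s, H y &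
  [/\ src t = src s, deg t = deg s, Lmin s y (b, c), dsum (deg x) = d &
   x = ccomp t b]]].
pose H' := H `|` Ed `|` T `|` K.
have Kd x : K x -> dsum (deg x) = d by move=> [? [? [? [? [? [_ _ _ []]]]]]].
have Td x : T x -> dsum (deg x) = d.
  move=> [y [z [w [_ yz wz D [[_ <-] ->]]]]].
  by rewrite !deg_comp// D.
have H'lt x : H' x -> (dsum (deg x) < d)%N -> H x.
  by move=> [[[//|[_ /= ->]]|/Td ->]|/Kd ->]; rewrite ltnn.
exists H'; split.
- rewrite !finite_setU; split; [split; [split=> //|]|].
  + exact: finite_setIl.
  + apply: (@sub_finite_set _ _ ((fun p => ccomp p.1 p.2) @`
      (H `*` (\bigcup_(e in Ed) [set z | exists2 w, src w = rng z & e = ccomp w z])))).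
      move=> x [y [z [w [Hy yz wz D [Ew ->]]]]]; exists (y, z) => //; split => //.
      by exists (ccomp w z) => //; exists w.
    apply: finite_image; apply: finite_setX => //; apply: bigcup_finite.
      exact: finite_setIl.
    by move=> e _; exact: finite_suffix.
  + apply: (@sub_finite_set _ _ ((fun p => ccomp p.1 p.2) @`
      (H `*` (\bigcup_(p in H `*` H) (fst @` Lmin p.1 p.2))))).
      move=> x [t [s [y [b [c [Ht Hs Hy [_ _ M _ ->]]]]]]].
      exists (t, b) => //; split => //; exists (s, y) => //; by exists (b, c).
    apply: finite_image; apply: finite_setX => //; apply: bigcup_finite.
      exact: finite_setX.
    by move=> p _; apply: finite_image; exact: hfa.
- move=> x [[[/HN//|[/EN//]]|]|].
  + move=> [y [z [w [_ yz wz D [[/EN h _] ->]]]]] /=.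
    by move: h => /=; rewrite !deg_comp// D.
  + move=> [t [s [y [b [c [Ht Hs Hy [ts D M _ ->]]]]]]] /=.
    rewrite (deg_swap ts D (Lmin_src M)) (Lmin_deg M).
    by apply: dmax_le; apply: HN.
- by move=> x [[[/Hd/ltnW//|[_ /= ->]]|/Td /= ->]|/Kd /= ->] /=.
- move=> e [Ee /=]; rewrite ltnS leq_eqVlt => /orP[/eqP h|h].
    by left; left; right.
  by left; left; left; exact: EH.
move=> l m s e z H'l H'm H's lm D M; have me := Lmin_src M.
have degE := deg_swap lm D me.
have dm : (dsum (deg m) <= dsum (deg (ccomp l e)))%N.
  by rewrite degE; apply: dsum_le; exact: deg_compl.
have ds : (dsum (deg s) <= dsum (deg (ccomp l e)))%N.
  by rewrite degE (Lmin_deg M); apply: dsum_le; exact: dle_maxr.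
rewrite ltnS leq_eqVlt => /orP[/eqP tot|tot]; last first.
  have Hm := H'lt _ H'm (leq_ltn_trans dm tot).
  have Hs := H'lt _ H's (leq_ltn_trans ds tot).
  have Hl : H l by apply: H'lt => //; rewrite D; exact: leq_ltn_trans dm tot.
  by left; left; left; exact: (Hcl _ _ _ _ _ Hl Hm Hs lm D M).
(* If m already has total degree d, then e is a vertex and l e = l. *)
move: dm; rewrite tot leq_eqVlt => /orP[/eqP dm|dm].
  have : dsum (deg e) = 0%N.
    by move: tot; rewrite degE deg_comp// dsumD dm; lia.
  by move=> /dsum0P /deg0_idm ->; rewrite -me -lm comp_idr.
have Hm := H'lt _ H'm dm.
have Hl : H l by apply: H'lt => //; rewrite D.
move: ds; rewrite tot leq_eqVlt => /orP[/eqP ds|ds]; last first.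
  have Hs := H'lt _ H's ds.
  by right; exists l, m, s, e, z; split.
have sz : z = idm (src s).
  have [_ sz E0 _] := M; apply: deg_ccomp0 => //; rewrite -E0 /= -degE.
  apply/esym/dle_anti; first by rewrite degE (Lmin_deg M) dle_maxr.
  apply/dleP => i; rewrite leqNgt; apply/negP => lt.
  have hle : forall j, (deg s j <= deg (ccomp l e) j)%N.
    by apply/dleP; rewrite degE (Lmin_deg M) dle_maxr.
  have : (dsum (deg s) < dsum (deg (ccomp l e)))%N.
    by rewrite /dsum (bigD1 i)//= [X in (_ < X)%N](bigD1 i)//= -addSn leq_add// leq_sum.
  by rewrite ds tot ltnn.
have sE : s = ccomp m e by have [_ _ /= -> _] := M; rewrite sz comp_idr.
(* The path s = m e has total degree d, so it was added at this stage, in one of three ways. *)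
have [[[/Hd /=|Eds]|Ts]|Ks] := H's; first by rewrite ds ltnn.
- left; right; exists l, e, m; split=> //; first by rewrite lm.
  by rewrite -sE.
(* Here s = y x with w x in [Ed]. Let m th = y eta be the minimal common extension inside s. If it
   is all of s, then l e is built from the lower paths l, m, y and lies in [K]. Otherwise l th is in
   H, and l e = (l th) z2 replaces w eta in w x, so it lies in [T]. *)
- have [y [x [w [Hy yx wx Dyw [Edw sE']]]]] := Ts.
  have im : initial m s by rewrite sE; exact: initial_ccomp.
  have iy : initial y s by rewrite sE'; exact: initial_ccomp.
  have [th [eta [M' [z2]]]] := initial_min im iy.
  have mth := Lmin_src M'; rewrite src_comp// => thz.
  rewrite {1}sE -compA// => /ccompI eE; have {}eE : e = ccomp th z2.
    by apply: eE; rewrite ?rng_comp.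
  have [_ /= yeta E1 E2] := M'.
  have z2eta : src eta = rng z2.
    by rewrite -(src_comp yeta) -E1 src_comp.
  have xE : x = ccomp eta z2.
    apply: (@ccompI _ _ y) => //; first by rewrite rng_comp.
    by rewrite compA// -E1 -sE' sE eE compA.
  have H1 : dsum (deg (ccomp l th)) = dsum (deg (ccomp m th)).
    by rewrite (deg_swap lm D mth).
  have : (dsum (deg (ccomp m th)) <= d)%N.
    rewrite -tot degE; apply: dsum_le; rewrite eE compA//.
    by apply: deg_compl; rewrite src_comp.
  rewrite leq_eqVlt => /orP[/eqP dth|dth].
    have z20 : e = th.
      have : dsum (deg z2) = 0%N.
        by move: tot; rewrite degE eE compA// deg_comp ?src_comp// dsumD dth; lia.
      by move=> /dsum0P /deg0_idm z2E; rewrite eE z2E -thz comp_idr.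
    by right; exists l, m, y, e, eta; split => //; split => //; rewrite z20.
  have Hlt : H (ccomp l th) by apply: (Hcl _ _ _ _ _ Hl Hm Hy lm D M'); rewrite H1.
  left; right; exists (ccomp l th), z2, (ccomp w eta); split => //.
  + by rewrite src_comp ?lm.
  + by rewrite src_comp// wx xE rng_comp.
  + rewrite (deg_swap lm D mth) E1 !deg_comp ?Dyw//.
    by rewrite wx xE rng_comp.
  + split; first by rewrite -compA ?wx ?xE ?rng_comp// -xE.
    by rewrite eE compA ?lm.
(* Here s = t b with s0 b = y c minimal, and m th = t eta is the minimal common extension inside s.
   If it is shorter than s, then l th and s0 eta lie in H, the pair (z2, c) is minimal for s0 eta
   and y, and l e = (l th) z2 lies in [K]. *)
- have [t [s0 [y [b [c [Ht Hs0 Hy [ts0 Dts M0 _ sE']]]]]]] := Ks.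
  have s0b := Lmin_src M0; have tb : src t = rng b by rewrite ts0.
  have im : initial m s by rewrite sE; exact: initial_ccomp.
  have it : initial t s by rewrite sE'; exact: initial_ccomp.
  have [th [eta [M' [z2]]]] := initial_min im it.
  have mth := Lmin_src M'; rewrite src_comp// => thz.
  rewrite {1}sE -compA// => /ccompI eE; have {}eE : e = ccomp th z2.
    by apply: eE; rewrite ?rng_comp.
  have [_ /= teta E1 E2] := M'.
  have z2eta : src eta = rng z2.
    by rewrite -(src_comp teta) -E1 src_comp.
  have bE : b = ccomp eta z2.
    apply: (@ccompI _ _ t) => //; first by rewrite rng_comp.
    by rewrite compA// -E1 -sE' sE eE compA.
  have H1 : dsum (deg (ccomp l th)) = dsum (deg (ccomp m th)).
    by rewrite (deg_swap lm D mth).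
  have : (dsum (deg (ccomp m th)) <= d)%N.
    rewrite -tot degE; apply: dsum_le; rewrite eE compA//.
    by apply: deg_compl; rewrite src_comp.
  rewrite leq_eqVlt => /orP[/eqP dth|dth].
    have z20 : e = th.
      have : dsum (deg z2) = 0%N.
        by move: tot; rewrite degE eE compA// deg_comp ?src_comp// dsumD dth; lia.
      by move=> /dsum0P /deg0_idm z2E; rewrite eE z2E -thz comp_idr.
    by right; exists l, m, t, e, eta; split => //; split => //; rewrite z20.
  have Hlt : H (ccomp l th) by apply: (Hcl _ _ _ _ _ Hl Hm Ht lm D M'); rewrite H1.
  have s0eta : src s0 = rng eta by rewrite -ts0.
  have Ds0 : deg (ccomp s0 eta) = deg (ccomp m th).
    by rewrite (deg_swap (esym ts0) (esym Dts) teta) E1.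
  have Hs0e : H (ccomp s0 eta).
    apply: (Hcl _ _ _ _ _ Hs0 Ht Hm (esym ts0) (esym Dts) (Lmin_sym M')).
    by rewrite Ds0.
  right; exists (ccomp l th), (ccomp s0 eta), y, z2, c; split => //; split => //.
  + by rewrite !src_comp ?lm// -(src_comp mth) E1 src_comp.
  + by rewrite (deg_swap lm D mth) Ds0.
  + have [_ /= yc E3 E4] := M0; split=> //=; rewrite ?src_comp//.
      by rewrite -compA// -bE.
    rewrite -compA// -bE E4; apply: dle_anti; apply: dmax_le; rewrite ?dle_maxr//.
      by apply: dle_trans (dle_maxl _ _); exact: deg_compl.
    rewrite -E4 bE compA//; apply: deg_compl; rewrite ?src_comp//.
  + by rewrite eE compA ?lm.
Qed.

(** Since deg (l e) is the join of deg m and deg s, a bound N on the degrees in E holds for all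
    added paths; the stages therefore end at the total degree of N. *)
Lemma min_closure (E : set L) : finite_set E ->
  exists G : set L, [/\ finite_set G, E `<=` G & min_closed G].
Proof.
move=> finE.
have [N EN] : exists N : degree k, E `<=` [set e | dle (deg e) N].
  have /finite_fsetP[X ->] := finE.
  exists (\sum_(e <- finmap.enum_fset X) deg e) => e /= eX.
  by rewrite (big_rem e)//= dle_addr.
have key d : exists H : set L, [/\ finite_set H, H `<=` [set e | dle (deg e) N],
    H `<=` [set e | (dsum (deg e) < d)%N],
    E `&` [set e | (dsum (deg e) < d)%N] `<=` H & closed_below d H].
  elim: d => [|d [H [h1 h2 h3 h4 h5]]].
    by exists set0; split => // e [].
  exact: (min_closure_step finE EN h1 h2 h3 h4 h5).
have [G [h1 h2 h3 h4 h5]] := key (dsum N).+1.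
exists G; split => //.
  by move=> e Ee; apply: h4; split => //=; rewrite ltnS dsum_le//; exact: EN.
move=> l m s e z Gl Gm Gs lm D M; apply: (h5 _ _ _ _ _ Gl Gm Gs lm D M).
rewrite ltnS (deg_swap lm D (Lmin_src M)) (Lmin_deg M) dsum_le//.
by apply: dmax_le; exact: h2.
Qed.

End MinClosure.

(** * Boundary paths and their initial segments *)

Section Segments.
Variables (k : nat) (L : kgraph k).
Implicit Types (a b c e l m : L) (v : obj L) (x y : gpath L).

Definition segments x : set L :=
  [set a | exists n (h : dlex n (gdeg x)), a = x (omk (dle0 n) h)].

Lemma segment_split x (p q : degree k) (hpq : dle p q) (hq : dlex q (gdeg x)) :
  exists a b, [/\ segments x a, segments x b, deg a = p, deg b = q &
    src a = rng (x (omk hpq hq)) /\ b = ccomp a (x (omk hpq hq))].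
Proof.
have hp := dle_dlex hpq hq.
exists (x (omk (dle0 p) hp)), (x (omk (dle0 q) hq)); split.
- by exists p, hp.
- by exists q, hq.
- by rewrite gmor_deg /= /omega_deg /=; apply/ffunP => i; rewrite !ffunE subn0.
- by rewrite gmor_deg /= /omega_deg /=; apply/ffunP => i; rewrite !ffunE subn0.
- exact: gmor_omk.
Qed.

Lemma segment_exists x n : dlex n (gdeg x) -> exists2 a, segments x a & deg a = n.
Proof.
move=> h; have [_ [b [_ h1 _ h2 _]]] := segment_split (dle0 n) h.
by exists b.
Qed.

Lemma segment_dlex x a : segments x a -> dlex (deg a) (gdeg x).
Proof.
move=> [n [h ->]]; rewrite gmor_deg /= /omega_deg /=.
by apply: dle_dlex h; apply/dleP => i; rewrite !ffunE subn0.
Qed.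

Lemma segment_initial x a b : segments x a -> segments x b ->
  dle (deg a) (deg b) -> initial a b.
Proof.
have degx n (h : dlex n (gdeg x)) : deg (x (omk (dle0 n) h)) = n.
  by rewrite gmor_deg /= /omega_deg /=; apply/ffunP => i; rewrite !ffunE subn0.
move=> [p [hp ->]] [q [hq ->]]; rewrite !degx => pq.
have [s ->] := gmor_omk x (dle0 p) pq (dle0 q) hp hq.
exact: initial_ccomp.
Qed.

Lemma segment_uniq x a b : segments x a -> segments x b -> deg a = deg b -> a = b.
Proof.
move=> xa xb D; have := segment_initial xa xb; rewrite D dlexx => /(_ isT) ab.
exact: initial_uniq ab (initial_refl _) D.
Qed.

Lemma segment_trans x a b : initial a b -> segments x b -> segments x a.
Proof.
move=> ab xb; have := segment_exists (dle_dlex (initial_deg ab) (segment_dlex xb)).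
move=> [c xc D]; have cb : initial c b.
  by apply: (segment_initial xc xb); rewrite D initial_deg.
by rewrite (initial_uniq ab cb).
Qed.

Lemma segment_rng x a : segments x a -> rng a = grng x.
Proof. by move=> [n [h ->]]; rewrite gmor_rng /grng; congr gobj; exact: val_inj. Qed.

Lemma segment_idm x : segments x (idm (grng x)).
Proof.
have [a xa _] := segment_exists (dlex0 (gdeg x)).
by rewrite -(segment_rng xa); exact: segment_trans (initial_idm _) xa.
Qed.

Lemma segment_directed x a b : segments x a -> segments x b ->
  exists c, [/\ segments x c, initial a c & initial b c].
Proof.
move=> xa xb; have ha := segment_dlex xa; have hb := segment_dlex xb.
have : dlex (dmax (deg a) (deg b)) (gdeg x).
  apply/dlexP => i n E; rewrite ffunE geq_max.
  by move/dlexP : ha => -> //; move/dlexP : hb => ->.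
move=> /segment_exists[c xc D]; exists c; split => //.
  by apply: (segment_initial xa xc); rewrite D dle_maxl.
by apply: (segment_initial xb xc); rewrite D dle_maxr.
Qed.

Lemma segment_src x n (h : dlex n (gdeg x)) a : segments x a -> deg a = n ->
  src a = gobj x (exist _ n h : obj (Omega (gdeg x))).
Proof.
move=> xa D.
have [c [b [_ xb _ D' [cs E]]]] := segment_split (dle0 n) h.
rewrite (segment_uniq xa xb) ?D ?D'// E src_comp// gmor_src; congr gobj.
exact: val_inj.
Qed.

(** Far along x every finite coordinate of its degree is used up, and the boundary condition lets no
    path continue in these directions; in the infinite directions the segment can be as long as
    wanted. *)
Lemma boundary_segment x (N : degree k) : is_boundary_path x -> exists2 a,
  segments x a & (forall i, gdeg x i = None -> (N i <= deg a i)%N) /\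
  forall e i, src a = rng e -> gdeg x i <> None -> deg e i = 0%N.
Proof.
move=> [nx hnx bx].
pose n : degree k := [ffun i => if gdeg x i is Some b then b else maxn (nx i) (N i)].
have hn : dlex n (gdeg x) by apply/dlexP => i b E; rewrite ffunE E.
have nxn : dle nx n.
  apply/dleP => i; rewrite ffunE; case E : (gdeg x i) => [b|]; rewrite ?leq_maxl//.
  by move/dlexP : hnx; apply.
have [a xa D] := segment_exists hn.
exists a => //; split=> [i E|e i ae]; first by rewrite D ffunE E leq_maxr.
case E : (gdeg x i) => [b|] // _; apply/eqP; rewrite -leqn0 leqNgt; apply/negP => lt.
(* Otherwise e begins with a path of degree e_i, which the boundary condition forbids. *)
have /initial_exists[c Dc ce] : dle (dgen i) (deg e).
  by apply/dleP => j; rewrite ffunE; case: eqP => // ->.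
have /seteqP[+ _] := bx (exist _ n hn) i nxn ltac:(by rewrite /= ffunE E).
by move=> /(_ c); apply; split => //; rewrite -(segment_src hn xa D) ae (initial_rng ce).
Qed.

(** Continue a along x by a long c and take a minimal extension e al = c be with e in E. Then be is
    a vertex: finite directions allow no further extension, and in infinite ones deg c already
    dominates deg e. So e is an initial segment of c. *)
Lemma boundary_exhaustive x a (E : set L) : is_boundary_path x ->
  segments x a -> finite_set E -> exhaustive (src a) E ->
  exists2 e, E e & segments x (ccomp a e).
Proof.
move=> bx xa /finite_fsetP[X ->] [Er exh].
(* The summand deg a appears because [boundary_segment] measures segments from the start of x, while
   c starts at the end of a. *)
pose N := deg a + \sum_(e <- finmap.enum_fset X) deg e.
have NE e : e \in X -> dle (deg a + deg e) N.
  move=> eX; apply/dleP => i; rewrite /N (big_rem e)//= !daddE; lia.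
have [b' xb' [hN _]] := boundary_segment N bx.
have [b'' xb'' [_ h0']] := boundary_segment N bx.
have [b1 [xb1 ib' ib'']] := segment_directed xb' xb''.
have [b [xb ab b1b]] := segment_directed xa xb1.
have h0 e i : src b = rng e -> gdeg x i <> None -> deg e i = 0%N.
  move=> be xi; have [d bd bE] := initial_trans ib'' b1b.
  have de : src d = rng e by rewrite -be bE src_comp.
  have := h0' (ccomp d e) i; rewrite rng_comp// deg_comp// daddE => /(_ bd xi).
  by move=> /eqP; rewrite addn_eq0 => /andP[_ /eqP].
have [c ac bE] := ab.
have [e Ee [[al be] M]] := exh c (esym ac).
exists e => //; have [/= eal cbe E1 E2] := M.
have /deg0_idm be0 : deg be = 0.
  apply/ffunP => i; rewrite [RHS]ffunE.
  have [xi|xi] := pselect (gdeg x i = None); last first.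
    by apply: h0 xi; rewrite bE src_comp.
  move/ffunP : E2 => /(_ i); rewrite E1 deg_comp// daddE ffunE.
  have : (deg e i <= deg c i)%N.
    have := hN i xi; have /dleP/(_ i) := NE e Ee; rewrite daddE.
    have /initial_deg/dleP/(_ i) := initial_trans ib' b1b.
    by rewrite bE deg_comp// daddE; lia.
  move=> /maxn_idPr -> /eqP; rewrite -[X in _ == X]addn0 eqn_add2l => /eqP.
  exact.
have ec : initial e c.
  by exists al => //; rewrite E1 be0 -cbe comp_idr.
by apply: segment_trans xb; rewrite bE; apply: initial_ccompl.
Qed.

Lemma concat_segment l x y a : src l = grng x -> is_concat l x y ->
  segments x a -> segments y (ccomp l a).
Proof.
move=> lx [yN y1 y2] xa.
have hq : dlex (deg l + deg a) (gdeg y).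
  apply/dlexP => i b; rewrite yN ffunE; case E : (gdeg x i) => [c|]//= [<-].
  rewrite daddE addnC leq_add2r.
  by move/segment_dlex/dlexP : xa; apply.
have [c [b [yc yb Dc Db [cs bE]]]] := segment_split (dle_addr (deg l) (deg a)) hq.
have [n [h aE]] := xa; have cl : c = l.
  have [q [hq' cE]] := yc; rewrite cE y1//= -Dc cE gmor_deg /omega_deg/=.
  by congr pair; apply/ffunP => i; rewrite [RHS]ffunE ffunE subn0.
have -> : ccomp l a = b; last by [].
rewrite bE cl; congr ccomp; rewrite [LHS]aE; apply/esym/(y2 (deg l + deg a)) => //=.
congr pair; rewrite aE gmor_deg /omega_deg/=.
by apply/ffunP => i; rewrite !ffunE subn0 addKn.
Qed.

Lemma concat_segment_initial l x y b : src l = grng x -> is_concat l x y ->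
  segments y b -> exists2 a, segments x a & initial b (ccomp l a).
Proof.
move=> lx yl yb; have [yN _ _] := yl.
have hq : dlex (dsub (deg b) (deg l)) (gdeg x).
  have /dlexP := segment_dlex yb; rewrite yN => h.
  apply/dlexP => i n E; have := h i (n + deg l i)%N; rewrite !ffunE E /=.
  by move=> /(_ erefl); lia.
have [a xa D] := segment_exists hq; exists a => //.
apply: segment_initial yb (concat_segment lx yl xa) _.
rewrite deg_comp ?(segment_rng xa)// D.
by apply/dleP => i; rewrite daddE ffunE; lia.
Qed.

Lemma compatible_initial2 l m a b : src l = rng b -> src m = rng b ->
  initial a b -> compatible (ccomp l b) (ccomp m b) ->
  compatible (ccomp l a) (ccomp m a).
Proof.
move=> lb mb ab [w h1 h2].
exists w; first exact: initial_trans (initial_ccompl lb ab) h1.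
exact: initial_trans (initial_ccompl mb ab) h2.
Qed.

(** Turns aperiodicity into a finite statement: distinct l x and m x differ already at some finite
    segment. In finite directions compatibility forces deg l and deg m to agree, so l x and m x have
    the same degree; then each l a is the segment of m x of its degree, both being initial in a
    common extension. *)
Lemma compatible_concat l m x : is_boundary_path x ->
  src l = grng x -> src m = grng x ->
  (forall a, segments x a -> compatible (ccomp l a) (ccomp m a)) ->
  concat l x = concat m x.
Proof.
move=> bx lx mx lm; set y := concat m x.
have ym : is_concat m x y by exact: concatP.
apply: (is_concat_uniq (concatP lx)).
have D i : gdeg x i <> None -> deg l i = deg m i.
  have [a xa [_ h]] := boundary_segment 0 bx => xi.
  have la : src l = rng a by rewrite lx (segment_rng xa).
  have ma : src m = rng a by rewrite mx (segment_rng xa).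
  have [w [e]] := lm a xa; rewrite src_comp// => ae wE [z].
  rewrite src_comp// wE => az /(congr1 (@deg _ _))/ffunP/(_ i).
  by rewrite !deg_comp ?src_comp// !daddE (h e)// (h z)//; lia.
have yN : gdeg y = daddx (gdeg x) (deg l).
  have [E _ _] := ym; rewrite E {E}; apply/ffunP => i; rewrite !ffunE.
  by case E : (gdeg x i) => [b|]//=; rewrite D// E.
have ly a : segments x a -> segments y (ccomp l a).
  move=> xa; have la : src l = rng a by rewrite lx (segment_rng xa).
  have : dlex (deg l + deg a) (gdeg y).
    apply/dlexP => i b; rewrite yN ffunE; case E : (gdeg x i) => [c|]//= [<-].
    rewrite daddE addnC leq_add2r.
    by move/segment_dlex/dlexP : xa; apply.
  move=> /segment_exists[b yb Db].
  have [a' xa' ba'] := concat_segment_initial mx ym yb.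
  have [c [xc ac a'c]] := segment_directed xa xa'.
  have [w h1 h2] := lm c xc.
  have lc : src l = rng c by rewrite lx (segment_rng xc).
  have mc : src m = rng c by rewrite mx (segment_rng xc).
  rewrite (@initial_uniq _ _ (ccomp l a) b w) ?deg_comp//.
    exact: initial_trans (initial_ccompl lc ac) h1.
  apply: initial_trans (initial_trans ba' _) h2.
  exact: initial_ccompl.
have yl : segments y l.
  by rewrite -(comp_idr l); apply: ly; rewrite lx; exact: segment_idm.
split => //.
  move=> f fE; apply: segment_uniq _ yl _.
    have fL : dlex (deg l) (gdeg y).
      by have /andP[_] := valP (f : omega_mor _); rewrite fE.
    by exists (deg l), fL; congr (y _); apply: val_inj; rewrite /= fE.
  rewrite gmor_deg; have -> : deg f = dsub (val f).2 (val f).1 by [].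
  by rewrite fE/=; apply/ffunP => i; rewrite !ffunE subn0.
move=> n f g fE gE.
have /andP[h1 h2] := valP (f : omega_mor _); rewrite fE/= in h1 h2.
have [c [b [yc yb Dc Db [cs bE]]]] := segment_split h1 h2.
have fE' : f = omk h1 h2 by apply: val_inj; rewrite fE.
have cl : c = l by apply: segment_uniq yc yl _.
have xg : segments x (x g).
  have /andP[_ h3] := valP (g : omega_mor _); rewrite gE/= in h3.
  by exists (dsub n (deg l)), h3; congr (x _); apply: val_inj; rewrite /= gE.
have lg : src l = rng (x g) by rewrite lx (segment_rng xg).
have lf : src l = rng (y (omk h1 h2)) by rewrite -cs cl.
have {}bE : b = ccomp l (y (omk h1 h2)) by rewrite [LHS]bE; congr ccomp.
rewrite fE'; apply: (ccompI lf lg); rewrite -bE.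
apply: (segment_uniq yb (ly _ xg)).
rewrite Db deg_comp// gmor_deg.
have -> : deg g = dsub (val g).2 (val g).1 by [].
rewrite gE/=; apply/ffunP => i; have /dleP/(_ i) := h1.
by rewrite !ffunE subn0 => /subnKC.
Qed.

(** Each pair of distinct paths is separated by some segment of x and stays separated along longer
    segments, so by directedness one segment serves all the finitely many pairs. *)
Lemma separating_path v (S : set L)
  (hap : exists x : gpath L, [/\ is_boundary_path x, grng x = v
      & forall l m : L, src l = v -> src m = v -> l <> m ->
          concat l x <> concat m x]) :
  finite_set S -> S `<=` [set l | src l = v] ->
  exists2 t, rng t = v & forall l m, S l -> S m ->
    compatible (ccomp l t) (ccomp m t) -> l = m.
Proof.
move: hap => [x [bx xv hx]] /finite_fsetP[X SX] Sv.
have [a xa ha] : exists2 a, segments x a & forall p, p \in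
    [seq (l, m) | l <- finmap.enum_fset X, m <- finmap.enum_fset X] ->
    compatible (ccomp p.1 a) (ccomp p.2 a) -> p.1 = p.2.
  have : forall p, p \in [seq (l, m) | l <- finmap.enum_fset X, m <- finmap.enum_fset X] ->
      src p.1 = v /\ src p.2 = v.
    by move=> _ /allpairsP[[l m] /= [h1 h2 ->]]; split; apply: Sv; rewrite SX.
  elim: [seq _ | _ <- _, _ <- _] => [|p s IHs] hs.
    by exists (idm (grng x)) => //; exact: segment_idm.
  have [|b xb hb] := IHs; first by move=> q qs; apply: hs; rewrite inE qs orbT.
  have [s1 s2] := hs p (mem_head _ _).
  have [a xa hp] : exists2 a, segments x a &
      compatible (ccomp p.1 a) (ccomp p.2 a) -> p.1 = p.2.
    apply: contrapT => nh; have pE : p.1 <> p.2.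
      by move=> pE; apply: nh; exists (idm (grng x)) => //; exact: segment_idm.
    apply: (hx _ _ s1 s2 pE); apply: compatible_concat; rewrite ?xv// => a xa.
    by apply: contrapT => h; apply: nh; exists a.
  have [c [xc ac bc]] := segment_directed xa xb; exists c => // q.
  rewrite inE => /orP[/eqP -> h|qs h].
    by apply: hp; apply: compatible_initial2 ac h; rewrite ?s1 ?s2 (segment_rng xc).
  apply: hb => //; apply: compatible_initial2 bc h.
    by rewrite (hs q _).1 ?inE ?qs ?orbT// (segment_rng xc).
  by rewrite (hs q _).2 ?inE ?qs ?orbT// (segment_rng xc).
exists a; first by rewrite (segment_rng xa).
move=> l m Sl Sm; apply: (ha (l, m)).
by apply/allpairsP; exists (l, m); split=> //=; move: Sl Sm; rewrite SX.
Qed.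

End Segments.

(** * Comparing growth rates along powers of two *)

Section Growth.
Variable R : realType.

Lemma bernoulli (e : R) (l : nat) : 0 <= e -> 1 + e *+ l <= (1 + e) ^+ l.
Proof.
move=> e0; elim: l => [|l IHl]; first by rewrite mulr0n addr0 expr0.
rewrite exprS mulrDl mul1r mulrS addrCA addrC lerD//.
by rewrite ler_peMr// exprn_ege1// lerDl.
Qed.

Lemma invS_le (e : R) : 0 < e ->
  exists N, forall n, (N <= n)%N -> n.+1%:R^-1 <= e.
Proof.
move=> e0; exists (Num.bound e^-1) => n Nn.
rewrite -[e]invrK lef_pV2 ?posrE ?invr_gt0//.
have e1 : 0 <= e^-1 by rewrite invr_ge0 ltW.
by apply: le_trans (ltW (archi_boundP e1)) _; rewrite ler_nat (leq_trans Nn).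
Qed.

(** If x / y = 1 + e with e > 0, take the exponent m = 2^(k+1) 2^i. As 2^(k+1) > k+1, Bernoulli
    gives (1 + e)^m >= (e 2^i)^(k+1), whereas the bound grows like (2^i)^k only. *)
Lemma pow2_growth_le (x y c : R) (k : nat) : 0 <= x -> 0 <= y ->
  (forall j, x ^+ (2 ^ j) <= c * ((2 ^ j).+1 ^ k)%:R * y ^+ (2 ^ j)) -> x <= y.
Proof.
move=> x0 y0 h; rewrite leNgt; apply/negP => yx.
have [y1|y1] := leP y 0.
  have yE : y = 0 by apply/eqP; rewrite eq_le y1 y0.
  have := h 0%N; rewrite expn0 !expr1 yE mulr0 => x1.
  by move: yx; rewrite yE ltNge x1.
pose e := x / y - 1.
have e0 : 0 < e by rewrite subr_gt0 ltr_pdivlMr// mul1r.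
have h' j : (1 + e) ^+ (2 ^ j) <= c * ((2 ^ j).+1 ^ k)%:R.
  by rewrite /e addrC subrK expr_div_n ler_pdivrMr ?exprn_gt0// h.
have c0 : 0 <= c.
  have := h' 0%N; rewrite expn0 expr1 => h1.
  have : 0 <= c * (2 ^ k)%:R by apply: le_trans h1; rewrite addr_ge0// ltW.
  by rewrite pmulr_lge0// ltr0n expn_gt0.
(* From m + 1 <= 2^(k+2) 2^i for m = 2^(k+1+i). *)
pose C : R := c * ((2 ^ k.+2) ^ k)%:R.
have key i : e ^+ k.+1 * (2 ^ i)%:R <= C.
  have l0 : (0 < 2 ^ i)%N by rewrite expn_gt0.
  have l0R : 0 < (2 ^ i)%:R :> R by rewrite ltr0n.
  have : (e * (2 ^ i)%:R) ^+ k.+1 <= c * ((2 ^ k.+2 * 2 ^ i) ^ k)%:R.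
    have := h' (k.+1 + i)%N; set m := (2 ^ (k.+1 + i))%N => h1.
    have mE : (m = 2 ^ k.+1 * 2 ^ i)%N by rewrite /m expnD.
    apply: (@le_trans _ _ ((1 + e) ^+ m)); last first.
      apply: le_trans h1 _; rewrite ler_wpM2l// ler_nat.
      case: (k) m mE => [|k'] m mE; first by rewrite !expn0.
      rewrite leq_exp2r// mE (expnS 2 k'.+2).
      have : (0 < 2 ^ k'.+2 * 2 ^ i)%N by rewrite muln_gt0 !expn_gt0.
      lia.
    rewrite exprMn -exprMn.
    apply: (@le_trans _ _ (((1 + e) ^+ (2 ^ i)) ^+ k.+1)).
      have h2 : e * (2 ^ i)%:R <= (1 + e) ^+ (2 ^ i).
        by apply: le_trans (bernoulli _ (ltW e0)); rewrite mulr_natr lerDr.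
      have h3 : 0 <= e * (2 ^ i)%:R by rewrite mulr_ge0// ltW.
      by apply: lerXn2r; rewrite ?nnegrE// (le_trans h3).
    rewrite -exprM; apply: ler_weXn2l; first by rewrite lerDl ltW.
    rewrite mE mulnC leq_mul2r; apply/orP; right.
    by apply: ltnW; rewrite ltn_expl.
  rewrite expnMn natrM mulrA -/C [((2 ^ i) ^ k)%:R]natrX exprMn [(2 ^ i)%:R ^+ k.+1]exprS.
  by rewrite mulrA ler_pM2r// exprn_gt0.
have C0 : 0 <= C by rewrite mulr_ge0.
have ek0 : 0 < e ^+ k.+1 by rewrite exprn_gt0.
have := Num.Theory.archi_boundP (divr_ge0 C0 (ltW ek0)).
set i := Num.bound _ => Ci.
have := key i; rewrite leNgt => /negP; apply.
rewrite -ltr_pdivrMl// mulrC (lt_le_trans Ci)// ler_nat ltnW// ltn_expl//.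
Qed.

(** The exponents start at 2, so a positive power of y remains on the right and y = 0 forces x = 0.
    For y > 0 the missing power of y goes into the constant, and its summand x / y covers the
    exponent 1, absent from the hypothesis. *)
Lemma pow2_shift_le (x y c : R) : 0 <= x -> 0 <= y ->
  (forall j, x ^+ (2 ^ j.+1) <= c * y ^+ (2 ^ j.+1).-1) -> x <= y.
Proof.
move=> x0 y0 h; have [y1|y1] := leP y 0.
  have yE : y = 0 by apply/eqP; rewrite eq_le y1 y0.
  have := h 0%N; rewrite yE expr0n/= mulr0 => x1.
  rewrite -(@ler_pXn2r _ 2)// ?nnegrE//.
  by rewrite [leRHS]expr0n.
apply: (@pow2_growth_le x y (c / y + x / y) 0) => // -[|j].
  rewrite expn0 !expr1 mulr1 mulrDl !divfK ?gt_eqF// lerDr.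
  have := h 0%N; rewrite expr1 => h1.
  have : 0 <= c * y by apply: le_trans h1; rewrite exprn_ge0.
  by rewrite pmulr_lge0.
apply: le_trans (h j) _; rewrite expn0 mulr1 mulrDl.
have -> : c / y * y ^+ (2 ^ j.+1) = c * y ^+ (2 ^ j.+1).-1.
  by rewrite -[in LHS](@prednK (2 ^ j.+1)) ?expn_gt0// exprS mulrA divfK// gt_eqF.
by rewrite lerDl !mulr_ge0// ?invr_ge0// exprn_ge0.
Qed.
End Growth.

(** * Norms in C*-algebras and Cuntz-Krieger relations *)

Section RealNorm.
Variables (R : realType).

(* Norms over [R[i]] take values in [R[i]]; [nrm] is the real number behind. *)
Definition nrm (V : normedZmodType R[i]) (v : V) : R := complex.Re `|v|.

Variable V : normedZmodType R[i].
Implicit Types (u v : V).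

Lemma nrmE v : `|v| = (nrm v)%:C%C.
Proof. by apply/esym/RRe_real; exact: normr_real. Qed.

Lemma nrm_ge0 v : 0 <= nrm v.
Proof. by rewrite -lecR -nrmE; exact: normr_ge0. Qed.

Lemma nrmD u v : nrm (u + v) <= nrm u + nrm v.
Proof. by rewrite -lecR rmorphD/= -!nrmE ler_normD. Qed.

Lemma nrm0 : nrm (0 : V) = 0.
Proof. by rewrite /nrm normr0. Qed.

Lemma nrm_eq0 v : nrm v = 0 -> v = 0.
Proof. by move=> h; apply/normr0_eq0; rewrite nrmE h. Qed.

Lemma nrmN v : nrm (- v) = nrm v.
Proof. by rewrite /nrm normrN. Qed.

Lemma nrmB u v : nrm (u - v) = nrm (v - u).
Proof. by rewrite /nrm distrC. Qed.

Lemma nrm_tri u v w : nrm (u - w) <= nrm (u - v) + nrm (v - w).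
Proof. by rewrite (le_trans _ (nrmD _ _))// addrA subrK. Qed.

Lemma nrm_sum (I : Type) (s : seq I) (P : pred I) (F : I -> V) :
  nrm (\sum_(i <- s | P i) F i) <= \sum_(i <- s | P i) nrm (F i).
Proof.
elim/big_rec2 : _ => [|i y1 y2 _ h]; first by rewrite nrm0.
by rewrite (le_trans (nrmD _ _))// lerD2l.
Qed.

End RealNorm.

Lemma nrmZ (R : realType) (A : normedModType R[i]) (z : R[i]) (a : A) :
  nrm (z *: a) = nrm z * nrm a.
Proof.
by have [] : (nrm (z *: a))%:C%C = (nrm z * nrm a)%:C%C;
  rewrite ?rmorphM/= -?nrmE ?normrZ.
Qed.

(** * Norm estimates and powers in a C*-algebra *)

Section CStarBasics.
Variables (R : realType) (A : cstarAlgType R).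
Implicit Types (a b c p q : A) (s : seq A).

Lemma cmul0r a : 0 ** a = 0.
Proof. by apply: (addrI (0 ** a)); rewrite -cmulDl !addr0. Qed.
Lemma cmulr0 a : a ** 0 = 0.
Proof. by apply: (addrI (a ** 0)); rewrite -cmulDr !addr0. Qed.
Lemma cmulNr a b : (- a) ** b = - (a ** b).
Proof. by rewrite -scaleN1r cmulZl scaleN1r. Qed.
Lemma cmulrN a b : a ** (- b) = - (a ** b).
Proof. by rewrite -scaleN1r cmulZr scaleN1r. Qed.
Lemma cmulBl a b c : (a - b) ** c = a ** c - b ** c.
Proof. by rewrite cmulDl cmulNr. Qed.
Lemma cmulBr a b c : a ** (b - c) = a ** b - a ** c.
Proof. by rewrite cmulDr cmulrN. Qed.
Lemma cmul_suml (I : Type) (r : seq I) (P : pred I) (F : I -> A) a :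
  (\sum_(i <- r | P i) F i) ** a = \sum_(i <- r | P i) F i ** a.
Proof. by apply: (big_morph (fun x => x ** a)) => [x y|]; rewrite ?cmulDl ?cmul0r. Qed.
Lemma cmul_sumr (I : Type) (r : seq I) (P : pred I) (F : I -> A) a :
  a ** (\sum_(i <- r | P i) F i) = \sum_(i <- r | P i) a ** F i.
Proof. by apply: (big_morph (cmul a)) => [x y|]; rewrite ?cmulDr ?cmulr0. Qed.

Lemma cadj0 : (0 : A)^† = 0.
Proof. by apply: (addrI ((0 : A)^†)); rewrite -cadjD !addr0. Qed.
Lemma cadjN a : (- a)^† = - a^†.
Proof. by rewrite -scaleN1r cadjZ rmorphN1 scaleN1r. Qed.
Lemma cadjB a b : (a - b)^† = a^† - b^†.
Proof. by rewrite cadjD cadjN. Qed.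
Lemma cadj_sum (I : Type) (r : seq I) (P : pred I) (F : I -> A) :
  (\sum_(i <- r | P i) F i)^† = \sum_(i <- r | P i) (F i)^†.
Proof. by apply: (big_morph (@cadj _ A)) => [x y|]; rewrite ?cadjD ?cadj0. Qed.

Lemma nrmM a b : nrm (a ** b) <= nrm a * nrm b.
Proof. by rewrite -lecR rmorphM/= -!nrmE cnormM. Qed.

Lemma nrm_cstar a : nrm (a^† ** a) = nrm a ^+ 2.
Proof.
by have [] : (nrm (a^† ** a))%:C%C = (nrm a ^+ 2)%:C%C;
  rewrite ?rmorphXn/= -?nrmE ?cnorm_adj.
Qed.

Lemma nrm_adj a : nrm a^† = nrm a.
Proof.
have h b : nrm b <= nrm b^†.
  have := nrm_ge0 b; rewrite le_eqVlt => /orP[/eqP <-|b1]; first exact: nrm_ge0.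
  have := nrmM b^† b; rewrite nrm_cstar expr2 ler_pM2r//.
by apply: le_anti; rewrite h andbT; have := h a^†; rewrite cadjK.
Qed.

Lemma nrm_mul_le1l a b : nrm a <= 1 -> nrm (a ** b) <= nrm b.
Proof.
by move=> h; rewrite (le_trans (nrmM _ _))// ler_piMl// nrm_ge0.
Qed.

Lemma nrm_mul_le1r a b : nrm b <= 1 -> nrm (a ** b) <= nrm a.
Proof.
by move=> h; rewrite (le_trans (nrmM _ _))// ler_piMr// nrm_ge0.
Qed.

Lemma nrm_sq_le1 a : nrm a ^+ 2 <= nrm a -> nrm a <= 1.
Proof.
move=> h; rewrite leNgt; apply/negP => lt; move: h; rewrite leNgt => /negP; apply.
by rewrite expr2 ltr_pMr// (lt_trans ltr01).
Qed.

Lemma nrm_projection_le1 p : is_projection p -> nrm p <= 1.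
Proof. by move=> [p1 p2]; apply: nrm_sq_le1; rewrite -nrm_cstar p1 p2. Qed.

Lemma nrm_projection p : is_projection p -> p <> 0 -> nrm p = 1.
Proof.
move=> [p1 p2] p0; have := nrm_cstar p; rewrite p1 p2 => /esym/eqP.
rewrite -subr_eq0 expr2 -{3}[nrm p]mulr1 -mulrBr mulf_eq0 subr_eq0.
by move=> /orP[/eqP/nrm_eq0//|/eqP].
Qed.

(* [cexp a n] is the power [n + 1] of [a], as there is no unit. *)
Fixpoint cexp a n := if n is n'.+1 then a ** cexp a n' else a.

Lemma cexpD a m n : cexp a m ** cexp a n = cexp a (m + n).+1.
Proof. by elim: m => //= m IHm; rewrite -cmulA IHm. Qed.

Lemma cexpSr a n : cexp a n.+1 = cexp a n ** a.
Proof. by rewrite -[X in _ ** X]/(cexp a 0) cexpD addn0. Qed.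

Lemma cexp_adj a n : a^† = a -> (cexp a n)^† = cexp a n.
Proof. by move=> h; elim: n => // n IHn; rewrite [in LHS]/= cadjM IHn h -cexpSr. Qed.

(** The C*-identity for a self-adjoint power doubles the exponent, which reaches exactly the
    exponents 2^j; hence the growth lemmas along powers of two. *)
Lemma nrm_cexp2 a j : a^† = a -> nrm (cexp a (2 ^ j).-1) = nrm a ^+ (2 ^ j).
Proof.
move=> h; elim: j => [|j IHj]; first by rewrite expn0 expr1.
rewrite expnS mul2n -addnn exprD -IHj -expr2 -nrm_cstar cexp_adj// cexpD.
congr (nrm (cexp a _)); have := expn_gt0 2 j; lia.
Qed.

Lemma nrm_cexp_le a n : nrm (cexp a n) <= nrm a ^+ n.+1.
Proof.
elim: n => [|n IHn] /=; first by rewrite expr1.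
by rewrite (le_trans (nrmM _ _))// exprS ler_wpM2l// nrm_ge0.
Qed.

Lemma foldl_cmul a s b : a ** foldl cmul b s = foldl cmul (a ** b) s.
Proof. by elim: s b => //= c s IHs b; rewrite IHs cmulA. Qed.

Lemma foldl_commute a s b : a ** b = b ** a ->
  (forall c, c \in s -> a ** c = c ** a) ->
  a ** foldl cmul b s = foldl cmul b s ** a.
Proof.
elim: s b => //= c s IHs b ab h; apply: IHs => [|d ds].
  by rewrite cmulA ab -cmulA h ?mem_head// cmulA.
by rewrite h// inE ds orbT.
Qed.

Lemma nrm_foldl s b : nrm b <= 1 -> (forall c, c \in s -> nrm c <= 1) ->
  nrm (foldl cmul b s) <= 1.
Proof.
elim: s b => //= c s IHs b hb h; apply: IHs => [|d ds].
  by rewrite (le_trans (nrm_mul_le1l _ _))// h// mem_head.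
by rewrite h// inE ds orbT.
Qed.

End CStarBasics.

(** * Range projections and gap projections of a Cuntz-Krieger family *)

Section CuntzKriegerFamily.
Variables (R : realType) (k : nat) (L : kgraph k) (A : cstarAlgType R).
Variables (t : L -> A) (ct : CK_family t) (hfa : finitely_aligned L).
Implicit Types (c d e l m n z : L) (v : obj L) (T : seq L).

Lemma ck_src l : t l ** t (idm (src l)) = t l.
Proof. by rewrite (CK_comp ct) ?rng_idm// comp_idr. Qed.

Lemma ck_rng l : t (idm (rng l)) ** t l = t l.
Proof. by rewrite (CK_comp ct) ?src_idm// comp_idl. Qed.

Lemma ck_idm_adj v : (t (idm v))^† = t (idm v).
Proof. by have [] := CK_proj ct v. Qed.

Lemma ck_idm_idem v : t (idm v) ** t (idm v) = t (idm v).
Proof. by have [] := CK_proj ct v. Qed.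

Lemma ck_adj_rng l : (t l)^† ** t (idm (rng l)) = (t l)^†.
Proof. by rewrite -[in RHS](ck_rng l) cadjM ck_idm_adj. Qed.

Lemma ck_src_adj l : t (idm (src l)) ** (t l)^† = (t l)^†.
Proof. by rewrite -[in RHS](ck_src l) cadjM ck_idm_adj. Qed.

Lemma ck_adj_mul l : (t l)^† ** t l = t (idm (src l)).
Proof. by rewrite (CK_min ct) Lmin_refl fsbig_set1/= ck_idm_adj ck_idm_idem. Qed.

Lemma ck_adj_comp d c : src d = rng c -> (t d)^† ** t (ccomp d c) = t c.
Proof. by move=> dc; rewrite -(CK_comp ct dc) cmulA ck_adj_mul dc ck_rng. Qed.

Lemma ck_adj_incompatible d c : ~ compatible d c -> (t d)^† ** t c = 0.
Proof. by move=> h; rewrite (CK_min ct) incompatible_Lmin// fsbig_set0. Qed.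

Lemma ck_adj_mulE l m :
  (t l)^† ** t m = \sum_(p <- finmap.enum_fset (fset_set (Lmin l m))) t p.1 ** (t p.2)^†.
Proof. by rewrite (CK_min ct) fsbig_finite. Qed.

Lemma mem_Lmin l m p : (p \in finmap.enum_fset (fset_set (Lmin l m))) = (p \in Lmin l m).
Proof. exact: in_fset_set. Qed.

Lemma nrm_ck l : nrm (t l) <= 1.
Proof.
apply: nrm_sq_le1; rewrite -nrm_cstar ck_adj_mul.
have := CK_proj ct (src l) => h; have h1 := nrm_projection_le1 h.
have [->|h0] := pselect (t (idm (src l)) = 0); first by rewrite nrm0 nrm_ge0.
rewrite (nrm_projection h h0).
have : nrm (t l) ^+ 2 = 1.
  by rewrite -nrm_cstar ck_adj_mul (nrm_projection h h0).
move=> /eqP; rewrite sqrf_eq1 => /orP[/eqP ->//|/eqP E].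
by have := nrm_ge0 (t l); rewrite E lerNr oppr0 ler10.
Qed.

Definition crange l : A := t l ** (t l)^†.

Lemma crange_proj l : is_projection (crange l).
Proof.
rewrite /crange; split; first by rewrite cadjM cadjK.
by rewrite cmulA -(cmulA (t l)) ck_adj_mul ck_src.
Qed.

Lemma crange_mulE l m : crange l ** crange m =
  \sum_(p <- finmap.enum_fset (fset_set (Lmin l m))) crange (ccomp l p.1).
Proof.
rewrite /crange cmulA -(cmulA (t l)) ck_adj_mulE cmul_sumr cmul_suml.
rewrite big_seq [RHS]big_seq; apply: eq_bigr => -[e z].
rewrite mem_Lmin inE => -[/= le mz E _].
by rewrite {2}E -(CK_comp ct le) -(CK_comp ct mz) cadjM !cmulA.
Qed.

(** By [crange_mulE] the product is a sum of projections, hence self-adjoint, and its adjoint is the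
    product in the other order. *)
Lemma crange_commute l m : crange l ** crange m = crange m ** crange l.
Proof.
have h n : (crange n)^† = crange n by have [] := crange_proj n.
rewrite -[LHS]cadjK cadjM !h !crange_mulE cadj_sum.
by apply: eq_bigr => p _; rewrite h.
Qed.

Lemma crange_rng l : t (idm (rng l)) ** crange l = crange l.
Proof. by rewrite /crange cmulA ck_rng. Qed.

Lemma crange_rngr l : crange l ** t (idm (rng l)) = crange l.
Proof. by rewrite /crange -cmulA ck_adj_rng. Qed.

(** The leading t_v gives the product over an empty T a value; if the paths of T have range v, it is
    absorbed by the other factors, so that relation (iv) becomes [ck_gap_exhaustive]. *)
Definition ck_gap v T : A :=
  foldl cmul (t (idm v)) [seq t (idm v) - crange n | n <- T].

Lemma ck_factor_proj v n : rng n = v -> is_projection (t (idm v) - crange n).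
Proof.
move=> <-; have [h1 h2] := crange_proj n.
split; first by rewrite cadjB h1 ck_idm_adj.
by rewrite cmulBl !cmulBr crange_rng crange_rngr ck_idm_idem h2 subrr subr0.
Qed.

Lemma ck_factor_commute v m n : rng n = v -> rng m = v ->
  (t (idm v) - crange n) ** (t (idm v) - crange m) =
  (t (idm v) - crange m) ** (t (idm v) - crange n).
Proof.
have E x : rng x = v ->
    t (idm v) ** crange x = crange x /\ crange x ** t (idm v) = crange x.
  by move=> <-; rewrite crange_rng crange_rngr.
move=> /E[n1 n2] /E[m1 m2]; rewrite !cmulBl !cmulBr n1 n2 m1 m2 crange_commute.
rewrite !opprB !addrA [LHS]addrAC [RHS]addrAC; congr (_ + _); exact: addrAC.
Qed.

Lemma ck_gap_le1 v T : (forall n, n \in T -> rng n = v) -> nrm (ck_gap v T) <= 1.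
Proof.
move=> h; apply: nrm_foldl => [|c /mapP[n nT ->]].
  exact: nrm_projection_le1 (CK_proj ct v).
by apply/nrm_projection_le1/ck_factor_proj/h.
Qed.

(** The factors commute, so the one of n can be moved to the front, where t_n^* annihilates it. *)
Lemma ck_adj_gap v T n : (forall n, n \in T -> rng n = v) -> n \in T ->
  (t n)^† ** ck_gap v T = 0.
Proof.
move=> h nT; rewrite /ck_gap; have rn := h n nT.
have qn : (t n)^† ** (t (idm v) - crange n) = 0.
  by rewrite cmulBr -rn ck_adj_rng /crange cmulA ck_adj_mul ck_src_adj subrr.
case/splitPr : nT h => T1 T2 h.
rewrite map_cat foldl_cat/= -foldl_commute.
- by rewrite foldl_cmul cmulA qn cmul0r; elim: [seq _ | _ <- T2] => //= a s; rewrite cmul0r.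
- have [p1 p2] := crange_proj n.
  by rewrite cmulBl cmulBr -rn crange_rng crange_rngr.
- move=> c /mapP[m mT ->]; apply: ck_factor_commute => //.
  by apply: h; rewrite mem_cat mT.
Qed.

Lemma ck_gap_exhaustive v (E : {fset L}) : exhaustive v [set` E] ->
  ck_gap v (finmap.enum_fset E) = 0.
Proof.
move=> exh; have := CK_exhaustive ct exh; have [Er ex] := exh.
rewrite /ck_gap; case EE : (finmap.enum_fset E) => [|n s].
  have [l + _] := ex (idm v) (rng_idm v).
  by rewrite /= -[l \in E]/(l \in finmap.enum_fset E) EE.
rewrite /= cmulBr ck_idm_idem.
have <- : rng n = v by apply: Er; rewrite /= -[n \in E]/(n \in finmap.enum_fset E) EE mem_head.
by rewrite -/(crange n) crange_rng.
Qed.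

Lemma nrm_gap_split (a : A) v T : (forall n, n \in T -> rng n = v) ->
  a ** t (idm v) = a ->
  nrm a <= nrm (a ** ck_gap v T) + \sum_(n <- T) nrm (a ** t n).
Proof.
move=> h av.
have : nrm a <= nrm (a ** ck_gap v T) + \sum_(n <- T) nrm (a ** crange n).
  rewrite /ck_gap foldl_cmul av.
  elim: T a h av => [|n T IHT] a h av /=; first by rewrite big_nil addr0.
  have rn := h n (mem_head _ _).
  have hT m : m \in T -> rng m = v by move=> mT; rewrite h// inE mT orbT.
  rewrite big_cons [nrm (a ** crange n) + _]addrC addrA.
  set q := t (idm v) - crange n; have qp : is_projection q by exact: ck_factor_proj.
  have := IHT (a ** q) hT; rewrite -cmulA.
  have -> : q ** t (idm v) = q by rewrite /q cmulBl ck_idm_idem -rn crange_rngr.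
  move=> /(_ erefl) IH.
  have aE : a = a ** q + a ** crange n by rewrite -cmulDr subrK av.
  rewrite {1}aE (le_trans (nrmD _ _))// lerD2r (le_trans IH)// lerD2l.
  rewrite big_seq [leRHS]big_seq; apply: ler_sum => m mT.
  have -> : a ** q ** crange m = a ** crange m ** q.
    rewrite -(cmulA a q) -(cmulA a (crange m)); congr (_ ** _).
    rewrite /q cmulBl cmulBr (crange_commute n).
    by rewrite -(hT m mT) crange_rng crange_rngr.
  by apply: nrm_mul_le1r; exact: nrm_projection_le1.
move=> /le_trans; apply; rewrite lerD2l; apply: ler_sum => n _.
by rewrite /crange cmulA nrm_mul_le1r// nrm_adj nrm_ck.
Qed.

End CuntzKriegerFamily.

(** * Formal sums of the elements t_g t_d^* *)

Section FormalSums.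
Variables (R : realType) (k : nat) (L : kgraph k).
Implicit Types (e : R[i] * (L * L)) (s : seq (R[i] * (L * L))).

(* A term [(z, (g, d))] stands for z t_g t_d^*. *)
Definition wf_sum s := all (fun e => src e.2.1 == src e.2.2) s.

Definition adj_sum s := [seq (Num.conj e.1, (e.2.2, e.2.1)) | e <- s].

(** Relation (iii) applied to the two inner factors of the product. *)
Definition mul_term e f :=
  [seq (e.1 * f.1, (ccomp e.2.1 p.1, ccomp f.2.2 p.2)) |
     p <- finmap.enum_fset (fset_set (Lmin e.2.2 f.2.1))].

Definition mul_sum s s' := flatten [seq mul_term e f | e <- s, f <- s'].

Definition scale_sum (z : R[i]) s := [seq (z * e.1, e.2) | e <- s].

Definition grade e : {ffun 'I_k -> int} :=
  [ffun i => (deg e.2.1 i)%:Z - (deg e.2.2 i)%:Z].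

Definition grade_le (D : nat) s := all (fun e => [forall i, `|grade e i| <= D%:Z]) s.

Lemma wf_adj s : wf_sum s -> wf_sum (adj_sum s).
Proof. by rewrite /wf_sum all_map; apply: sub_all => e /=; rewrite eq_sym. Qed.

Lemma mem_mul_sum x s s' : finitely_aligned L -> x \in mul_sum s s' ->
  exists e f p, [/\ e \in s, f \in s', Lmin e.2.2 f.2.1 p &
    x = (e.1 * f.1, (ccomp e.2.1 p.1, ccomp f.2.2 p.2))].
Proof.
move=> hfa /flattenP[_ /allpairsP[[e f] /= [es fs ->]] /mapP[p pe ->]].
exists e, f, p; split => //.
by move: pe; rewrite [_ \in finmap.enum_fset _]in_fset_set// inE.
Qed.

Lemma wf_mul s s' : finitely_aligned L -> wf_sum s -> wf_sum s' ->
  wf_sum (mul_sum s s').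
Proof.
move=> hfa /allP ws /allP ws'; apply/allP => x.
move=> /(mem_mul_sum hfa)[e [f [p [es fs [h1 h2 E _] ->]]]] /=.
have /eqP h3 := ws _ es; have /eqP h4 := ws' _ fs.
rewrite !src_comp -?h4 ?h3//.
by rewrite -(src_comp h1) E src_comp.
Qed.

Lemma wf_filter P s : wf_sum s -> wf_sum [seq e <- s | P e].
Proof. by rewrite /wf_sum all_filter; apply: sub_all => e h; apply/implyP. Qed.

Lemma wf_scale z s : wf_sum s -> wf_sum (scale_sum z s).
Proof. by rewrite /wf_sum all_map. Qed.

Lemma wf_cat s s' : wf_sum s -> wf_sum s' -> wf_sum (s ++ s').
Proof. by rewrite /wf_sum all_cat => -> ->. Qed.

Lemma grade_le_mul D D' s s' : finitely_aligned L -> wf_sum s -> wf_sum s' ->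
  grade_le D s -> grade_le D' s' -> grade_le (D + D') (mul_sum s s').
Proof.
move=> hfa /allP ws /allP ws' /allP gs /allP gs'; apply/allP => x.
move=> /(mem_mul_sum hfa)[e [f [p [es fs [h1 h2 E _] ->]]]] /=.
have /eqP h3 := ws _ es; have /eqP h4 := ws' _ fs.
apply/forallP => i; have /forallP/(_ i) := gs _ es; have /forallP/(_ i) := gs' _ fs.
rewrite !ffunE/= !deg_comp -?h4 ?h3// !daddE.
have /ffunP/(_ i) := congr1 (@deg _ _) E; rewrite !deg_comp// !daddE.
move: (deg e.2.1 i) (deg e.2.2 i) (deg f.2.1 i) (deg f.2.2 i) (deg p.1 i) (deg p.2 i).
by move=> a1 a2 a3 a4 a5 a6; lia.
Qed.

Lemma grade_le_exists s : exists D, grade_le D s.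
Proof.
elim: s => [|e s [D h]]; first by exists 0%N.
pose E := (\sum_i `|grade e i|)%N.
exists (D + E)%N; apply/andP; split.
  apply/forallP => i; have : (`|grade e i| <= E)%N.
    by rewrite /E (bigD1 i)//= leq_addr.
  by move: (grade e i) => x; lia.
apply: sub_all h => f /forallP h; apply/forallP => i; move: (h i).
by move: (grade f i) => x; lia.
Qed.

(** The grades lie in the box [-D, D]^k. As D is additive under products, the count for an m-th
    power is polynomial in m. *)
Lemma grade_count D s : grade_le D s ->
  (size (undup (map grade s)) <= (2 * D).+1 ^ k)%N.
Proof.
move=> /allP gs.
pose f (g : {ffun 'I_k -> 'I_(2 * D).+1}) : {ffun 'I_k -> int} :=
  [ffun i => (nat_of_ord (g i))%:Z - D%:Z].
have : {subset undup (map grade s) <= map f (enum {ffun 'I_k -> 'I_(2 * D).+1})}.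
  move=> _ /[!mem_undup]/mapP[e es ->]; have /forallP h := gs e es.
  have hi i : (absz (grade e i + D%:Z)%R < (2 * D).+1)%N.
    by have := h i; move: (grade e i) => x; lia.
  apply/mapP; exists [ffun i => Ordinal (hi i)]; first by rewrite mem_enum.
  apply/ffunP => i; rewrite [RHS]ffunE [in RHS]ffunE/=.
  by have := h i; move: (grade e i) => x; lia.
move=> /(uniq_leq_size (undup_uniq _)); rewrite size_map -cardE.
by rewrite card_ffun !card_ord.
Qed.

Section Evaluation.
Variables (A : cstarAlgType R) (t : L -> A).

Definition ev s : A := \sum_(e <- s) e.1 *: (t e.2.1 ** (t e.2.2)^†).

Lemma ev_cat s s' : ev (s ++ s') = ev s + ev s'.
Proof. exact: big_cat. Qed.

Lemma ev_scale z s : ev (scale_sum z s) = z *: ev s.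
Proof.
by rewrite /ev big_map scaler_sumr; apply: eq_bigr => e _; rewrite scalerA.
Qed.

Lemma ev_adj s : ev (adj_sum s) = (ev s)^†.
Proof.
rewrite /ev big_map cadj_sum; apply: eq_bigr => e _.
by rewrite cadjZ cadjM cadjK.
Qed.

Lemma ev_mul s s' : CK_family t -> finitely_aligned L -> wf_sum s -> wf_sum s' ->
  ev (mul_sum s s') = ev s ** ev s'.
Proof.
move=> ct hfa /allP ws /allP ws'.
rewrite /ev /mul_sum big_flatten/= big_allpairs_dep/= cmul_suml.
rewrite big_seq [RHS]big_seq; apply: eq_bigr => e es.
rewrite cmul_sumr big_seq [RHS]big_seq; apply: eq_bigr => f fs.
rewrite /mul_term big_map/= cmulZl cmulZr scalerA -scaler_sumr; congr (_ *: _).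
rewrite cmulA -(cmulA (t e.2.1)) (ck_adj_mulE ct hfa) cmul_sumr cmul_suml.
rewrite big_seq [RHS]big_seq; apply: eq_bigr => p.
rewrite [_ \in finmap.enum_fset _]in_fset_set// inE => -[h1 h2 _ _].
have /eqP h3 := ws _ es; have /eqP h4 := ws' _ fs.
by rewrite -!(CK_comp ct) ?h3 -?h4// cadjM !cmulA.
Qed.

Lemma ev_grades s :
  ev s = \sum_(n <- undup (map grade s)) ev [seq e <- s | grade e == n].
Proof.
rewrite /ev [RHS](eq_bigr (fun n =>
  \sum_(e <- s | grade e == n) e.1 *: (t e.2.1 ** (t e.2.2)^†))); last first.
  by move=> n _; rewrite big_filter.
rewrite /ev (exchange_big_dep predT)//= big_seq [RHS]big_seq; apply: eq_bigr => e es.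
rewrite -big_filter (eq_filter (a2 := pred1 (grade e))); last by move=> n; rewrite /= eq_sym.
rewrite filter_pred1_uniq ?undup_uniq ?mem_undup ?map_f//.
by rewrite big_seq1.
Qed.

End Evaluation.

End FormalSums.

(** * Gap projections of a closed set of paths *)

Section ClosedSet.
Variables (R : realType) (k : nat) (L : kgraph k) (hfa : finitely_aligned L).
Variables (G : set L) (finG : finite_set G) (clG : min_closed G).
Implicit Types (a b c d g n : L).

Definition tails a : seq L := finmap.enum_fset (fset_set
  [set n | [/\ src a = rng n, G (ccomp a n) & n <> idm (src a)]]).

Lemma tails_finite a :
  finite_set [set n | [/\ src a = rng n, G (ccomp a n) & n <> idm (src a)]].
Proof.
apply: (@sub_finite_set _ _
  (\bigcup_(b in G) [set z | exists2 w, src w = rng z & b = ccomp w z])).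
  by move=> n /= [an Gn _]; exists (ccomp a n) => //; exists a.
by apply: bigcup_finite => // b _; exact: finite_suffix.
Qed.

Lemma tailsP a n : reflect [/\ src a = rng n, G (ccomp a n) & n <> idm (src a)]
  (n \in tails a).
Proof.
rewrite [_ \in tails a]in_fset_set; last exact: tails_finite.
by apply: (iffP idP) => [/set_mem//|h]; exact/mem_set.
Qed.

Lemma tails_rng a n : n \in tails a -> rng n = src a.
Proof. by move=> /tailsP[]. Qed.

(** Closure applied to s = b n, where the initial segment b is replaced by a. *)
Lemma tails_sub a b : G a -> G b -> src a = src b -> deg a = deg b ->
  {subset tails b <= tails a}.
Proof.
move=> Ga Gb sab dab n /tailsP[bn Gbn n1]; apply/tailsP; split; rewrite ?sab//.
apply: (clG Ga Gb Gbn sab dab (z := idm (src n))).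
by rewrite Lmin_initial.
Qed.

Variables (A : cstarAlgType R) (t : L -> A) (ct : CK_family t).

Lemma act_initial g d c (w : A) : src g = src d -> src d = rng c ->
  (t g ** (t d)^†) ** (t (ccomp d c) ** w) = t (ccomp g c) ** w.
Proof.
move=> gd dc; rewrite cmulA -(cmulA (t g)) (ck_adj_comp ct)//.
by rewrite (CK_comp ct) ?gd.
Qed.

(** In a minimal extension d e = b z the path z is not a vertex, so it is a tail of b, hence of a,
    and t_z^* kills w. The vector w is left general to serve both families: it will be a gap
    projection in one and t'_(c d) in the other. *)
Lemma act_gap a b g d (w : A) : G a -> G b -> G d -> src a = src b ->
  deg a = deg b -> (forall n, n \in tails a -> (t n)^† ** w = 0) ->
  ~ initial d b -> (t g ** (t d)^†) ** (t b ** w) = 0.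
Proof.
move=> Ga Gb Gd sab dab h db.
rewrite -cmulA (cmulA (t d)^†) (ck_adj_mulE ct hfa) cmul_suml cmul_sumr.
rewrite big_seq big1// => -[e z]; rewrite mem_Lmin// inE => M.
rewrite -(cmulA (t e)) h ?cmulr0//; have [/= de bz E _] := M.
apply: (tails_sub Ga Gb) => //; apply/tailsP; split => //.
  exact: (clG Gb Gb Gd erefl erefl (Lmin_sym M)).
by move=> z1; apply: db; exists e => //; rewrite E z1 comp_idr.
Qed.

(** Downward induction on the total degree of d: [nrm_gap_split] leaves t_d times its gap, bounded
    by K, and the longer paths d n, which are in G. What matters is that C does not depend on y,
    later a high power of x. *)
Lemma gap_bound : exists2 C : R, 0 <= C & forall (y : A) K, 0 <= K ->
  (forall a, G a -> nrm (y ** (t a ** ck_gap t (src a) (tails a))) <= K) ->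
  forall d, G d -> nrm (y ** t d) <= C * K.
Proof.
have /finite_fsetP[X GX] := finG.
pose D := (\sum_(a <- finmap.enum_fset X) dsum (deg a))%N.
pose M := (\sum_(a <- finmap.enum_fset X) size (tails a))%N.
have DG a : G a -> (dsum (deg a) <= D)%N.
  by rewrite GX => aX; rewrite /D (big_rem a)//= leq_addr.
have MG a : G a -> (size (tails a) <= M)%N.
  by rewrite GX => aX; rewrite /M (big_rem a)//= leq_addr.
have key m : exists2 C : R, 0 <= C & forall (y : A) K, 0 <= K ->
  (forall a, G a -> nrm (y ** (t a ** ck_gap t (src a) (tails a))) <= K) ->
  forall d, G d -> (D - dsum (deg d) < m)%N -> nrm (y ** t d) <= C * K.
  elim: m => [|m [C C0 IHm]]; first by exists 0.
  exists (1 + C *+ M); first by rewrite addr_ge0 ?mulrn_wge0.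
  move=> y K K0 h d Gd dm.
  have CK0 : 0 <= C * K by rewrite mulr_ge0.
  have yd : y ** t d ** t (idm (src d)) = y ** t d by rewrite -cmulA (ck_src ct).
  have := nrm_gap_split ct hfa (@tails_rng d) yd.
  move=> /le_trans; apply; rewrite mulrDl mul1r; apply: lerD.
    by rewrite -cmulA h.
  apply: (@le_trans _ _ (\sum_(n <- tails d) C * K)); last first.
    rewrite big_const_seq count_predT iter_addr_0 mulrnAl.
    by rewrite ler_wpMn2l// MG.
  rewrite big_seq [leRHS]big_seq; apply: ler_sum => n /tailsP[dn Gdn n1].
  rewrite -cmulA (CK_comp ct)//; apply: IHm => //.
  have := DG _ Gdn; rewrite deg_comp// dsumD.
  have : (0 < dsum (deg n))%N.
    rewrite lt0n; apply/eqP => /dsum0P /deg0_idm nE.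
    by apply: n1; rewrite nE dn.
  by lia.
have [C C0 h] := key D.+1; exists C => // y K K0 hK d Gd.
by apply: h; rewrite // ltnS leq_subr.
Qed.

End ClosedSet.

(** * Comparison of graded components *)

Section OrthonormalIsometries.
Variables (R : realType) (B : cstarAlgType R) (I : eqType) (V : I -> B) (P : B).
Variables (U : seq I) (uU : uniq U) (projP : is_projection P).
Hypothesis VV : {in U &, forall i j, (V i)^† ** V j = if i == j then P else 0}.
Hypothesis VP : {in U, forall i, V i ** P = V i}.
Implicit Types (Q : pred I) (i j : I).

Definition range_proj Q : B := \sum_(i <- U | Q i) V i ** (V i)^†.

Lemma range_proj_mul Q j : j \in U -> range_proj Q ** V j = if Q j then V j else 0.
Proof.
move=> jU; rewrite /range_proj cmul_suml (big_rem j)//= -cmulA VV// eqxx VP//.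
rewrite big_seq_cond big1 ?addr0// => i /andP[/[!mem_rem_uniq]// /[!inE]/andP[ij iU] _].
by rewrite -cmulA VV// (negPf ij) cmulr0.
Qed.

Lemma range_proj_adj Q : (range_proj Q)^† = range_proj Q.
Proof. by rewrite cadj_sum; apply: eq_bigr => i _; rewrite cadjM cadjK. Qed.

Lemma range_proj_le1 Q : nrm (range_proj Q) <= 1.
Proof.
apply: nrm_projection_le1; split; first exact: range_proj_adj.
rewrite {2}/range_proj cmul_sumr [RHS]/range_proj.
rewrite big_seq_cond [RHS]big_seq_cond; apply: eq_bigr => i /andP[iU Qi].
by rewrite cmulA range_proj_mul// Qi.
Qed.

(** Multiplying by V_i^* leaves w_i P, and the non-zero projection P has norm 1. *)
Lemma coef_le (Cs : seq I) (w : I -> R[i]) i : uniq Cs -> {subset Cs <= U} ->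
  P <> 0 -> nrm (V i) <= 1 -> i \in Cs ->
  nrm (w i) <= nrm (\sum_(j <- Cs) w j *: V j).
Proof.
move=> uC CU P0 Vi iC.
have : (V i)^† ** (\sum_(j <- Cs) w j *: V j) = w i *: P.
  rewrite cmul_sumr (big_rem i)//= cmulZr VV ?CU// eqxx.
  rewrite big_seq big1 ?addr0// => j /[!mem_rem_uniq]// /[!inE]/andP[ij jC].
  by rewrite cmulZr VV ?CU// eq_sym (negPf ij) scaler0.
move=> /(congr1 (@nrm _ _)); rewrite nrmZ (nrm_projection projP P0) mulr1 => <-.
by apply: nrm_mul_le1l; rewrite nrm_adj.
Qed.
End OrthonormalIsometries.

(** * Transfer of the matrix of a graded component to the second family *)

Section Estimate.
Variables (R : realType) (k : nat) (L : kgraph k) (hfa : finitely_aligned L).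
Implicit Types (a b c d g : L) (s : seq (R[i] * (L * L))).

Lemma grade_mul_sum s s' x : wf_sum s -> wf_sum s' -> x \in mul_sum s s' ->
  exists e f, [/\ e \in s, f \in s' & grade x = grade e + grade f].
Proof.
move=> /allP ws /allP ws' /(mem_mul_sum hfa)[e [f [p [es fs [h1 h2 E _] ->]]]].
exists e, f; split => //; apply/ffunP => i; rewrite !ffunE/=.
have /eqP h3 := ws _ es; have /eqP h4 := ws' _ fs.
rewrite !deg_comp -?h4 ?h3// !daddE.
have /ffunP/(_ i) := congr1 (@deg _ _) E; rewrite !deg_comp// !daddE.
move: (deg e.2.1 i) (deg e.2.2 i) (deg f.2.1 i) (deg f.2.2 i) (deg p.1 i) (deg p.2 i).
by move=> a1 a2 a3 a4 a5 a6; lia.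
Qed.

(** The grades -n and n of the two factors cancel. *)
Lemma grade_adj_mul s n x : wf_sum s -> all (fun e => grade e == n) s ->
  x \in mul_sum (adj_sum s) s -> deg x.2.1 = deg x.2.2.
Proof.
move=> ws /allP hs /(grade_mul_sum (wf_adj ws) ws)[e [f [+ /hs/eqP fn E]]].
move=> /mapP[e' /hs/eqP en eE]; apply/ffunP => i.
have /ffunP/(_ i) := E; rewrite eE [RHS]ffunE fn -en !ffunE/=.
move: (deg e'.2.1 i) (deg e'.2.2 i) (deg x.2.1 i) (deg x.2.2 i).
by move=> a1 a2 a3 a4; lia.
Qed.

Variables (G : set L) (finG : finite_set G) (clG : min_closed G).

Definition quot d b : L := xget b [set c | src d = rng c /\ b = ccomp d c].

Lemma quotP d b : initial d b -> src d = rng (quot d b) /\ b = ccomp d (quot d b).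
Proof.
move=> [c h1 h2].
by apply: (@xgetPex _ b [set c | src d = rng c /\ b = ccomp d c]); exists c.
Qed.

Lemma act_gapE (A : cstarAlgType R) (t : L -> A) a b g d (w : A) :
  CK_family t -> G a -> G b -> G d -> src a = src b -> deg a = deg b ->
  src g = src d -> (forall n, n \in tails G a -> (t n)^† ** w = 0) ->
  (t g ** (t d)^†) ** (t b ** w) =
  if `[< initial d b >] then t (ccomp g (quot d b)) ** w else 0.
Proof.
move=> ct Ga Gb Gd sab dab gd h; case: asboolP => [/quotP[h1 h2]|db].
  by rewrite {1}h2 act_initial.
exact: (act_gap hfa finG clG ct _ Ga Gb Gd sab dab h db).
Qed.

Variables (A B : cstarAlgType R) (t : L -> A) (t' : L -> B).
Variables (ct : CK_family t) (ct' : CK_family t').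
Hypothesis t'0 : forall v : obj L, t' (idm v) <> 0.
Hypothesis hap : forall v : obj L, exists x : gpath L,
    [/\ is_boundary_path x, grng x = v
      & forall l m : L, src l = v -> src m = v -> l <> m ->
          concat l x <> concat m x].
Variables (s : seq (R[i] * (L * L))) (ws : wf_sum s) (n : {ffun 'I_k -> int}).
Hypothesis sG : forall e, e \in s -> G e.2.2.

Let b := [seq e <- s | grade e == n].
Let x := mul_sum (adj_sum b) b.
Hypothesis xG : forall e, e \in x -> G e.2.1 /\ G e.2.2.

Let wb : wf_sum b. Proof. exact: wf_filter. Qed.
Let wx : wf_sum x. Proof. by apply: wf_mul => //; exact: wf_adj. Qed.

Let degx e : e \in x -> deg e.2.1 = deg e.2.2.
Proof. by apply: (@grade_adj_mul b n) => //; exact: filter_all. Qed.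

Lemma gap_separated a : ck_gap t (src a) (tails G a) <> 0 ->
  exists2 c, rng c = src a & forall m, m \in tails G a -> ~ compatible m c.
Proof.
move=> g0; apply: contrapT => h; apply: g0.
apply: (ck_gap_exhaustive ct); split.
  by move=> m mT; apply: tails_rng finG _ _ mT.
move=> m rm; apply: contrapT => h'; apply: h; exists m => // l lT lm.
by apply: h'; exists l => //; exact: compatible_Lmin.
Qed.

(** The power of x applied to t_a R is a combination of the t_c R with at most as many terms as G
    has elements. Its coefficients can be read off in the second algebra, where x acts on the V_c as
    T^* T for a compression T of the whole sum s. *)
Lemma coef_bound a q : G a ->
  nrm (cexp (ev t x) q ** (t a ** ck_gap t (src a) (tails G a))) <=
  (size (finmap.enum_fset (fset_set G)))%:R * (nrm (ev t' s) ^+ 2) ^+ q.+1.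
Proof.
move=> Ga; set v := src a; set T := tails G a; set Rg := ck_gap t v T.
set Gs := finmap.enum_fset (fset_set G).
have GsP c : (c \in Gs) = (c \in G) by rewrite /Gs [LHS]in_fset_set.
have [g0|g0] := pselect (Rg = 0).
  by rewrite g0 !cmulr0 nrm0 mulr_ge0// exprn_ge0// exprn_ge0// nrm_ge0.
have [nu rnu nuT] := gap_separated g0.
(* The terms of x have degree 0, so they send each t_c R with c in [Cs] to another such vector or to
   0. *)
pose Cs := [seq c <- Gs | (src c == v) && (deg c == deg a)].
have CsP c : reflect [/\ G c, src a = src c & deg a = deg c] (c \in Cs).
  rewrite mem_filter GsP; apply: (iffP idP).
    by move=> /andP[/andP[/eqP -> /eqP ->] /set_mem].
  by move=> [h <- <-]; rewrite !eqxx/=; exact/mem_set.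
have uC : uniq Cs by rewrite filter_uniq// /Gs finmap.fset_uniq.
(* The images of [Cs] under the terms of s of every grade are included, so that the V_c stay
   orthonormal there and a projection can pick out one grade. *)
pose Kall := Cs ++ [seq ccomp e.2.1 (quot e.2.2 c) | e <- s, c <- Cs].
pose U := undup [seq c <- Kall | src c == v].
have uU : uniq U by exact: undup_uniq.
have Usrc c : c \in U -> src c = rng nu.
  by rewrite mem_undup mem_filter => /andP[/eqP -> _].
have CU : {subset Cs <= U}.
  move=> c cC; rewrite mem_undup mem_filter mem_cat cC/= andbT.
  by move/CsP : cC => [_ /esym/eqP].
have KU e c : e \in s -> c \in Cs -> initial e.2.2 c -> ccomp e.2.1 (quot e.2.2 c) \in U.
  move=> es cC ic; rewrite mem_undup mem_filter mem_cat; apply/andP; split.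
    have /allP/(_ _ es)/eqP h := ws; have [h1 h2] := quotP ic.
    by rewrite src_comp ?h// -(src_comp h1) -h2; move/CsP : cC => [_ /esym/eqP].
  by apply/orP; right; apply/allpairsP; exists (e, c); split.
have Snu : [set` [seq ccomp c nu | c <- U]] `<=` [set l | src l = src nu].
  by move=> _ /= /mapP[c cU ->]; rewrite src_comp// Usrc.
have [tau rtau htau] := separating_path (hap (src nu)) (finite_seq _) Snu.
have nutau : src nu = rng tau by rewrite rtau.
(* The vector w' plays the role of R: the choice of nu makes the tails kill it, and the choice of
   tau makes the V_c orthonormal. *)
pose w' := t' (ccomp nu tau); pose V c := t' c ** w'; pose P := t' (idm (src tau)).
have projP : is_projection P by exact: (CK_proj ct').
have VE c : c \in U -> V c = t' (ccomp (ccomp c nu) tau).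
  move=> cU; have cnu := Usrc c cU.
  by rewrite -compA// /V /w' (CK_comp ct')// rng_comp.
have VV : {in U &, forall c d, (V c)^† ** V d = if c == d then P else 0}.
  move=> c d cU dU; rewrite !VE//; case: eqP => [->|cd].
    have dnu := Usrc d dU.
    by rewrite (ck_adj_mul ct') src_comp ?src_comp.
  rewrite (ck_adj_incompatible ct')// => /htau h; apply: cd.
  by apply: (@ccompIr _ _ _ _ nu); rewrite ?Usrc//; apply: h; exact: map_f.
have VP : {in U, forall c, V c ** P = V c}.
  move=> c cU; rewrite /V /w' /P -cmulA.
  by rewrite -[in idm (src tau)](src_comp nutau) (ck_src ct').
have VN c : nrm (V c) <= 1.
  by rewrite (le_trans (nrm_mul_le1r _ _))// (nrm_ck ct').
have w'T m : m \in T -> (t' m)^† ** w' = 0.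
  move=> mT; apply: (ck_adj_incompatible ct') => h; apply: (nuT m mT).
  exact: compatible_initial h (initial_ccomp _).
have RgT m : m \in T -> (t m)^† ** Rg = 0.
  by apply: (ck_adj_gap ct hfa) => l /(tails_rng finG).
(* Equal coefficients on both sides, as a relation rather than a map, so that linear independence of
   the t_c R is never at issue. *)
pose W (p : A) (p' : B) := exists w : L -> R[i],
  p = \sum_(c <- Cs) w c *: (t c ** Rg) /\ p' = \sum_(c <- Cs) w c *: V c.
have W0 : W 0 0.
  by exists (fun=> 0); split; rewrite big1// => c _; rewrite scale0r.
have WD p p' r r' : W p p' -> W r r' -> W (p + r) (p' + r').
  move=> [w [-> ->]] [z [-> ->]]; exists (fun c => w c + z c).
  by rewrite -!big_split; split; apply: eq_bigr => c _; rewrite scalerDl.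
have WZ z p p' : W p p' -> W (z *: p) (z *: p').
  move=> [w [-> ->]]; exists (fun c => z * w c).
  by rewrite !scaler_sumr; split; apply: eq_bigr => c _; rewrite scalerA.
have WV c : c \in Cs -> W (t c ** Rg) (V c).
  move=> cC; exists (fun d => (d == c)%:R).
  by rewrite !(big_rem c cC)/= !eqxx !scale1r !big_seq !big1 ?addr0// => d;
    rewrite mem_rem_uniq// inE => /andP[/negPf -> _]; rewrite scale0r.
have WS : forall (I : eqType) (r : seq I) F F', (forall i, i \in r -> W (F i) (F' i)) ->
    W (\sum_(i <- r) F i) (\sum_(i <- r) F' i).
  move=> I r F F' h; rewrite big_seq [X in W _ X]big_seq.
  by apply: (big_ind2 W).
have WX p p' : W p p' -> W (ev t x ** p) (ev t' x ** p').
  move=> [w [-> ->]]; rewrite !cmul_sumr; apply: (WS) => c cC.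
  rewrite !cmulZr; apply: (WZ); rewrite /ev !cmul_suml; apply: (WS) => e ex.
  rewrite !cmulZl; apply: (WZ); have /CsP[Gc sc dc] := cC; have [Gg Gd] := xG ex.
  have /allP/(_ _ ex)/eqP gd := wx.
  rewrite (act_gapE ct Ga Gc Gd sc dc gd RgT) (act_gapE ct' Ga Gc Gd sc dc gd w'T).
  case: asboolP => [/quotP[h1 h2]|_]; last exact: W0.
  apply: WV; apply/CsP; split.
  - apply: (clG Gg Gd Gc gd (degx ex) (z := idm (src (quot e.2.2 c)))).
    by rewrite [in X in Lmin _ X]h2 Lmin_initial.
  - by rewrite src_comp ?gd// sc [in LHS]h2 src_comp.
  - by rewrite deg_comp ?gd// dc [in LHS]h2 deg_comp// (degx ex).
pose N c := [ffun i => (deg c i)%:Z - (deg a i)%:Z] == n.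
pose Q1 c := c \in Cs.
pose Pi1 := range_proj V U Q1; pose Pi2 := range_proj V U N.
(* A term of grade g sends V_c to 0 or to some V_d with deg d = deg a + g, so [Pi2] keeps exactly
   the terms of grade n. *)
have Pi2S c : c \in Cs -> Pi2 ** (ev t' s ** V c) = ev t' b ** V c.
  move=> cC; rewrite /ev [X in Pi2 ** X]cmul_suml [RHS]cmul_suml [LHS]cmul_sumr.
  rewrite [RHS]big_filter [RHS]big_mkcond/=.
  rewrite big_seq [RHS]big_seq; apply: eq_bigr => e es.
  have /CsP[Gc sc dc] := cC; have Gd := sG es.
  have /allP/(_ _ es)/eqP gd := ws.
  rewrite cmulZl cmulZr (act_gapE ct' Ga Gc Gd sc dc gd w'T).
  case: asboolP => [ic|_]; last by rewrite cmulr0 scaler0 if_same.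
  rewrite [Pi2 ** _](range_proj_mul uU VV VP) ?KU//.
  have [h1 h2] := quotP ic.
  have -> : N (ccomp e.2.1 (quot e.2.2 c)) = (grade e == n).
    congr (_ == n); apply/ffunP => i; rewrite !ffunE dc [in X in _ - X]h2.
    rewrite !deg_comp ?gd// !daddE.
    move: (deg e.2.1 i) (deg e.2.2 i) (deg (quot e.2.2 c) i) => a1 a2 a3; lia.
  by case: ifP; rewrite ?scaler0.
have Pi1V p p' : W p p' -> Pi1 ** p' = p'.
  move=> [w [_ ->]]; rewrite cmul_sumr big_seq [RHS]big_seq; apply: eq_bigr => c cC.
  by rewrite cmulZr [Pi1 ** _](range_proj_mul uU VV VP) ?CU// /Q1 cC.
pose X' := ev t' x.
have X'E : X' = (ev t' b)^† ** ev t' b.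
  by rewrite /X' /x ev_mul// ?ev_adj//; exact: wf_adj.
(* Compression costs nothing in norm, and by [Pi2S] it turns s into its component b on the span. *)
pose Tt := Pi2 ** ev t' s ** Pi1.
have TtE : Tt = ev t' b ** Pi1.
  rewrite /Tt /Pi1 /range_proj [LHS]cmul_sumr [RHS]cmul_sumr.
  rewrite big_seq_cond [RHS]big_seq_cond; apply: eq_bigr => c /andP[_ cC].
  rewrite [LHS](cmulA _ (V c)) -(cmulA Pi2 (ev t' s) (V c)) Pi2S//.
  by rewrite -(cmulA _ (V c)).
have TtN : nrm Tt <= nrm (ev t' s).
  apply: le_trans (nrm_mul_le1r _ _) _; first exact: (range_proj_le1 uU VV VP).
  by apply: nrm_mul_le1l; exact: (range_proj_le1 uU VV VP).
have TtV p p' : W p p' -> (Tt^† ** Tt) ** p' = X' ** p'.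
  move=> Wp; rewrite TtE cadjM [Pi1^†]range_proj_adj.
  rewrite !cmulA -(cmulA _ Pi1) (Pi1V _ _ Wp).
  rewrite -(cmulA Pi1) -X'E -cmulA.
  by rewrite (Pi1V _ _ (WX _ _ Wp)).
(* Since x preserves the span, and X' agrees with T^* T there, their powers agree on V_a. *)
have Wq j : W (cexp (ev t x) j ** (t a ** Rg)) (cexp X' j ** V a) /\
    cexp X' j ** V a = cexp (Tt^† ** Tt) j ** V a.
  have WVa : W (t a ** Rg) (V a) by apply: WV; apply/CsP.
  elim: j => [|j [IH1 IH2]].
    by split; [exact: WX|exact: (esym (TtV _ _ WVa))].
  rewrite /= -(cmulA (ev t x)) -(cmulA X') -(cmulA (Tt^† ** Tt)).
  split; first exact: WX.
  by rewrite -IH2 (TtV _ _ IH1).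
have [[w [-> E]] E'] := Wq q.
apply: (@le_trans _ _ (\sum_(c <- Cs) (nrm (ev t' s) ^+ 2) ^+ q.+1)).
  apply: le_trans (nrm_sum _ _ _) _.
  rewrite big_seq [leRHS]big_seq; apply: ler_sum => c cC; rewrite nrmZ.
  apply: (@le_trans _ _ (nrm (w c))).
    rewrite ler_piMr ?nrm_ge0// (le_trans (nrm_mul_le1r _ _)) ?(nrm_ck ct)//.
    by apply: (ck_gap_le1 ct) => m /(tails_rng finG).
  apply: le_trans (coef_le projP VV w uC CU (@t'0 (src tau)) (VN c) cC) _.
  rewrite -E E'; apply: le_trans (nrm_mul_le1r _ (VN a)) _.
  apply: le_trans (nrm_cexp_le _ _) _.
  by rewrite nrm_cstar lerXn2r// ?nnegrE ?exprn_ge0 ?nrm_ge0// lerXn2r// nnegrE nrm_ge0.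
rewrite big_const_seq count_predT iter_addr_0 -[leLHS]mulr_natl.
rewrite ler_wpM2r// ?exprn_ge0 ?nrm_ge0// ler_nat.
by rewrite size_filter count_size.
Qed.

End Estimate.

(** * Independence of the norm of a finite sum from the family *)

Section NormComparison.
Variables (R : realType) (k : nat) (L : kgraph k) (hfa : finitely_aligned L).
Implicit Types (s : seq (R[i] * (L * L))).

Fixpoint pow_sum s n := if n is n'.+1 then mul_sum s (pow_sum s n') else s.

Lemma wf_pow s n : wf_sum s -> wf_sum (pow_sum s n).
Proof. by move=> ws; elim: n => //= n IHn; exact: wf_mul. Qed.

Lemma grade_le_pow D s n : wf_sum s -> grade_le D s ->
  grade_le (D * n.+1) (pow_sum s n).
Proof.
move=> ws gs; elim: n => [|n IHn]; first by rewrite muln1.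
by rewrite mulnS; apply: grade_le_mul => //; exact: wf_pow.
Qed.

Lemma ev_pow (A : cstarAlgType R) (t : L -> A) s n : CK_family t -> wf_sum s ->
  ev t (pow_sum s n) = cexp (ev t s) n.
Proof.
move=> ct ws; elim: n => //= n IHn.
by rewrite ev_mul// ?IHn//; exact: wf_pow.
Qed.

Variables (A B : cstarAlgType R) (t : L -> A) (t' : L -> B).
Variables (ct : CK_family t) (ct' : CK_family t').
Hypothesis t'0 : forall v : obj L, t' (idm v) <> 0.
Hypothesis hap : forall v : obj L, exists x : gpath L,
    [/\ is_boundary_path x, grng x = v
      & forall l m : L, src l = v -> src m = v -> l <> m ->
          concat l x <> concat m x].

(** The finite set G is generated by both paths of each term of x, so that x preserves the spans,
    and by the second paths of the terms of s, to which [act_gap] is applied. *)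
Lemma ev_component_le s (n : {ffun 'I_k -> int}) : wf_sum s ->
  nrm (ev t [seq e <- s | grade e == n]) <= nrm (ev t' s).
Proof.
move=> ws; set b := [seq e <- s | _].
have wb : wf_sum b by exact: wf_filter.
pose x := mul_sum (adj_sum b) b.
have wx : wf_sum x by apply: wf_mul => //; exact: wf_adj.
pose E : set L := [set` [seq e.2.1 | e <- x] ++ [seq e.2.2 | e <- x] ++ [seq e.2.2 | e <- s]].
have [G [finG EG clG]] := min_closure hfa (finite_seq _ : finite_set E).
have xG e : e \in x -> G e.2.1 /\ G e.2.2.
  by move=> ex; split; apply: EG; rewrite /E /= !mem_cat (map_f _ ex) ?orbT.
have sG e : e \in s -> G e.2.2.
  by move=> es; apply: EG; rewrite /E /= !mem_cat (map_f _ es) !orbT.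
have [C C0 hC] := gap_bound hfa finG ct.
pose X := ev t x; pose Y := nrm (ev t' s) ^+ 2.
have XE : X = (ev t b)^† ** ev t b.
  by rewrite /X /x ev_mul// ?ev_adj//; exact: wf_adj.
have Xadj : X^† = X by rewrite XE cadjM cadjK.
have Y0 : 0 <= Y by rewrite exprn_ge0// nrm_ge0.
suff : nrm X <= Y.
  by rewrite XE nrm_cstar /Y ler_sqr ?nnegrE ?nrm_ge0.
pose N : R := (size (finmap.enum_fset (fset_set G)))%:R.
pose c := (\sum_(e <- x) nrm e.1) * (C * N).
apply: (@pow2_shift_le _ _ _ c) => //; first exact: nrm_ge0.
move=> j; rewrite -nrm_cexp2//.
have [q ->] : exists q, (2 ^ j.+1).-1 = q.+1.
  by exists (2 ^ j.+1).-2; rewrite expnS; have := expn_gt0 2 j; lia.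
(* The last factor x is expanded into terms z t_g t_d^*; dropping the contraction t_d^* leaves a
   power of x times t_g, as [gap_bound] requires. This costs one power of Y, which [pow2_shift_le]
   allows for. *)
rewrite cexpSr {2}/X /ev cmul_sumr /c -mulrA mulr_suml.
apply: le_trans (nrm_sum _ _ _) _.
rewrite big_seq [leRHS]big_seq; apply: ler_sum => e ex.
rewrite cmulZr nrmZ ler_wpM2l ?nrm_ge0//.
rewrite cmulA; apply: le_trans (nrm_mul_le1r _ _) _.
  by rewrite nrm_adj (nrm_ck ct).
rewrite -mulrA; apply: hC; first by rewrite mulr_ge0// exprn_ge0.
  by move=> a Ga; apply: (coef_bound hfa finG clG ct ct' t'0 hap ws sG xG q Ga).
by have [] := xG e ex.
Qed.

Lemma ev_le s : wf_sum s -> nrm (ev t s) <= nrm (ev t' s).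
Proof.
move=> ws; pose h := mul_sum (adj_sum s) s.
have wh : wf_sum h by apply: wf_mul => //; exact: wf_adj.
have [D hD] := grade_le_exists h.
have hE (C : cstarAlgType R) (u : L -> C) : CK_family u -> ev u h = (ev u s)^† ** ev u s.
  by move=> cu; rewrite /h ev_mul// ?ev_adj//; exact: wf_adj.
suff : nrm (ev t h) <= nrm (ev t' h).
  by rewrite !hE// !nrm_cstar ler_sqr ?nnegrE ?nrm_ge0.
(* The grades of the 2^j-th power of h are bounded by D 2^j, and 2 D 2^j + 1 <= (2 D + 1) (2^j +
   1). *)
apply: (@pow2_growth_le _ _ _ (((2 * D).+1 ^ k)%:R) k) => [||j]; rewrite ?nrm_ge0//.
rewrite -!nrm_cexp2; try by rewrite hE// cadjM cadjK.
set q := (2 ^ j).-1; have qE : (2 ^ j = q.+1)%N by rewrite prednK// expn_gt0.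
rewrite -!ev_pow// ev_grades.
apply: le_trans (nrm_sum _ _ _) _.
apply: (@le_trans _ _ (\sum_(n <- undup (map (@grade _ _ _) (pow_sum h q))) nrm (ev t' (pow_sum h q)))).
  by apply: ler_sum => n _; apply: ev_component_le; exact: wf_pow.
rewrite big_const_seq count_predT iter_addr_0 -[leLHS]mulr_natl.
rewrite ler_wpM2r ?nrm_ge0// -natrM ler_nat -expnMn.
apply: leq_trans (grade_count (grade_le_pow _ wh hD)) _.
case: (k) => [|k']; first by rewrite !expn0.
by rewrite leq_exp2r// qE; nia.
Qed.

End NormComparison.

(** * Passing to the generated C*-algebras *)

Section NormTopology.
Variables (R : realType) (A : cstarAlgType R).
Implicit Types (a b : A) (S : set A).

Lemma ltcR_pos (e : R[i]) : 0 < e -> exists2 d : R, 0 < d & e = d%:C%C.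
Proof.
move=> e0; have eE : (complex.Re e)%:C%C = e by exact/RRe_real/gtr0_real.
by exists (complex.Re e); rewrite ?eE// -ltcR eE.
Qed.

Lemma nrm_lt a (d : R) : (`|a| < d%:C%C) = (nrm a < d).
Proof. by rewrite nrmE ltcR. Qed.

Lemma closed_nrmP S : closed S <->
  forall a, (forall e : R, 0 < e -> exists2 b, S b & nrm (a - b) < e) -> S a.
Proof.
split => [cS a h|h a ca]; apply: cS || apply: h.
  move=> B /nbhs_ballP[e /= e0 eB]; have [d d0 dE] := ltcR_pos e0.
  have [b Sb ab] := h d d0; exists b; split => //; apply: eB.
  by rewrite -ball_normE /= dE nrm_lt.
move=> e e0; have [|b [Sb]] := ca (ball a e%:C%C).
  by apply: nbhsx_ballx; rewrite ltcR.
by rewrite -ball_normE /= nrm_lt => ab; exists b.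
Qed.

Lemma nrm_cauchy_cvg (u : nat -> A) : (forall e : R, 0 < e ->
    exists N, forall n, (N <= n)%N -> nrm (u N - u n) < e) ->
  exists a, forall e : R, 0 < e -> exists N, forall n, (N <= n)%N -> nrm (a - u n) < e.
Proof.
move=> h; have : cvg (u @ \oo).
  apply: cauchy_cvg; apply: cauchy_exP => e e0; have [d d0 dE] := ltcR_pos e0.
  have [N hN] := h d d0; exists (u N); exists N => // n /= Nn.
  by rewrite -ball_normE /= dE nrm_lt hN.
move=> /cvgrPdist_lt cu; exists (lim (u @ \oo)) => e e0.
have [|N _ hN] := cu (e%:C%C); first by rewrite ltcR.
by exists N => n /hN /=; rewrite nrm_lt.
Qed.

End NormTopology.

(** * Extension of the correspondence of finite sums to their closures *)

Section Approximation.
Variables (R : realType) (k : nat) (L : kgraph k) (hfa : finitely_aligned L).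
Implicit Types (s : seq (R[i] * (L * L))).

(* [(a, b)] lies in the closure of the set of pairs [(ev t s, ev t' s)]. *)
Definition approx (A B : cstarAlgType R) (t : L -> A) (t' : L -> B) a b :=
  forall e : R, 0 < e -> exists s, [/\ wf_sum s, nrm (a - ev t s) <= e &
    nrm (b - ev t' s) <= e].

Lemma approx_sym (A B : cstarAlgType R) (t : L -> A) (t' : L -> B) a b :
  approx t t' a b -> approx t' t b a.
Proof. by move=> h e /h[s [ws h1 h2]]; exists s. Qed.

Lemma approx_left (A B : cstarAlgType R) (t : L -> A) (t' : L -> B) a b :
  approx t t' a b -> approx t t a a.
Proof. by move=> h e /h[s [ws h1 h2]]; exists s. Qed.

Section Pair.
Variables (A B : cstarAlgType R) (t : L -> A) (t' : L -> B).
Variables (ct : CK_family t) (ct' : CK_family t').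

Lemma approx_ev s : wf_sum s -> approx t t' (ev t s) (ev t' s).
Proof. by move=> ws e e0; exists s; rewrite !subrr !nrm0 ltW. Qed.

Lemma approx_gen l : approx t t' (t l) (t' l).
Proof.
have := @approx_ev [:: (1, (l, idm (src l)))].
rewrite /ev !big_seq1/= !scale1r !ck_idm_adj// !ck_src//; apply.
by rewrite /wf_sum/= src_idm eqxx.
Qed.

(** The restriction e <= 1 serves products, whose error would otherwise contain a quadratic term. *)
Lemma approxI (c : R) a b : 0 <= c -> (forall e : R, 0 < e -> e <= 1 ->
  exists s, [/\ wf_sum s, nrm (a - ev t s) <= c * e & nrm (b - ev t' s) <= c * e]) ->
  approx t t' a b.
Proof.
move=> c0 h e e0; pose d := Num.min 1 (e / (c + 1)).
have c1 : 0 < c + 1 by rewrite ltr_wpDl.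
have d0 : 0 < d by rewrite lt_min ltr01 divr_gt0.
have d1 : d <= 1 by rewrite ge_min lexx.
have cd : c * d <= e.
  apply: (@le_trans _ _ ((c + 1) * d)); first by rewrite ler_wpM2r ?lerDl// ltW.
  by rewrite mulrC -ler_pdivlMr// ge_min lexx orbT.
have [s [ws h1 h2]] := h d d0 d1.
by exists s; split => //; apply: le_trans cd.
Qed.

Lemma approx_lin (z : R[i]) a b a' b' : approx t t' a b -> approx t t' a' b' ->
  approx t t' (z *: a + a') (z *: b + b').
Proof.
move=> h h'; apply: (@approxI (nrm z + 1)); first by rewrite addr_ge0// nrm_ge0.
move=> e e0 _; have [s [ws h1 h2]] := h e e0; have [s' [ws' h1' h2']] := h' e e0.
exists (scale_sum z s ++ s'); split; first exact/wf_cat/ws'/wf_scale.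
  rewrite ev_cat ev_scale opprD addrACA -scalerBr (le_trans (nrmD _ _))//.
  by rewrite nrmZ mulrDl mul1r lerD// ler_wpM2l// nrm_ge0.
rewrite ev_cat ev_scale opprD addrACA -scalerBr (le_trans (nrmD _ _))//.
by rewrite nrmZ mulrDl mul1r lerD// ler_wpM2l// nrm_ge0.
Qed.

Lemma approx_mul a b a' b' : approx t t' a b -> approx t t' a' b' ->
  approx t t' (a ** a') (b ** b').
Proof.
have bound (C : cstarAlgType R) (x y x' y' : C) (e : R) : 0 < e -> e <= 1 ->
    nrm (x - y) <= e -> nrm (x' - y') <= e ->
    nrm (x ** x' - y ** y') <= (nrm x + nrm x' + 1) * e.
  move=> e0 e1 h h'.
  have -> : x ** x' - y ** y' = x ** (x' - y') + (x - y) ** y'.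
    by rewrite cmulBr cmulBl addrA subrK.
  apply: le_trans (nrmD _ _) _; rewrite -addrA mulrDl; apply: lerD.
    by rewrite (le_trans (nrmM _ _))// ler_wpM2l// nrm_ge0.
  rewrite (le_trans (nrmM _ _))// mulrC ler_pM ?nrm_ge0//.
  have -> : y' = x' - (x' - y') by rewrite subKr.
  by rewrite (le_trans (nrmD _ _))// nrmN lerD// (le_trans h').
move=> h h'; apply: (@approxI ((nrm a + nrm a' + 1) + (nrm b + nrm b' + 1))).
  by rewrite !addr_ge0// ?nrm_ge0.
move=> e e0 e1; have [s [ws h1 h2]] := h e e0; have [s' [ws' h1' h2']] := h' e e0.
exists (mul_sum s s'); rewrite !ev_mul//; split; first exact: wf_mul.
  apply: le_trans (bound _ _ _ _ _ _ e0 e1 h1 h1') _.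
  by rewrite ler_wpM2r ?(ltW e0)// lerDl !addr_ge0 ?nrm_ge0.
apply: le_trans (bound _ _ _ _ _ _ e0 e1 h2 h2') _.
by rewrite ler_wpM2r ?(ltW e0)// lerDr !addr_ge0 ?nrm_ge0.
Qed.

Lemma approx_adj a b : approx t t' a b -> approx t t' a^† b^†.
Proof.
move=> h e /h[s [ws h1 h2]]; exists (adj_sum s); split; first exact: wf_adj.
  by rewrite ev_adj -cadjB nrm_adj.
by rewrite ev_adj -cadjB nrm_adj.
Qed.

End Pair.

(** The diagonal case of [approx] is the closure of the finite sums, which contains the t_l and is
    already closed under the operations because formal sums are. *)
Lemma cstar_generatedE (A : cstarAlgType R) (t : L -> A) : CK_family t ->
  cstar_generated (range t) = [set a | approx t t a a].
Proof.
move=> ct; apply/seteqP; split.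
  apply: smallest_sub; last by move=> _ [l _ <-]; exact: approx_gen.
  split.
  - apply/closed_nrmP => a h e e0.
    have e2 : 0 < e / 2 by rewrite divr_gt0.
    have [b hb ab] := h (e / 2) e2; have [s [ws h1 _]] := hb (e / 2) e2.
    by exists s; split => //; rewrite (le_trans (nrm_tri _ b _))// (splitr e) lerD// ltW.
  - by have := @approx_ev A A t t [::] isT; rewrite /ev big_nil.
  - by move=> z a b; exact: approx_lin.
  - by move=> a b; exact: approx_mul.
  - by move=> a; exact: approx_adj.
move=> a ha S [[Scl S0 Slin Smul Sadj] tS]; move/closed_nrmP : Scl; apply=> e e0.
have [s [ws h1 _]] := ha (e / 2) ltac:(by rewrite divr_gt0).
exists (ev t s); last by rewrite (le_lt_trans h1)// ltr_pdivrMr// ltr_pMr// ltr1n.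
rewrite /ev; elim: s {ws h1} => [|f s IHs]; first by rewrite big_nil.
rewrite big_cons; apply: Slin IHs; apply: Smul; first exact: tS.
by apply: Sadj; exact: tS.
Qed.

Section Isomorphism.
Variables (A B : cstarAlgType R) (t : L -> A) (t' : L -> B).
Variables (ct : CK_family t) (ct' : CK_family t').
Hypothesis iso : forall s, wf_sum s -> nrm (ev t s) = nrm (ev t' s).

(** By linearity the pair (0, b' - b) is a limit of pairs whose two norms agree. *)
Lemma approx_uniq a b b' : approx t t' a b -> approx t t' a b' -> b = b'.
Proof.
move=> h h'; apply/eqP; rewrite -subr_eq0; apply/eqP/nrm_eq0.
have := approx_lin (-1) h h'; rewrite !scaleN1r [- a + a]addrC subrr => h0.
apply/le_anti; rewrite nrm_ge0 andbT nrmB addrC.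
have h1 e : 0 < e -> nrm (- b + b') <= e.
  move=> e0; have [s [ws]] := h0 (e / 2) ltac:(by rewrite divr_gt0).
  rewrite sub0r nrmN iso// => h1 h2.
  have -> : - b + b' = (- b + b' - ev t' s) + ev t' s by rewrite subrK.
  by rewrite (le_trans (nrmD _ _))// (splitr e) lerD.
by apply/ler_addgt0Pr => e e0; rewrite add0r h1.
Qed.

(** Equality of norms carries a sequence of sums approximating a to a Cauchy sequence in B. *)
Lemma approx_exists a : approx t t a a -> exists b, approx t t' a b.
Proof.
move=> h; have p n : 0 < n.+1%:R^-1 :> R by rewrite invr_gt0.
pose s n := projT1 (cid (h _ (p n))).
have ws n : wf_sum (s n) by have [] := projT2 (cid (h _ (p n))).
have hs n : nrm (a - ev t (s n)) <= n.+1%:R^-1.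
  by have [] := projT2 (cid (h _ (p n))).
have [|b hb] := @nrm_cauchy_cvg _ _ (fun n => ev t' (s n)).
  move=> e e0; have [N hN] := invS_le (e := e / 4) ltac:(by rewrite divr_gt0).
  exists N => n Nn.
  have E (C : cstarAlgType R) (u : L -> C) m :
      ev u (s N) - ev u (s m) = ev u (scale_sum (-1) (s m) ++ s N).
    by rewrite ev_cat ev_scale scaleN1r addrC.
  rewrite E -iso; last by apply: wf_cat => //; exact: wf_scale.
  rewrite -E (le_lt_trans (nrm_tri _ a _))//.
  apply: (@le_lt_trans _ _ (e / 4 + e / 4)); last by lra.
  apply: lerD; last by rewrite (le_trans (hs n))// hN.
  by rewrite nrmB (le_trans (hs N))// hN.
exists b => e e0; have [N hN] := invS_le e0; have [M hM] := hb e e0.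
exists (s (N + M)%N); split => //.
  by rewrite (le_trans (hs _))// hN// leq_addr.
by rewrite ltW// hM// leq_addl.
Qed.

End Isomorphism.

(** [approx] is the graph of the isomorphism; its symmetry in the two families gives injectivity and
    surjectivity. *)
Lemma cstar_iso (A B : cstarAlgType R) (t : L -> A) (t' : L -> B) :
  CK_family t -> CK_family t' ->
  (forall s, wf_sum s -> nrm (ev t s) = nrm (ev t' s)) ->
  exists2 phi : A -> B,
    is_cstar_iso (cstar_generated (range t)) (cstar_generated (range t')) phi &
    forall l : L, phi (t l) = t' l.
Proof.
move=> ct ct' iso; have iso' s (ws : wf_sum s) := esym (iso s ws).
rewrite !cstar_generatedE//.
pose phi a := xget 0 [set b | approx t t' a b].
have phiP a : approx t t a a -> approx t t' a (phi a).
  by move=> /(approx_exists iso)[b]; exact: (@xgetI _ _ [set b | approx t t' a b]).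
have phiE a b : approx t t' a b -> phi a = b.
  by move=> h; exact: (approx_uniq iso (phiP _ (approx_left h)) h).
exists phi; last by move=> l; apply: phiE; exact: approx_gen.
split.
- split.
  + by move=> a /phiP /approx_sym /approx_left.
  + move=> a b /set_mem/phiP ha /set_mem/phiP hb E; move: ha; rewrite E => ha.
    exact: (approx_uniq iso' (approx_sym ha) (approx_sym hb)).
  + move=> b /(approx_exists iso')[a] /approx_sym h; exists a; last exact: phiE.
    exact: approx_left h.
- by move=> z a b /phiP ha /phiP hb; apply: phiE; exact: approx_lin.
- by move=> a b /phiP ha /phiP hb; apply: phiE; exact: approx_mul.
- by move=> a /phiP ha; apply: phiE; exact: approx_adj.
Qed.

End Approximation.

(** * The Hilbert space of square-summable functions *)

Section UnorderedSums.
Variables (R : realType) (I : choiceType).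
Implicit Types (h g : I -> R) (F : {fset I}).

Definition psum h F : R := \sum_(i <- finmap.enum_fset F) h i.

Lemma psumD h g F : psum (fun i => h i + g i) F = psum h F + psum g F.
Proof. exact: big_split. Qed.

Lemma psumZ c h F : psum (fun i => c * h i) F = c * psum h F.
Proof. by rewrite /psum mulr_sumr. Qed.

Lemma ler_psum h g F : (forall i, h i <= g i) -> psum h F <= psum g F.
Proof. by move=> hg; exact: ler_sum. Qed.

Lemma psum_subset h F F' : (forall i, 0 <= h i) -> fsubset F F' ->
  psum h F <= psum h F'.
Proof.
move=> h0 /fsubsetP FF'; rewrite /psum [leRHS](bigID (fun i => i \in F))/=.
rewrite -[X in _ <= X + _]big_filter.
have E : perm_eq [seq i <- finmap.enum_fset F' | i \in F] (finmap.enum_fset F).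
  apply: uniq_perm; rewrite ?filter_uniq ?fset_uniq// => i.
  by rewrite mem_filter; apply: andb_idr; exact: FF'.
by rewrite (perm_big _ E) lerDl sumr_ge0.
Qed.

(** Convergence along the finite subsets, so that sums can be reindexed by partial bijections
    without an enumeration of I. *)
Definition hassum h (s : R) := forall e, 0 < e -> exists F0 : {fset I},
  forall F, fsubset F0 F -> `|s - psum h F| <= e.

Lemma hassum_uniq h s s' : hassum h s -> hassum h s' -> s = s'.
Proof.
move=> hs hs'; apply/eqP; rewrite -subr_eq0 -normr_le0; apply/ler_addgt0Pr => e e0.
have [F hF] := hs (e / 2) ltac:(by rewrite divr_gt0).
have [F' hF'] := hs' (e / 2) ltac:(by rewrite divr_gt0).
have := hF (fsetU F F') (fsubsetUl _ _); have := hF' (fsetU F F') (fsubsetUr _ _).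
rewrite add0r; move: (psum h _) => x h1 h2.
by rewrite (le_trans (ler_distD x _ _))// (splitr e) lerD// distrC.
Qed.

Lemma hassumD h g s r : hassum h s -> hassum g r ->
  hassum (fun i => h i + g i) (s + r).
Proof.
move=> hs gr e e0; have [F hF] := hs (e / 2) ltac:(by rewrite divr_gt0).
have [F' hF'] := gr (e / 2) ltac:(by rewrite divr_gt0).
exists (fsetU F F') => X FX; rewrite psumD opprD addrACA (le_trans (ler_normD _ _))//.
rewrite (splitr e) lerD// ?hF ?hF'//.
  exact: fsubset_trans (fsubsetUl _ _) FX.
exact: fsubset_trans (fsubsetUr _ _) FX.
Qed.

Lemma hassumZ c h s : hassum h s -> hassum (fun i => c * h i) (c * s).
Proof.
move=> hs e e0; have c1 : 0 < `|c| + 1 by rewrite ltr_wpDl.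
have [F hF] := hs (e / (`|c| + 1)) ltac:(by rewrite divr_gt0).
exists F => X FX; rewrite psumZ -mulrBr normrM.
apply: (@le_trans _ _ ((`|c| + 1) * (e / (`|c| + 1)))).
  by rewrite ler_pM// ?lerDl// hF.
by rewrite mulrC divfK// gt_eqF.
Qed.

Lemma hassum_le h s F : (forall i, 0 <= h i) -> hassum h s -> psum h F <= s.
Proof.
move=> h0 hs; apply/ler_addgt0Pr => e e0; have [F0 hF] := hs e e0.
have := hF (fsetU F0 F) (fsubsetUl _ _); rewrite ler_distl => /andP[h1 _].
have := psum_subset h0 (fsubsetUr F0 F); lra.
Qed.

Lemma hassum_ub h s c : hassum h s -> (forall F, psum h F <= c) -> s <= c.
Proof.
move=> hs hc; apply/ler_addgt0Pr => e e0; have [F0 hF] := hs e e0.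
have := hF F0 (fsubset_refl _); rewrite ler_distl => /andP[_ h1].
have := hc F0; lra.
Qed.

Lemma hassum_exists h c : (forall i, 0 <= h i) -> (forall F, psum h F <= c) ->
  exists s, hassum h s.
Proof.
move=> h0 hc; pose S := range (psum h).
have supS : has_sup S.
  by split; [exists (psum h fset0), fset0|exists c => _ [F _ <-]].
exists (sup S) => e e0; have [_ [F0 _ <-] lt] := sup_adherent e0 supS.
exists F0 => F F0F; have h1 := psum_subset h0 F0F.
have h2 : psum h F <= sup S by apply: ub_le_sup; [case: supS|exists F].
by rewrite ler_distl; apply/andP; split; lra.
Qed.

(** h is the difference of the non-negative families h + g and g, whose partial sums are bounded. *)
Lemma hassum_dominated h g c : (forall i, `|h i| <= g i) ->
  (forall F, psum g F <= c) -> exists s, hassum h s.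
Proof.
move=> hg gc; have g0 i : 0 <= g i by exact: le_trans (hg i).
have [s hs] := hassum_exists g0 gc.
have hg0 i : 0 <= h i + g i by have := hg i; rewrite ler_norml => /andP[]; lra.
have [F|r hr] := @hassum_exists (fun i => h i + g i) (c + c) hg0.
  rewrite psumD lerD// (le_trans _ (gc F))// ler_psum// => i.
  exact: le_trans (ler_norm _) (hg i).
exists (r + (-1) * s).
suff -> : h = (fun i => (h i + g i) + (-1) * g i) by exact: hassumD hr (hassumZ _ hs).
by apply/funext => i; rewrite mulN1r addrK.
Qed.

End UnorderedSums.

Section Ell2.
Variables (R : realType) (I : choiceType).
Local Notation C := R[i].
Implicit Types (f g h : I -> C) (z w : C).

(** The real part of z times the conjugate of w. Norms and adjoints of complex-linear operators are
    determined by the real part of the inner product, so only real families are summed. *)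
Definition dot z w : R :=
  complex.Re z * complex.Re w + complex.Im z * complex.Im w.

Lemma dotC z w : dot z w = dot w z.
Proof. by rewrite /dot; ring. Qed.
Lemma dotDl z z' w : dot (z + z') w = dot z w + dot z' w.
Proof. by case: z z' w => [a b] [c d] [x y]; rewrite /dot/=; ring. Qed.
Lemma dot_mull z w w' : dot (z * w) w' = dot w (Num.conj z * w').
Proof. by case: z w w' => [a b] [c d] [x y]; rewrite /dot/=; ring. Qed.
Lemma dot_mul z w : dot (z * w) (z * w) = dot z z * dot w w.
Proof. by case: z w => [a b] [c d]; rewrite /dot/=; ring. Qed.
Lemma dot_ge0 z : 0 <= dot z z.
Proof. by rewrite /dot addr_ge0// -expr2 sqr_ge0. Qed.
Lemma dot_eq0 z : dot z z = 0 -> z = 0.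
Proof.
case: z => a b; rewrite /dot/= => /eqP; rewrite paddr_eq0 -?expr2 ?sqr_ge0//.
by rewrite !sqrf_eq0 => /andP[/eqP -> /eqP ->].
Qed.
Lemma dot_nrm z : nrm z ^+ 2 = dot z z.
Proof.
case: z => a b; rewrite /nrm /dot/= sqr_sqrtr ?addr_ge0 ?sqr_ge0//.
Qed.
Lemma dot_le z w : `|dot z w| <= dot z z + dot w w.
Proof.
case: z w => [a b] [c d]; rewrite /dot/= ler_norml.
have := sqr_ge0 (a - c); have := sqr_ge0 (a + c).
have := sqr_ge0 (b - d); have := sqr_ge0 (b + d).
have := sqr_ge0 a; have := sqr_ge0 b; have := sqr_ge0 c; have := sqr_ge0 d.
by rewrite !expr2 => *; apply/andP; split; nra.
Qed.
Lemma dot_add_le z w : dot (z + w) (z + w) <= 2 * dot z z + 2 * dot w w.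
Proof.
case: z w => [a b] [c d]; rewrite /dot/=.
by have := sqr_ge0 (a - c); have := sqr_ge0 (b - d); rewrite !expr2 => *; nra.
Qed.

Definition sq_summable f := exists c, forall F, psum (fun i => dot (f i) (f i)) F <= c.

Definition ell2_pred : {pred I -> C} := fun f => `[< sq_summable f >].

Lemma ell2_submod : submod_closed ell2_pred.
Proof.
split.
  apply/asboolP; exists 0 => F.
  by rewrite /psum big1// => i _; rewrite /dot/= !mulr0 addr0.
move=> z f g /asboolP[c hc] /asboolP[d hd]; apply/asboolP.
exists (2 * (dot z z * c) + 2 * d) => F.
apply: (@le_trans _ _ (psum (fun i => 2 * (dot z z * dot (f i) (f i)) + 2 * dot (g i) (g i)) F)).
  by apply: ler_psum => i; rewrite -dot_mul; exact: dot_add_le.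
rewrite psumD !psumZ; apply: lerD; apply: ler_wpM2l => //.
by apply: ler_wpM2l => //; exact: dot_ge0.
Qed.

HB.instance Definition _ := GRing.isSubmodClosed.Build C (I -> C) ell2_pred ell2_submod.

Definition ell2 := {f : I -> C | ell2_pred f}.
HB.instance Definition _ := SubChoice.on ell2.
HB.instance Definition _ := [SubChoice_isSubLmodule of ell2 by <:].

End Ell2.

Section InnerProduct.
Variables (R : realType) (I : choiceType).
Local Notation C := R[i].
Local Notation H := (ell2 R I).
Implicit Types (f g h : H) (z w : C) (F : {fset I}).

Definition ip f g : R := xget 0 [set s | hassum (fun i => dot (val f i) (val g i)) s].

Lemma ell2_bound f : exists c, forall F, psum (fun i => dot (val f i) (val f i)) F <= c.
Proof. by have /asboolP := valP f. Qed.

Lemma ipP f g : hassum (fun i => dot (val f i) (val g i)) (ip f g).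
Proof.
have [c hc] := ell2_bound f; have [d hd] := ell2_bound g.
apply: (@xgetPex _ 0 [set s | hassum (fun i => dot (val f i) (val g i)) s]).
apply: (@hassum_dominated _ _ _ (fun i => dot (val f i) (val f i) + dot (val g i) (val g i)) (c + d)).
  by move=> i; exact: dot_le.
by move=> F; rewrite psumD lerD.
Qed.

Lemma ipE f g s : hassum (fun i => dot (val f i) (val g i)) s -> ip f g = s.
Proof. exact/hassum_uniq/ipP. Qed.

Lemma ipC f g : ip f g = ip g f.
Proof.
apply: ipE; rewrite (_ : (fun i => _) = fun i => dot (val g i) (val f i)); first exact: ipP.
by apply/funext => i; rewrite dotC.
Qed.

Lemma ipDl f g h : ip (f + g) h = ip f h + ip g h.
Proof.
apply: ipE; rewrite (_ : (fun i => _) =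
  fun i => dot (val f i) (val h i) + dot (val g i) (val h i)).
  exact: hassumD (ipP _ _) (ipP _ _).
by apply/funext => i; rewrite -dotDl raddfD.
Qed.

Lemma ipDr f g h : ip f (g + h) = ip f g + ip f h.
Proof. by rewrite ipC ipDl !(ipC f). Qed.

Lemma ip_scale z f g : ip (z *: f) g = ip f (Num.conj z *: g).
Proof.
apply: ipE; rewrite (_ : (fun i => _) =
  fun i => dot (val f i) (val (Num.conj z *: g) i)); first exact: ipP.
by apply/funext => i; rewrite !linearZ/= -dot_mull.
Qed.

Lemma ip_real (c : R) f g : ip (c%:C%C *: f) g = c * ip f g.
Proof.
apply: ipE; rewrite (_ : (fun i => _) = fun i => c * dot (val f i) (val g i)).
  exact: hassumZ (ipP _ _).
apply/funext => i; rewrite linearZ/= [(_ *: _) i]/(_ * _).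
by case: (val f i) (val g i) => [a b] [d e]; rewrite /dot/=; ring.
Qed.

Lemma ip_realr (c : R) f g : ip f (c%:C%C *: g) = c * ip f g.
Proof. by rewrite ipC ip_real ipC. Qed.

Lemma ipNl f g : ip (- f) g = - ip f g.
Proof.
by rewrite -[RHS]mulN1r -ip_real rmorphN1 scaleN1r.
Qed.

Lemma ipNr f g : ip f (- g) = - ip f g.
Proof. by rewrite ipC ipNl ipC. Qed.

Lemma ip0l g : ip 0 g = 0.
Proof. by have := ipDl 0 0 g; rewrite addr0 => h; lra. Qed.

Lemma psum_le_ip f F : psum (fun i => dot (val f i) (val f i)) F <= ip f f.
Proof. by apply: hassum_le (ipP _ _) => i; exact: dot_ge0. Qed.

Lemma dot_le_ip f i : dot (val f i) (val f i) <= ip f f.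
Proof.
by have := psum_le_ip f [fset i]%fset; rewrite /psum big_seq_fset1.
Qed.

Lemma ip_ge0 f : 0 <= ip f f.
Proof. by have := psum_le_ip f fset0; rewrite /psum big_seq_fset0. Qed.

Lemma ip_eq0 f : ip f f = 0 -> f = 0.
Proof.
move=> h; apply: val_inj; apply/funext => i; apply: dot_eq0.
by apply/le_anti; rewrite dot_ge0 -h dot_le_ip.
Qed.

Lemma ip_inj f f' : (forall g, ip f g = ip f' g) -> f = f'.
Proof.
move=> h; apply/eqP; rewrite -subr_eq0; apply/eqP/ip_eq0.
by rewrite ipDl ipNl h subrr.
Qed.

Lemma ip_cauchy_schwarz f g : ip f g ^+ 2 <= ip f f * ip g g.
Proof.
have := ip_ge0 g; rewrite le_eqVlt => /orP[/eqP/esym g0|g0].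
  by rewrite (ip_eq0 g0) ipC ip0l expr0n ip0l mulr0.
pose c := - ip f g / ip g g.
have := ip_ge0 (f + c%:C%C *: g).
rewrite ipDl !ipDr ip_real !ip_realr ip_real (ipC g f).
have -> : ip f f + c * ip f g + (c * ip f g + c * (c * ip g g)) =
  ip f f - ip f g ^+ 2 / ip g g by rewrite /c; field; rewrite gt_eqF.
by rewrite subr_ge0 ler_pdivrMr.
Qed.

Definition hnorm f : R := Num.sqrt (ip f f).

Lemma hnorm_ge0 f : 0 <= hnorm f. Proof. exact: sqrtr_ge0. Qed.

Lemma hnorm_sq f : hnorm f ^+ 2 = ip f f.
Proof. by rewrite sqr_sqrtr// ip_ge0. Qed.

Lemma hnorm0 : hnorm 0 = 0.
Proof. by rewrite /hnorm ip0l sqrtr0. Qed.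

Lemma hnorm_eq0 f : hnorm f = 0 -> f = 0.
Proof. by move=> h; apply: ip_eq0; rewrite -hnorm_sq h expr0n. Qed.

Lemma ip_le f g : ip f g <= hnorm f * hnorm g.
Proof.
have h0 : 0 <= hnorm f * hnorm g by rewrite mulr_ge0// hnorm_ge0.
have [/ltW lt|lt] := ltP (ip f g) 0; first exact: le_trans h0.
rewrite -ler_sqr ?nnegrE// exprMn !hnorm_sq; exact: ip_cauchy_schwarz.
Qed.

Lemma hnormD f g : hnorm (f + g) <= hnorm f + hnorm g.
Proof.
rewrite -ler_sqr ?nnegrE ?addr_ge0 ?hnorm_ge0// sqrrD !hnorm_sq ipDl !ipDr (ipC g f).
by have := ip_le f g; lra.
Qed.

Lemma hnormZ z f : hnorm (z *: f) = nrm z * hnorm f.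
Proof.
apply/eqP; rewrite -(@eqrXn2 _ 2) ?mulr_ge0 ?hnorm_ge0 ?nrm_ge0//.
rewrite exprMn !hnorm_sq dot_nrm; apply/eqP/ipE.
rewrite (_ : (fun i => _) = fun i => dot z z * dot (val f i) (val f i)).
  exact: hassumZ (ipP _ _).
by apply/funext => i; rewrite linearZ/= -dot_mul.
Qed.

Lemma hnormN f : hnorm (- f) = hnorm f.
Proof. by rewrite /hnorm ipNl ipNr opprK. Qed.

Lemma real_cauchy_cvg (u : nat -> R) : (forall e : R, 0 < e ->
    exists N, forall n, (N <= n)%N -> `|u N - u n| < e) ->
  exists a, forall e : R, 0 < e -> exists N, forall n, (N <= n)%N -> `|a - u n| < e.
Proof.
move=> h; have : cvg ((u : nat -> R^o) @ \oo).
  apply: cauchy_cvg; apply: cauchy_exP => e e0.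
  have [N hN] := h e e0; exists (u N); exists N => // n /hN.
move=> /cvgrPdist_lt cu; exists (lim ((u : nat -> R^o) @ \oo)) => e e0.
by have [N _ hN] := cu e e0; exists N => n /hN.
Qed.

(** The limit is taken coordinatewise. The bound on its distance to u_n is proved over one finite F
    at a time, through a u_m close to the limit on F, and does not depend on F. *)
Lemma ell2_complete (u : nat -> H) : (forall e : R, 0 < e ->
    exists N, forall n m, (N <= n)%N -> (N <= m)%N -> hnorm (u n - u m) <= e) ->
  exists f, forall e : R, 0 < e -> exists N, forall n, (N <= n)%N -> hnorm (f - u n) <= e.
Proof.
move=> hu.
have coord (P : C -> R) i : (forall z w, P (z - w) = P z - P w) ->
    (forall z, `|P z| ^+ 2 <= dot z z) -> exists a, forall e, 0 < e ->
    exists N, forall n, (N <= n)%N -> `|a - P (val (u n) i)| < e.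
  move=> PB Pd; apply: real_cauchy_cvg => e e0.
  have [N hN] := hu (e / 2) ltac:(by rewrite divr_gt0).
  exists N => n Nn; apply: (@le_lt_trans _ _ (e / 2)); last by lra.
  apply: le_trans (hN N n (leqnn N) Nn).
  rewrite -ler_sqr ?nnegrE ?hnorm_ge0// hnorm_sq -PB.
  by rewrite (le_trans (Pd _))// (le_trans _ (dot_le_ip _ i))// raddfB.
have ReB (z w : C) : complex.Re (z - w) = complex.Re z - complex.Re w by exact: raddfB.
have ImB (z w : C) : complex.Im (z - w) = complex.Im z - complex.Im w by exact: raddfB.
have Red (z : C) : `|complex.Re z| ^+ 2 <= dot z z.
  by rewrite real_normK ?num_real// /dot -!expr2 lerDl sqr_ge0.
have Imd (z : C) : `|complex.Im z| ^+ 2 <= dot z z.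
  by rewrite real_normK ?num_real// /dot -!expr2 lerDr sqr_ge0.
pose fv (i : I) : C := (projT1 (cid (coord _ i ReB Red)) +i* projT1 (cid (coord _ i ImB Imd)))%C.
have fvP i e : 0 < e -> exists N, forall n, (N <= n)%N ->
    dot (fv i - val (u n) i) (fv i - val (u n) i) <= e.
  move=> e0; pose d := Num.min 1 (e / 2).
  have d0 : 0 < d by rewrite lt_min ltr01 divr_gt0.
  have [N hN] := projT2 (cid (coord _ i ReB Red)) d d0.
  have [M hM] := projT2 (cid (coord _ i ImB Imd)) d d0.
  exists (maxn N M) => n; rewrite geq_max => /andP[/hN h1 /hM h2].
  have sq (x : R) : `|x| < d -> x ^+ 2 <= e / 2.
    move=> xd; rewrite -real_normK ?num_real// expr2.
    apply: (@le_trans _ _ (1 * d)).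
      by rewrite ler_pM// ltW// (lt_le_trans xd)// ge_min lexx.
    by rewrite mul1r ge_min lexx orbT.
  rewrite /dot ReB ImB -!expr2 (splitr e) lerD// sq//.
have tail e : 0 < e -> exists N, forall n, (N <= n)%N -> forall F : {fset I},
    psum (fun i => dot (fv i - val (u n) i) (fv i - val (u n) i)) F <= e ^+ 2.
  move=> e0; have [N hN] := hu (e / 2) ltac:(by rewrite divr_gt0).
  exists N => n Nn F.
  (* The budget is 2 (e^2 / 4) + 2 (e / 2)^2 = e^2, the first part being spread evenly over F; the
     successor keeps the divisor positive for empty F. *)
  have e1 : 0 < e ^+ 2 / 4 / (size (finmap.enum_fset F)).+1%:R.
    by rewrite !divr_gt0 ?exprn_gt0.
  have [m Nm hm] : exists2 m, (N <= m)%N & forall i, i \in finmap.enum_fset F ->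
      dot (fv i - val (u m) i) (fv i - val (u m) i) <=
      e ^+ 2 / 4 / (size (finmap.enum_fset F)).+1%:R.
    have [M hM] : exists M, forall m i, (M <= m)%N -> i \in finmap.enum_fset F ->
      dot (fv i - val (u m) i) (fv i - val (u m) i) <=
      e ^+ 2 / 4 / (size (finmap.enum_fset F)).+1%:R.
      move: (_ / _) e1 => d d0.
      elim: (finmap.enum_fset F) => [|i s [M hM]]; first by exists 0%N.
      have [M' hM'] := fvP i d d0; exists (maxn M M') => m j; rewrite geq_max => /andP[h1 h2].
      by rewrite inE => /orP[/eqP ->|js]; [exact: hM'|exact: hM].
    by exists (maxn N M); rewrite ?leq_maxl// => i iF; apply: hM; rewrite ?leq_maxr.
  apply: (@le_trans _ _ (psum (fun i => 2 * dot (fv i - val (u m) i) (fv i - val (u m) i) +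
      2 * dot (val (u m - u n) i) (val (u m - u n) i)) F)).
    apply: ler_psum => i; rewrite (_ : fv i - _ = (fv i - val (u m) i) + val (u m - u n) i).
      exact: dot_add_le.
    by rewrite raddfB/= addrA subrK.
  rewrite psumD !psumZ.
  have h1 : psum (fun i => dot (val (u m - u n) i) (val (u m - u n) i)) F <= (e / 2) ^+ 2.
    apply: le_trans (psum_le_ip _ _) _; rewrite -hnorm_sq lerXn2r// ?nnegrE ?hnorm_ge0 ?hN//.
    by rewrite divr_ge0// ltW.
  have h2 : psum (fun i => dot (fv i - val (u m) i) (fv i - val (u m) i)) F <= e ^+ 2 / 4.
    apply: (@le_trans _ _ (\sum_(i <- finmap.enum_fset F)
        e ^+ 2 / 4 / (size (finmap.enum_fset F)).+1%:R)).
      by rewrite /psum big_seq [leRHS]big_seq; exact: ler_sum.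
    rewrite big_const_seq count_predT iter_addr_0 -mulrnAl -mulr_natr.
    rewrite ler_pdivrMr ?ltr0n// ler_wpM2l ?ler_nat//.
    by rewrite divr_ge0// exprn_ge0// ltW.
  have : (e / 2) ^+ 2 = e ^+ 2 / 4 by field.
  by move: h1 h2; lra.
have fv2 : ell2_pred fv.
  have [N hN] := tail 1 ltr01; have [c hc] := ell2_bound (u N).
  apply/asboolP; exists (2 * 1 + 2 * c) => F.
  apply: (@le_trans _ _ (psum (fun i => 2 * dot (fv i - val (u N) i) (fv i - val (u N) i) +
      2 * dot (val (u N) i) (val (u N) i)) F)).
    by apply: ler_psum => i; rewrite -{1 2}(subrK (val (u N) i) (fv i)) dot_add_le.
  rewrite psumD !psumZ; have := hN N (leqnn N) F; have := hc F.
  by rewrite expr1n; lra.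
exists (exist _ fv fv2 : H) => e e0; have [N hN] := tail e e0.
exists N => n Nn; have e0' := ltW e0.
rewrite -ler_sqr ?nnegrE ?hnorm_ge0// hnorm_sq.
apply: (hassum_ub (ipP _ _)) => F; rewrite raddfB/=; exact: hN.
Qed.

End InnerProduct.

(** * The C*-algebra of bounded operators *)

Section BoundedOperators.
Variables (R : realType) (I : choiceType).
Local Notation C := R[i].
Local Notation H := (ell2 R I).
Implicit Types (f g h : H) (z : C) (T S : H -> H).

(** The existence of an adjoint is built in, in place of the Riesz theorem; that S is itself linear
    and bounded is derived in [bop_adj_ex]. *)
Definition is_bop T := [/\ forall z f g, T (z *: f + g) = z *: T f + T g,
  exists2 c : R, 0 <= c & forall f, hnorm (T f) <= c * hnorm f
  & exists S, forall f g, ip (T f) g = ip f (S g)].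

Definition bop_pred : {pred H -> H} := fun T => `[< is_bop T >].

Lemma bop_submod : submod_closed bop_pred.
Proof.
split.
  apply/asboolP; split.
  - by move=> z f g /=; rewrite scaler0 addr0.
  - by exists 0 => // f; rewrite hnorm0 mul0r.
  - by exists (fun=> 0) => f g; rewrite ip0l ipC ip0l.
move=> z T S /asboolP[T1 [c c0 T2] [T' T3]] /asboolP[S1 [d d0 S2] [S' S3]].
apply/asboolP; split.
- move=> w f g; have E h : (z *: T + S) h = z *: T h + S h by [].
  by rewrite !E T1 S1 !scalerDr addrACA !scalerA mulrC.
- exists (nrm z * c + d); first by rewrite addr_ge0// mulr_ge0// nrm_ge0.
  move=> f; rewrite mulrDl -mulrA (le_trans (hnormD _ _))// lerD// hnormZ.
  by rewrite ler_wpM2l ?nrm_ge0.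
- exists (fun g => T' (Num.conj z *: g) + S' g) => f g.
  by rewrite ipDl [X in ip X _]/(z *: T f) ip_scale T3 S3 ipDr.
Qed.

HB.instance Definition _ :=
  GRing.isSubmodClosed.Build C (H -> H) bop_pred bop_submod.

Definition bop := {T : H -> H | bop_pred T}.
HB.instance Definition _ := SubChoice.on bop.
HB.instance Definition _ := [SubChoice_isSubLmodule of bop by <:].

Implicit Types (a b : bop).

Lemma bopP a : is_bop (val a). Proof. exact/asboolP/(valP a). Qed.

Lemma bop_lin a z f g : val a (z *: f + g) = z *: val a f + val a g.
Proof. by have [h _ _] := bopP a. Qed.

Lemma bop0 a : val a 0 = 0.
Proof.
have := bop_lin a 1 0 0; rewrite scaler0 addr0 scale1r => h.
by apply: (addrI (val a 0)); rewrite -h addr0.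
Qed.

Lemma bop_scaler a z f : val a (z *: f) = z *: val a f.
Proof. by have := bop_lin a z f 0; rewrite !addr0 bop0 addr0. Qed.

Lemma bop_addr a f g : val a (f + g) = val a f + val a g.
Proof. by have := bop_lin a 1 f g; rewrite !scale1r. Qed.

Lemma bop_add a b f : val (a + b) f = val a f + val b f.
Proof. by rewrite raddfD. Qed.

Lemma bop_scale z a f : val (z *: a) f = z *: val a f.
Proof. by rewrite linearZ. Qed.

Lemma bop_ext a b : (forall f, val a f = val b f) -> a = b.
Proof. by move=> h; apply: val_inj; apply/funext. Qed.

Definition bnorm a : R :=
  inf [set c | 0 <= c /\ forall f, hnorm (val a f) <= c * hnorm f].

Lemma bnorm_has_inf a :
  has_inf [set c : R | 0 <= c /\ forall f, hnorm (val a f) <= c * hnorm f].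
Proof.
split; first by have [_ [c c0 h] _] := bopP a; exists c.
by exists 0 => c [].
Qed.

Lemma bnorm_ge0 a : 0 <= bnorm a.
Proof. by apply: lb_le_inf; [case: (bnorm_has_inf a)|move=> c []]. Qed.

Lemma bnorm_le a (c : R) : 0 <= c -> (forall f, hnorm (val a f) <= c * hnorm f) ->
  bnorm a <= c.
Proof. by move=> c0 h; apply: ge_inf => //; case: (bnorm_has_inf a). Qed.

Lemma hnorm_bop a f : hnorm (val a f) <= bnorm a * hnorm f.
Proof.
have := hnorm_ge0 f; rewrite le_eqVlt => /orP[/eqP f0|f0].
  by have [_ [c c0 h] _] := bopP a; have := h f; rewrite -f0 !mulr0.
rewrite -ler_pdivrMr//; apply: lb_le_inf; first by case: (bnorm_has_inf a).
by move=> c [c0 h]; rewrite ler_pdivrMr.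
Qed.

Lemma bnormD a b : bnorm (a + b) <= bnorm a + bnorm b.
Proof.
apply: bnorm_le => [|f]; first by rewrite addr_ge0// bnorm_ge0.
by rewrite bop_add mulrDl (le_trans (hnormD _ _))// lerD// hnorm_bop.
Qed.

Lemma bnormZ_le z a : bnorm (z *: a) <= nrm z * bnorm a.
Proof.
apply: bnorm_le => [|f]; first by rewrite mulr_ge0 ?bnorm_ge0 ?nrm_ge0.
by rewrite bop_scale hnormZ -mulrA ler_wpM2l ?nrm_ge0 ?hnorm_bop.
Qed.

Lemma nrm_mulC z w : nrm (z * w : C) = nrm z * nrm w.
Proof.
by have [] : (nrm (z * w))%:C%C = (nrm z * nrm w)%:C%C;
  rewrite ?rmorphM/= -?nrmE ?normrM.
Qed.

Lemma bnormZ z a : bnorm (z *: a) = nrm z * bnorm a.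
Proof.
apply/le_anti; rewrite bnormZ_le/=.
have [->|z0] := eqVneq z 0; first by rewrite nrm0 mul0r bnorm_ge0.
have zp : 0 < nrm z.
  by rewrite lt_neqAle nrm_ge0 andbT eq_sym; apply: contra z0 => /eqP/nrm_eq0/eqP.
have := bnormZ_le z^-1 (z *: a); rewrite scalerA mulVf// scale1r.
have -> : nrm z^-1 = (nrm z)^-1.
  apply: (mulfI (lt0r_neq0 zp)); rewrite -nrm_mulC (divff z0) (divff (lt0r_neq0 zp)).
  by rewrite /nrm normr1.
by rewrite ler_pdivlMl.
Qed.

Lemma bnorm_eq0 a : bnorm a = 0 -> a = 0.
Proof.
move=> h; apply: bop_ext => f; rewrite [RHS]/(0 : H); apply: hnorm_eq0.
by apply/le_anti; rewrite hnorm_ge0 andbT (le_trans (hnorm_bop _ _))// h mul0r.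
Qed.

(** Inner products determine S g, whence linearity; the squared norm of S g is the inner product of
    a (S g) with g, whence the bound. *)
Lemma bop_adj_ex a : exists b, forall f g, ip (val a f) g = ip f (val b g).
Proof.
have [_ _ [S hS]] := bopP a.
suff SP : bop_pred S by exists (exist _ S SP).
apply/asboolP; split.
- move=> z f g; apply: ip_inj => h; rewrite ipC -hS ipDr ipDl.
  congr (_ + _); last by rewrite [RHS]ipC -hS.
  by rewrite ip_scale [LHS]ipC ip_scale [LHS]ipC -bop_scaler hS ipC.
- exists (bnorm a); first exact: bnorm_ge0.
  move=> g; have := hnorm_ge0 (S g); rewrite le_eqVlt => /orP[/eqP <-|h].
    by rewrite mulr_ge0 ?bnorm_ge0 ?hnorm_ge0.
  rewrite -(ler_pM2r h) -expr2 hnorm_sq -hS (le_trans (ip_le _ _))//.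
  by rewrite mulrAC ler_wpM2r ?hnorm_ge0// hnorm_bop.
- by exists (val a) => f g; rewrite ipC -hS ipC.
Qed.

Definition bop_adj a : bop := projT1 (cid (bop_adj_ex a)).

Lemma bop_adjP a f g : ip (val a f) g = ip f (val (bop_adj a) g).
Proof. exact: (projT2 (cid (bop_adj_ex a))). Qed.

Lemma bop_adjP' a f g : ip (val (bop_adj a) f) g = ip f (val a g).
Proof. by rewrite ipC -bop_adjP ipC. Qed.

Lemma bop_adj_uniq a b : (forall f g, ip (val a f) g = ip f (val b g)) -> bop_adj a = b.
Proof.
by move=> h; apply: bop_ext => g; apply: ip_inj => f; rewrite bop_adjP' ipC h ipC.
Qed.

Lemma bop_mul_subproof a b : bop_pred (val a \o val b).
Proof.
apply/asboolP; split.
- by move=> z f g; rewrite /comp !bop_lin.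
- exists (bnorm a * bnorm b) => [|f]; first by rewrite mulr_ge0 ?bnorm_ge0.
  rewrite /comp -mulrA (le_trans (hnorm_bop _ _))// ler_wpM2l ?bnorm_ge0//.
  exact: hnorm_bop.
- exists (val (bop_adj b) \o val (bop_adj a)) => f g.
  by rewrite /comp !bop_adjP.
Qed.

Definition bop_mul a b : bop :=
  exist (fun T => bop_pred T) (val a \o val b) (bop_mul_subproof a b).

Lemma bop_mulE a b f : val (bop_mul a b) f = val a (val b f). Proof. by []. Qed.

Lemma bnormM a b : bnorm (bop_mul a b) <= bnorm a * bnorm b.
Proof.
apply: bnorm_le => [|f]; first by rewrite mulr_ge0 ?bnorm_ge0.
rewrite bop_mulE -mulrA (le_trans (hnorm_bop _ _))// ler_wpM2l ?bnorm_ge0//.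
exact: hnorm_bop.
Qed.

Lemma bop_adjK : involutive bop_adj.
Proof. by move=> a; apply: bop_adj_uniq => f g; exact: bop_adjP'. Qed.

(** Cauchy-Schwarz on the inner product of f with b^* b f bounds the square of the norm of b by the
    norm of b^* b. Submultiplicativity then bounds the norm of b by that of b^*, and b := a^* gives
    the remaining inequality. *)
Lemma bnorm_cstar a : bnorm (bop_mul (bop_adj a) a) = bnorm a ^+ 2.
Proof.
have sq b : bnorm b ^+ 2 <= bnorm (bop_mul (bop_adj b) b).
  rewrite -[leRHS]sqr_sqrtr ?bnorm_ge0// ler_sqr ?nnegrE ?sqrtr_ge0 ?bnorm_ge0//.
  apply: bnorm_le => [|f]; first exact: sqrtr_ge0.
  rewrite -ler_sqr ?nnegrE ?mulr_ge0 ?sqrtr_ge0 ?hnorm_ge0//.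
  rewrite exprMn hnorm_sq [X in _ <= X * _]sqr_sqrtr ?bnorm_ge0// bop_adjP expr2 mulrA.
  rewrite (le_trans (ip_le _ _))// mulrC ler_wpM2r ?hnorm_ge0//.
  exact: (hnorm_bop (bop_mul (bop_adj b) b) f).
have le b : bnorm b <= bnorm (bop_adj b).
  have := bnorm_ge0 b; rewrite le_eqVlt => /orP[/eqP <-|b0]; first exact: bnorm_ge0.
  by rewrite -(ler_pM2r b0) -expr2 (le_trans (sq b))// bnormM.
apply/le_anti; rewrite sq andbT (le_trans (bnormM _ _))// expr2 ler_wpM2r ?bnorm_ge0//.
by rewrite -[in leRHS](bop_adjK a).
Qed.

(** The adjoints form a Cauchy sequence too, so both sequences converge pointwise; the limit of the
    adjoints is the adjoint demanded by [is_bop]. *)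
Lemma bop_complete (u : nat -> bop) : (forall e : R, 0 < e ->
    exists N, forall n m, (N <= n)%N -> (N <= m)%N -> bnorm (u n - u m) <= e) ->
  exists a, forall e : R, 0 < e -> exists N, forall n, (N <= n)%N -> bnorm (a - u n) <= e.
Proof.
have bop_sub a b f : val (a - b) f = val a f - val b f.
  by rewrite bop_add -scaleN1r bop_scale scaleN1r.
have adjB a b : bop_adj (a - b) = bop_adj a - bop_adj b.
  apply: bop_adj_uniq => f g; rewrite !bop_sub ipDl ipNl !bop_adjP.
  by rewrite ipDr ipNr.
have adjN a : bnorm (bop_adj a) = bnorm a.
  have le b : bnorm b <= bnorm (bop_adj b).
    have := bnorm_ge0 b; rewrite le_eqVlt => /orP[/eqP <-|b0]; first exact: bnorm_ge0.
    by rewrite -(ler_pM2r b0) -expr2 -bnorm_cstar bnormM.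
  by apply/le_anti; rewrite le andbT -[in leRHS](bop_adjK a).
have lim_ex (w : nat -> bop) : (forall e : R, 0 < e ->
    exists N, forall n m, (N <= n)%N -> (N <= m)%N -> bnorm (w n - w m) <= e) ->
    forall f, exists g, forall e : R, 0 < e -> exists N, forall n, (N <= n)%N ->
    hnorm (g - val (w n) f) <= e.
  move=> hw f; apply: ell2_complete => e e0.
  have f1 : 0 < hnorm f + 1 by rewrite ltr_wpDl ?hnorm_ge0.
  have [N hN] := hw (e / (hnorm f + 1)) ltac:(by rewrite divr_gt0).
  exists N => n m Nn Nm; rewrite -bop_sub (le_trans (hnorm_bop _ _))//.
  apply: (@le_trans _ _ (e / (hnorm f + 1) * (hnorm f + 1))).
    by rewrite ler_pM ?bnorm_ge0 ?hnorm_ge0 ?hN ?lerDl.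
  by rewrite divfK// gt_eqF.
move=> hu; have hu' : forall e : R, 0 < e -> exists N, forall n m,
    (N <= n)%N -> (N <= m)%N -> bnorm (bop_adj (u n) - bop_adj (u m)) <= e.
  by move=> e /hu[N hN]; exists N => n m h1 h2; rewrite -adjB adjN hN.
pose T f := projT1 (cid (lim_ex u hu f)).
have TP f : forall e : R, 0 < e -> exists N, forall n, (N <= n)%N ->
    hnorm (T f - val (u n) f) <= e by exact: (projT2 (cid (lim_ex u hu f))).
pose S f := projT1 (cid (lim_ex (fun n => bop_adj (u n)) hu' f)).
have SP f : forall e : R, 0 < e -> exists N, forall n, (N <= n)%N ->
    hnorm (S f - val (bop_adj (u n)) f) <= e
  by exact: (projT2 (cid (lim_ex (fun n => bop_adj (u n)) hu' f))).
have close (e : R) : 0 < e -> exists N, forall n, (N <= n)%N ->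
    forall f, hnorm (T f - val (u n) f) <= e * hnorm f.
  move=> e0; have [N hN] := hu e e0; exists N => n Nn f.
  apply/ler_addgt0Pr => d d0; have [M hM] := TP f d d0.
  have -> : T f - val (u n) f = (T f - val (u (N + M)%N) f) + val (u (N + M)%N - u n) f.
    by rewrite bop_sub addrA subrK.
  apply: le_trans (hnormD _ _) _; rewrite [leRHS]addrC.
  apply: lerD (hM _ (leq_addl _ _)) _; apply: le_trans (hnorm_bop _ _) _.
  exact: ler_wpM2r (hnorm_ge0 f) _ _ (hN _ _ (leq_addr _ _) Nn).
have hsmall f : (forall e : R, 0 < e -> hnorm f <= e) -> f = 0.
  move=> h; apply: hnorm_eq0; apply/le_anti; rewrite hnorm_ge0 andbT.
  by apply/ler_addgt0Pr => e e0; rewrite add0r h.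
have Tlin z f g : T (z *: f + g) = z *: T f + T g.
  apply/eqP; rewrite -subr_eq0; apply/eqP/hsmall => e e0.
  pose c := hnorm (z *: f + g) + nrm z * hnorm f + hnorm g + 1.
  have c0 : 0 < c by rewrite ltr_wpDl// !addr_ge0 ?mulr_ge0 ?hnorm_ge0 ?nrm_ge0.
  have [N hN] := close (e / c) ltac:(by rewrite divr_gt0).
  have {}hN := hN N (leqnn N).
  have -> : T (z *: f + g) - (z *: T f + T g) =
      (T (z *: f + g) - val (u N) (z *: f + g)) +
      (- (z *: (T f - val (u N) f)) + - (T g - val (u N) g)).
    rewrite bop_lin scalerBr opprB opprB opprD.
    move: (T (z *: f + g)) (z *: T f) (T g) (z *: val (u N) f) (val (u N) g).
    move=> a1 a2 a3 a4 a5; rewrite [- (a4 + a5)]opprD.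
    rewrite [a4 - a2 + (a5 - a3)]addrACA -opprD addrA.
    by rewrite -[a1 + _ + _]addrA -opprD [- (a4 + a5) + _]addrC subrr addr0 opprD.
  apply: (@le_trans _ _ (e / c * c)); last by rewrite divfK// gt_eqF.
  have h1 := hN (z *: f + g); have h3 := hN g.
  have h2 := ler_wpM2l (nrm_ge0 z) (hN f); rewrite -hnormZ mulrCA in h2.
  rewrite -hnormN in h2; rewrite -hnormN in h3.
  apply: le_trans (hnormD _ _) _; rewrite [e / c * c]mulrDr mulr1 !mulrDr -!addrA.
  apply: lerD h1 _; apply: le_trans (hnormD _ _) _; apply: lerD h2 _.
  by apply: le_trans h3 _; rewrite lerDl ltW// divr_gt0.
have Tb : exists2 c : R, 0 <= c & forall f, hnorm (T f) <= c * hnorm f.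
  have [N hN] := close 1 ltr01; exists (1 + bnorm (u N)).
    by rewrite addr_ge0 ?bnorm_ge0.
  move=> f; have -> : T f = (T f - val (u N) f) + val (u N) f by rewrite subrK.
  apply: le_trans (hnormD _ _) _; rewrite mulrDl.
  exact: lerD (hN N (leqnn N) f) (hnorm_bop _ _).
have TS f g : ip (T f) g = ip f (S g).
  apply/eqP; rewrite -subr_eq0 -normr_le0; apply/ler_addgt0Pr => e e0; rewrite add0r.
  pose c := hnorm f + hnorm g + 1.
  have c0 : 0 < c by rewrite ltr_wpDl// addr_ge0 ?hnorm_ge0.
  have ec : 0 < e / c by rewrite divr_gt0.
  have [N hN] := TP f _ ec; have [M hM] := SP g _ ec.
  have {}hN := hN (N + M)%N (leq_addr _ _); have {}hM := hM (N + M)%N (leq_addl _ _).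
  have ip_abs f1 g1 : `|ip f1 g1| <= hnorm f1 * hnorm g1.
    rewrite ler_norml ip_le andbT lerNl -ipNl (le_trans (ip_le _ _))//.
    by rewrite hnormN.
  have -> : ip (T f) g - ip f (S g) = ip (T f - val (u (N + M)%N) f) g -
      ip f (S g - val (bop_adj (u (N + M)%N)) g).
    rewrite ipDl ipDr ipNl ipNr bop_adjP; ring.
  apply: (@le_trans _ _ (e / c * c)); last by rewrite divfK// gt_eqF.
  rewrite (le_trans (ler_normB _ _))//.
  have h1 := ip_abs (T f - val (u (N + M)%N) f) g.
  have h2 := ip_abs f (S g - val (bop_adj (u (N + M)%N)) g).
  have h3 := ler_wpM2r (hnorm_ge0 g) hN; have h4 := ler_wpM2l (hnorm_ge0 f) hM.
  rewrite /c; lra.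
have TP' : bop_pred T by apply/asboolP; split => //; exists S.
exists (exist _ T TP') => e e0; have [N hN] := close e e0.
exists N => n Nn; apply: bnorm_le; first exact: ltW.
by move=> f; rewrite bop_sub; exact: hN.
Qed.

End BoundedOperators.

Section BoundedOperatorAlgebra.
Variables (R : realType) (I : choiceType).
Local Notation C := R[i].
Local Notation bop := (bop R I).
Implicit Types (a b c : bop) (z : C).

Let norm a : C := (bnorm a)%:C%C.

Let normD a b : norm (a + b) <= norm a + norm b.
Proof. by rewrite /norm -rmorphD/= lecR bnormD. Qed.

Let normZ z a : norm (z *: a) = `|z| * norm a.
Proof. by rewrite /norm bnormZ rmorphM/= -nrmE. Qed.

Let norm_eq0 a : norm a = 0 -> a = 0.
Proof. by rewrite /norm => -[] /bnorm_eq0. Qed.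

HB.instance Definition _ := Lmodule_isNormed.Build C bop normD normZ norm_eq0.

Lemma nrm_bop a : nrm a = bnorm a. Proof. by []. Qed.

Let bop_cauchy_cvg (F : set_system bop) : ProperFilter F -> cauchy F -> cvg F.
Proof.
move=> FF /cauchyP cF.
have p n : 0 < (n.+1%:R^-1 : R)%:C%C by rewrite ltcR invr_gt0.
pose u n := projT1 (cid (cF _ (p n))).
have uP n : F (ball (u n) (n.+1%:R^-1 : R)%:C%C) by exact: projT2 (cid (cF _ (p n))).
have ballE a b (e : R) : ball a e%:C%C b = (bnorm (a - b) < e) :> Prop.
  by rewrite -ball_normE /= nrmE ltcR.
have [|a ha] := @bop_complete _ _ u.
  move=> e e0; have [N hN] := invS_le (e := e / 2) ltac:(by rewrite divr_gt0).
  exists N => n m Nn Nm.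
  have [b [bn bm]] := filter_ex (filterI (uP n) (uP m)).
  rewrite ballE in bn; rewrite ballE in bm.
  rewrite -nrm_bop; apply: le_trans (nrm_tri _ b _) _.
  rewrite [nrm (b - _)]nrmB !nrm_bop (splitr e).
  exact: lerD (le_trans (ltW bn) (hN n Nn)) (le_trans (ltW bm) (hN m Nm)).
apply/cvg_ex; exists a => B /nbhs_ballP[e /= e0 eB].
have [d d0 dE] := ltcR_pos e0.
have [N hN] := invS_le (e := d / 4) ltac:(by rewrite divr_gt0).
have [M hM] := ha (d / 4) ltac:(by rewrite divr_gt0).
apply: filterS (uP (N + M)%N) => b; rewrite ballE => ub; apply: eB.
rewrite dE ballE -nrm_bop (le_lt_trans (nrm_tri _ (u (N + M)%N) _))//.
have h1 := hM _ (leq_addl N M); have h2 := hN _ (leq_addr M N).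
rewrite !nrm_bop; apply: le_lt_trans (lerD h1 (le_trans (ltW ub) h2)) _.
by move: (d) d0 => x x0; lra.
Qed.

HB.instance Definition _ := Uniform_isComplete.Build bop bop_cauchy_cvg.

Let mulA : associative (@bop_mul R I). Proof. by move=> a b c; apply: bop_ext. Qed.
Let mulDl : left_distributive (@bop_mul R I) +%R.
Proof. by move=> a b c; apply: bop_ext => f; rewrite bop_add !bop_mulE bop_add. Qed.
Let mulDr : right_distributive (@bop_mul R I) +%R.
Proof.
by move=> a b c; apply: bop_ext => f; rewrite bop_add !bop_mulE bop_add bop_addr.
Qed.
Let mulZl z a b : bop_mul (z *: a) b = z *: bop_mul a b.
Proof. by apply: bop_ext => f; rewrite bop_scale !bop_mulE bop_scale. Qed.
Let mulZr z a b : bop_mul a (z *: b) = z *: bop_mul a b.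
Proof. by apply: bop_ext => f; rewrite bop_scale !bop_mulE bop_scale bop_scaler. Qed.
Let normM a b : `|bop_mul a b| <= `|a| * `|b|.
Proof. by rewrite !nrmE !nrm_bop -rmorphM/= lecR bnormM. Qed.
Let adjD : {morph @bop_adj R I : a b / a + b}.
Proof.
move=> a b; apply: bop_adj_uniq => f g.
by rewrite !bop_add ipDl !bop_adjP ipDr.
Qed.
Let adjZ z a : bop_adj (z *: a) = z^* *: bop_adj a.
Proof.
by apply: bop_adj_uniq => f g; rewrite !bop_scale ip_scale -bop_scaler bop_adjP bop_scaler.
Qed.
Let adjM a b : bop_adj (bop_mul a b) = bop_mul (bop_adj b) (bop_adj a).
Proof. by apply: bop_adj_uniq => f g; rewrite !bop_mulE !bop_adjP. Qed.
Let norm_adj a : `|bop_mul (bop_adj a) a| = `|a| ^+ 2.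
Proof. by rewrite !nrmE !nrm_bop bnorm_cstar rmorphXn. Qed.

HB.instance Definition _ := NormedModule_isCStar.Build R bop mulA mulDl mulDr
  mulZl mulZr normM (@bop_adjK R I) adjD adjZ adjM norm_adj.

Lemma cmul_bop a b : a ** b = bop_mul a b. Proof. by []. Qed.
Lemma cadj_bop a : a^† = bop_adj a. Proof. by []. Qed.

End BoundedOperatorAlgebra.

(** * Partial bijections as operators *)

Section PartialBijections.
Variables (R : realType) (I : choiceType).
Local Notation C := R[i].
Local Notation H := (ell2 R I).
Implicit Types (p q : I -> option I) (f g : H).

Lemma mem_enum_fset (X : {fset I}) i : (i \in finmap.enum_fset X) = (i \in X).
Proof. by []. Qed.

(** Says that p is a partial bijection with inverse q. *)
Definition converse p q := forall i j, p i = Some j <-> q j = Some i.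

Lemma converse_sym p q : converse p q -> converse q p.
Proof. by move=> h i j; split => /h. Qed.

Definition pull (V : nmodType) p (u : I -> V) i : V := if p i is Some j then u j else 0.

Lemma pmap_uniq_converse p q (s : seq I) : converse p q -> uniq s -> uniq (pmap p s).
Proof.
move=> pq; elim: s => //= i s IHs /andP[is_ us]; case E : (p i) => [j|] /=; rewrite IHs//.
rewrite andbT; apply: contra is_; rewrite mem_pmap => /mapP[i' i's /esym/pq E'].
by move/pq : E; rewrite E' => -[<-].
Qed.

Lemma psum_pull p (h : I -> R) (F : {fset I}) :
  psum (pull p h) F = \sum_(j <- pmap p (finmap.enum_fset F)) h j.
Proof.
rewrite /psum; elim: (finmap.enum_fset F) => [|i s IHs]; first by rewrite !big_nil.
by rewrite big_cons IHs /= /pull; case: (p i) => [j|] /=; rewrite ?big_cons ?add0r.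
Qed.

Lemma psum_pull_le p q (h : I -> R) (F : {fset I}) : converse p q ->
  (forall i, 0 <= h i) -> exists F', psum (pull p h) F = psum h F'.
Proof.
move=> pq h0; exists [fset j in pmap p (finmap.enum_fset F)]%fset.
rewrite psum_pull /psum; apply: perm_big; apply: uniq_perm.
- by apply: (pmap_uniq_converse pq); exact: fset_uniq.
- exact: fset_uniq.
- by move=> j; rewrite mem_enum_fset inE.
Qed.

(** A finite F containing q(F0) sums the same values as F0 together with p(F): an index of F0
    missing from p(F) lies outside the range of p, where h vanishes. *)
Lemma hassum_pull p q (h : I -> R) s : converse p q ->
  (forall j, q j = None -> h j = 0) -> hassum h s -> hassum (pull p h) s.
Proof.
move=> pq h0 hs e /hs[F0 hF0].
exists [fset i in pmap q (finmap.enum_fset F0)]%fset => F /fsubsetP F0F.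
pose F1 := (F0 `|` [fset j in pmap p (finmap.enum_fset F)])%fset.
suff -> : psum (pull p h) F = psum h F1 by exact/hF0/fsubsetUl.
rewrite psum_pull /psum.
rewrite [RHS](bigID (fun j => j \in pmap p (finmap.enum_fset F)))/=.
rewrite [X in _ = _ + X]big_seq_cond [X in _ = _ + X]big1 ?addr0; last first.
  move=> j /andP[jF1 jp]; apply: h0; case E : (q j) => [i|//].
  exfalso; move/negP : jp; apply.
  have iF : i \in F.
    move: jF1; rewrite mem_enum_fset in_fsetU => /orP[jF0|].
      by apply: F0F; rewrite inE /= mem_pmap -E map_f.
    rewrite inE /= mem_pmap => /mapP[i' i'F /esym/pq E'].
    by move: E; rewrite E' => -[<-].
  by rewrite mem_pmap; move/pq : E => <-; exact: map_f.
rewrite -[RHS]big_filter; apply: perm_big; apply: uniq_perm.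
- by apply: (pmap_uniq_converse pq); exact: fset_uniq.
- by apply: filter_uniq; exact: fset_uniq.
- move=> j; rewrite mem_filter; apply/esym/andb_idr => jp.
  by rewrite mem_enum_fset in_fsetU inE /= jp orbT.
Qed.

Variables (p q : I -> option I) (pq : converse p q).

Lemma pull_ell2 f : ell2_pred (pull p (val f)).
Proof.
have [c hc] := ell2_bound f; apply/asboolP; exists c => F.
rewrite (_ : (fun i => _) = pull p (fun j => dot (val f j) (val f j))).
  have [|F' ->] := psum_pull_le F pq (h := fun j => dot (val f j) (val f j)).
    by move=> i; exact: dot_ge0.
  exact: hc.
apply/funext => i; rewrite /pull; case: (p i) => //.
by rewrite /dot/= !mulr0 addr0.
Qed.

Definition pull_vec f : H := exist (fun u => ell2_pred u) (pull p (val f)) (pull_ell2 f).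

Lemma pull_vecE f i : val (pull_vec f) i = if p i is Some j then val f j else 0.
Proof. by []. Qed.

Lemma hnorm_pull_le f : hnorm (pull_vec f) <= 1 * hnorm f.
Proof.
rewrite mul1r /hnorm; apply: ler_wsqrtr; apply: (hassum_ub (ipP _ _)) => F.
rewrite (_ : (fun i => _) = pull p (fun j => dot (val f j) (val f j))).
  have [|F' ->] := psum_pull_le F pq (h := fun j => dot (val f j) (val f j)).
    by move=> i; exact: dot_ge0.
  exact: psum_le_ip.
apply/funext => i; rewrite /= /pull; case: (p i) => //.
by rewrite /dot/= !mulr0 addr0.
Qed.

End PartialBijections.

Section PartialBijectionOperators.
Variables (R : realType) (I : choiceType).
Local Notation H := (ell2 R I).
Implicit Types (p q : I -> option I) (f g : H).

(** Both inner products are the same sum over the graph of p. *)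
Lemma ip_pull p q (pq : converse p q) f g :
  ip (pull_vec pq f) g = ip f (pull_vec (converse_sym pq) g).
Proof.
apply: ipE; rewrite (_ : (fun i => _) =
    pull p (fun j => dot (val f j) (val (pull_vec (converse_sym pq) g) j))).
  apply: (hassum_pull pq) (ipP _ _) => j E.
  by rewrite pull_vecE E /dot/= !mulr0 addr0.
apply/funext => i; rewrite pull_vecE /pull; case E : (p i) => [j|].
  by move/pq : E => E; rewrite pull_vecE E.
by rewrite /dot/= !mul0r addr0.
Qed.

Lemma pull_bop p q (pq : converse p q) : bop_pred (pull_vec pq : H -> H).
Proof.
apply/asboolP; split.
- move=> z f g; apply: val_inj; apply/funext => i.
  have linE (u w : H) j : val (z *: u + w) j = z * val u j + val w j by [].
  rewrite linE !pull_vecE.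
  by case: (p i) => [j|]; rewrite ?linE// mulr0 addr0.
- by exists 1 => // f; exact: hnorm_pull_le.
- by exists (pull_vec (converse_sym pq)) => f g; exact: ip_pull.
Qed.

Definition pop p q (pq : converse p q) : bop R I :=
  exist (fun T => bop_pred T) (pull_vec pq) (pull_bop pq).

Lemma popE p q (pq : converse p q) f i :
  val (val (pop pq) f) i = if p i is Some j then val f j else 0.
Proof. by []. Qed.

Lemma pop_adj p q (pq : converse p q) : (pop pq)^† = pop (converse_sym pq).
Proof. by rewrite cadj_bop; apply: bop_adj_uniq => f g; exact: ip_pull. Qed.

Lemma bop_eqP (a b : bop R I) :
  (forall f i, val (val a f) i = val (val b f) i) -> a = b.
Proof. by move=> h; apply: bop_ext => f; apply: val_inj; apply/funext. Qed.

Lemma bop_sumE (J : Type) (r : seq J) (P : pred J) (F : J -> bop R I) f i :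
  val (val (\sum_(j <- r | P j) F j) f) i = \sum_(j <- r | P j) val (val (F j) f) i.
Proof.
by apply: (big_morph (fun a : bop R I => val (val a f) i)) => [a b|//]; rewrite bop_add raddfD.
Qed.

Lemma bop_subE (a b : bop R I) f i :
  val (val (a - b) f) i = val (val a f) i - val (val b f) i.
Proof. by rewrite bop_add -scaleN1r bop_scale scaleN1r raddfB. Qed.

Lemma delta_ell2 (u : I) : ell2_pred (fun i => (i == u)%:R : R[i]).
Proof.
apply/asboolP; exists 1 => F.
have -> : (fun i => dot ((i == u)%:R : R[i]) (i == u)%:R) = fun i => (i == u)%:R :> R.
  by apply/funext => i; case: (i == u); rewrite /dot/= ?mulr0 ?mulr1 addr0.
have [uF|uF] := boolP (u \in finmap.enum_fset F).
  rewrite /psum (big_rem u)//= eqxx big_seq big1 ?addr0// => i.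
  by rewrite mem_rem_uniq ?fset_uniq// inE => /andP[/negPf ->].
rewrite /psum big_seq big1// => i iF; case: eqP => // iu.
by move: uF; rewrite -iu iF.
Qed.

Definition delta (u : I) : H :=
  exist (fun w => ell2_pred w) (fun i => (i == u)%:R) (delta_ell2 u).

Lemma deltaE u i : val (delta u) i = (i == u)%:R. Proof. by []. Qed.

End PartialBijectionOperators.

(** * The boundary-path representation *)

Section TightFilters.
Variables (k : nat) (L : kgraph k) (hfa : finitely_aligned L).
Implicit Types (a b c e l m n : L) (v : obj L) (U W : set L) (E : set L).

(* The tight filters are the points of the boundary-path space: a boundary
   path [x] is recorded as the set [segments x] of its initial segments. *)
Record tight_filter U : Prop := {
  tight_ex : U !=set0;
  tight_initial : forall a b, initial a b -> U b -> U a;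
  tight_directed : forall a b, U a -> U b ->
    exists c, [/\ U c, initial a c & initial b c];
  tight_exhaustive : forall a E, U a -> finite_set E -> exhaustive (src a) E ->
    exists2 e, E e & U (ccomp a e) }.

Lemma tight_segments (x : gpath L) : is_boundary_path x -> tight_filter (segments x).
Proof.
move=> bx; split.
- by exists (idm (grng x)); exact: segment_idm.
- exact: segment_trans.
- exact: segment_directed.
- by move=> a E; exact: boundary_exhaustive.
Qed.

Lemma tight_rng U a b : tight_filter U -> U a -> U b -> rng a = rng b.
Proof.
move=> tU Ua Ub; have [c [_ ac bc]] := tight_directed tU Ua Ub.
by rewrite -(initial_rng ac) (initial_rng bc).
Qed.

Lemma tight_idm U a : tight_filter U -> U a -> U (idm (rng a)).
Proof. by move=> tU; apply: tight_initial => //; exact: initial_idm. Qed.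

Definition shift l U : set L := [set m | src l = rng m /\ U (ccomp l m)].

Definition extend l W : set L :=
  [set a | exists m, [/\ W m, src l = rng m & initial a (ccomp l m)]].

Lemma tight_shift l U : tight_filter U -> U l -> tight_filter (shift l U).
Proof.
move=> tU Ul; split.
- by exists (idm (src l)); rewrite /shift /= rng_idm comp_idr.
- move=> a b ab [lb Ub]; split; first by rewrite lb (initial_rng ab).
  by apply: tight_initial Ub => //; exact: initial_ccompl.
- move=> a b [la Ua] [lb Ub]; have [c [Uc ac bc]] := tight_directed tU Ua Ub.
  have [d ld cE] : initial l c by apply: initial_trans ac; exact: initial_ccomp.
  exists d; split; first by split; rewrite // -cE.
    by apply: initial_cancel la ld _; rewrite -cE.
  by apply: initial_cancel lb ld _; rewrite -cE.
- move=> a E [la Ua] finE exE.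
  have [|e Ee Ue] := tight_exhaustive tU Ua finE; first by rewrite src_comp.
  have ae : src a = rng e by have [h _] := exE; rewrite (h e Ee).
  by exists e => //; split; rewrite ?rng_comp// compA.
Qed.

(** Pulls an exhaustive set back along n. For th at the source of n, some e in E has a common
    extension with n th, and the minimal extension e a = n b inside it makes b compatible with
    th. *)
Lemma exhaustive_Lmin n E : finite_set E -> exhaustive (rng n) E ->
  let E' := [set b | exists2 e, E e & exists a, Lmin e n (a, b)] in
  finite_set E' /\ exhaustive (src n) E'.
Proof.
move=> finE [Er exE] E'; split.
  apply: (@sub_finite_set _ _ (\bigcup_(e in E) (snd @` Lmin e n))).
    by move=> b [e Ee [a M]]; exists e => //; exists (a, b).
  by apply: bigcup_finite => // e _; apply: finite_image; exact: hfa.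
split; first by move=> b [e _ [a [_ /= nb _ _]]]; rewrite /= nb.
move=> th thn; have [|e Ee] := exE (ccomp n th); first by rewrite rng_comp.
move=> [p /Lmin_compatible[w ew nw]].
have nth : initial n (ccomp n th) by exact: initial_ccomp.
have [a [b [M abw]]] := initial_min ew (initial_trans nth nw).
exists b; first by exists e => //; exists a.
apply: compatible_Lmin; have [_ /= nb E1 _] := M.
by apply: (compatible_ccompl nb (esym thn)); exists w; rewrite -?E1.
Qed.

(** Exhaustiveness is the point: if a n = l m with m in W, an exhaustive set at the source of a is
    pulled back along n to the source of m, where tightness of W applies. *)
Lemma tight_extend l W : tight_filter W -> W (idm (src l)) -> tight_filter (extend l W).
Proof.
move=> tW Wl; have Wr m : W m -> src l = rng m.
  by move=> Wm; rewrite -(tight_rng tW Wl Wm) rng_idm.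
split.
- by exists l, (idm (src l)); rewrite rng_idm comp_idr; split => //; exact: initial_refl.
- move=> a b ab [m [Wm lm bm]]; exists m; split => //; exact: initial_trans bm.
- move=> a b [m [Wm lm am]] [n [Wn ln bn]].
  have [c [Wc mc nc]] := tight_directed tW Wm Wn; have lc := Wr c Wc.
  exists (ccomp l c); split; first by exists c; split => //; exact: initial_refl.
    exact: initial_trans am (initial_ccompl lc mc).
  exact: initial_trans bn (initial_ccompl lc nc).
- move=> a E [m [Wm lm [n an lmE]]] finE; rewrite an => exE.
  have [finE' exE'] := exhaustive_Lmin finE exE.
  have nm : src n = src m by rewrite -(src_comp an) -lmE src_comp.
  have [|b [e Ee [c M]] Wb] := tight_exhaustive tW Wm finE'; first by rewrite -nm.
  exists e => //; exists (ccomp m b); split; rewrite ?(Wr _ Wb)//.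
  have [/= ec nb E1 _] := M; have mb : src m = rng b by rewrite -nm.
  have ae : src a = rng e by have [h _] := exE; rewrite (h e Ee).
  rewrite compA// lmE -compA// -E1 compA//; apply: initial_ccomp.
  by rewrite src_comp.
Qed.

Lemma shift_idm l U : U l -> shift l U (idm (src l)).
Proof. by move=> Ul; rewrite /shift /= rng_idm comp_idr. Qed.

Lemma extend_shift l U : tight_filter U -> U l -> extend l (shift l U) = U.
Proof.
move=> tU Ul; apply/seteqP; split => a.
  by move=> [m [[lm Um] _ am]]; exact: tight_initial am Um.
move=> Ua; have [c [Uc lc ac]] := tight_directed tU Ul Ua.
by case: lc => m lm cE; exists m; split; rewrite -?cE//; split; rewrite -?cE.
Qed.

Lemma extend_self l W : W (idm (src l)) -> extend l W l.
Proof.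
by move=> Wl; exists (idm (src l)); rewrite rng_idm comp_idr; split => //; exact: initial_refl.
Qed.

Lemma shift_extend l W : tight_filter W -> W (idm (src l)) -> shift l (extend l W) = W.
Proof.
move=> tW Wl; apply/seteqP; split => a.
  by move=> [la [m [Wm lm]]] /(initial_cancel la lm) am; exact: tight_initial am Wm.
move=> Wa; have la : src l = rng a by rewrite -(tight_rng tW Wl Wa) rng_idm.
by split => //; exists a; split => //; exact: initial_refl.
Qed.

Lemma shift_comp l m U : src l = rng m -> shift m (shift l U) = shift (ccomp l m) U.
Proof.
move=> lm; apply/seteqP; split => a.
  by move=> [ma [_ Ua]]; split; rewrite ?src_comp// -compA.
move=> []; rewrite src_comp// => ma; rewrite -compA// => Ua; split => //.
by split; rewrite ?rng_comp.
Qed.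

Lemma shift_vertex v U : tight_filter U -> U (idm v) -> shift (idm v) U = U.
Proof.
move=> tU Uv; apply/seteqP; split => a.
  by move=> []; rewrite src_idm => ->; rewrite comp_idl.
move=> Ua; have va : v = rng a by rewrite -(tight_rng tU Uv Ua) rng_idm.
by split; rewrite ?src_idm// {1}va comp_idl.
Qed.

End TightFilters.

(** * The Cuntz-Krieger operators on the tight filters *)

Section BoundaryRepresentation.
Variables (R : realType) (k : nat) (L : kgraph k) (hfa : finitely_aligned L).
Implicit Types (a b c e l m n : L) (v : obj L) (U W : set L).

Definition take_off l U : option (set L) :=
  if `[< tight_filter U /\ U l >] then Some (shift l U) else None.

Definition put_on l W : option (set L) :=
  if `[< tight_filter W /\ W (idm (src l)) >] then Some (extend l W) else None.

Lemma take_off_converse l : converse (take_off l) (put_on l).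
Proof.
move=> U W; rewrite /take_off /put_on; split.
  case: asboolP => // -[tU Ul] [<-].
  rewrite asboolT ?extend_shift//; split; first exact: tight_shift.
  exact: shift_idm.
case: asboolP => // -[tW Wl] [<-].
rewrite asboolT ?shift_extend//; split; first exact: tight_extend.
exact: extend_self.
Qed.

(** Composing functions with the removal of l moves the point mass at W to the point mass at l W. *)
Definition bdry l : bop R (set L) := pop R (take_off_converse l).

Lemma bdryE l f U : val (val (bdry l) f) U =
  if `[< tight_filter U /\ U l >] then val f (shift l U) else 0.
Proof. by rewrite popE /take_off; case: asboolP. Qed.

Lemma bdry_adjE l f U : val (val ((bdry l)^†) f) U =
  if `[< tight_filter U /\ U (idm (src l)) >] then val f (extend l U) else 0.
Proof. by rewrite pop_adj popE /put_on; case: asboolP. Qed.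

Lemma bdry_vertexE v f U : val (val (bdry (idm v)) f) U =
  if `[< tight_filter U /\ U (idm v) >] then val f U else 0.
Proof. by rewrite bdryE; case: asboolP => // -[tU Uv]; rewrite shift_vertex. Qed.

Lemma bdry_rangeE l f U : val (val (bdry l ** (bdry l)^†) f) U =
  if `[< tight_filter U /\ U l >] then val f U else 0.
Proof.
rewrite cmul_bop bop_mulE bdryE; case: asboolP => // -[tU Ul].
rewrite bdry_adjE asboolT ?extend_shift//; split; first exact: tight_shift.
exact: shift_idm.
Qed.

Definition diagonal (d : bop R (set L)) (P : set L -> bool) :=
  forall f U, val (val d f) U = if P U then val f U else 0.

(** The paths l a, for (a, b) in [Lmin l m], all have the same degree, so the filter Z = l U
    contains at most one of them, and it contains one exactly when it contains m. Hence at most one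
    term of the sum is non-zero at U. *)
Lemma bdry_min l m : (bdry l)^† ** bdry m =
  \sum_(p \in Lmin l m) (bdry p.1 ** (bdry p.2)^†).
Proof.
rewrite fsbig_finite; last exact: hfa.
apply: bop_eqP => f U; rewrite bop_sumE cmul_bop bop_mulE bdry_adjE.
have termE p : Lmin l m p -> val (val (bdry p.1 ** (bdry p.2)^†) f) U =
    if `[< tight_filter U /\ U p.1 >] then val f (extend p.2 (shift p.1 U)) else 0.
  move=> [h1 h2 E _]; rewrite cmul_bop bop_mulE bdryE; case: asboolP => // -[tU Up].
  rewrite bdry_adjE asboolT//; split; first exact: tight_shift.
  have -> : src p.2 = src p.1.
    by move: (congr1 (@src _) E); rewrite !src_comp.
  exact: shift_idm.
have mem p : (p \in finmap.enum_fset (fset_set (Lmin l m))) -> Lmin l m p.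
  by rewrite [_ \in finmap.enum_fset _]in_fset_set// => /set_mem.
have [[tU Ul]|h] := asboolP; last first.
  rewrite big_seq big1// => p /mem M; rewrite (termE p M).
  case: asboolP => // -[tU Up]; exfalso; apply: h; split => //.
  by have [-> _ _ _] := M; exact: tight_idm.
have tZ := tight_extend hfa tU Ul; rewrite bdryE.
set Z := extend l U in tZ *.
have Zl : Z l by exact: extend_self.
have shZ : shift l Z = U by exact: shift_extend.
case: asboolP => [[_ Zm]|h]; last first.
  rewrite big_seq big1// => p /mem M; rewrite (termE p M).
  case: asboolP => // -[_ Up]; exfalso; apply: h; split => //.
  have [l1 m2 E _] := M; apply: (tight_initial tZ (initial_ccomp m2)); rewrite -E.
  by move: Up; rewrite -shZ => -[].
have [c [Zc lc mc]] := tight_directed tZ Zl Zm.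
have [a [b [M abc]]] := initial_min lc mc; have [/= la mb E D] := M.
have Zla : Z (ccomp l a) by exact: tight_initial abc Zc.
have Ua : U a by rewrite -shZ.
have pe : (a, b) \in finmap.enum_fset (fset_set (Lmin l m)).
  by rewrite [_ \in finmap.enum_fset _]in_fset_set//; exact/mem_set.
rewrite [RHS](eq_big_seq (fun p => if `[< tight_filter U /\ U p.1 >] then
  val f (extend p.2 (shift p.1 U)) else 0)); last by move=> p /mem; exact: termE.
rewrite (big_rem _ pe)/= asboolT// big_seq big1 ?addr0.
  congr (val f _).
  rewrite -[in RHS]shZ shift_comp// E -shift_comp// extend_shift//.
    exact: tight_shift.
  by split; rewrite // -E.
move=> [a' b']; rewrite mem_rem_uniq ?fset_uniq// inE => /andP[ne /mem M'].
case: asboolP => //= -[_ Ua']; exfalso; move/eqP : ne; apply.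
have [/= la' mb' E' D'] := M'.
have Zla' : Z (ccomp l a') by move: Ua'; rewrite -shZ => -[].
have [w [_ h h']] := tight_directed tZ Zla Zla'.
have ll : ccomp l a' = ccomp l a by apply: (initial_uniq h' h); rewrite D D'.
congr pair; first exact: (ccompI la' la ll).
by apply: (ccompI mb' mb); rewrite -E -E'.
Qed.

Lemma bdry_CK : CK_family bdry.
Proof.
split.
- move=> l; apply: bop_eqP => f U; rewrite cmul_bop bop_mulE bdry_rangeE bdryE.
  by case: asboolP.
- move=> v; split.
    rewrite cadj_bop; apply: bop_adj_uniq => f g; apply: ipE.
    rewrite (_ : (fun U => _) = fun U => dot (val f U) (val (val (bdry (idm v)) g) U)).
      exact: ipP.
    apply/funext => U; rewrite !bdry_vertexE; case: asboolP => // _.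
    by rewrite /dot/= !mul0r !mulr0.
  apply: bop_eqP => f U; rewrite cmul_bop bop_mulE !bdry_vertexE.
  by case: asboolP.
- move=> v w vw; apply: bop_eqP => f U; rewrite cmul_bop bop_mulE !bdry_vertexE.
  rewrite [RHS]/(0 : R[i]); case: asboolP => // -[tU Uv]; case: asboolP => // -[_ Uw].
  by exfalso; apply: vw; have := tight_rng tU Uv Uw; rewrite !rng_idm.
- move=> l m lm; apply: bop_eqP => f U; rewrite cmul_bop bop_mulE !bdryE.
  case: asboolP => [[tU Ul]|h]; last first.
    case: asboolP => // -[tU Ulm]; exfalso; apply: h; split => //.
    exact: tight_initial (initial_ccomp lm) Ulm.
  rewrite shift_comp//; congr (if _ then _ else _); apply: asbool_equiv_eq.
  split => [[_ [_ Ulm]]//|[_ Ulm]].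
  by split; [exact: tight_shift|split].
- exact: bdry_min.
(* All factors are diagonal. At a tight filter U through v, tightness puts some e of E into U, and
   the factor of e vanishes there. *)
- move=> v E [Ev exE].
  have En e : e \in E -> diagonal (bdry (idm v) - bdry e ** (bdry e)^†)
      (fun U => `[< tight_filter U /\ U (idm v) >] && ~~ `[< tight_filter U /\ U e >]).
    move=> eE f U; rewrite bop_subE bdry_vertexE bdry_rangeE.
    have [[tU Ue]|_] := asboolP (tight_filter U /\ U e); last by rewrite andbT subr0.
    rewrite andbF asboolT ?subrr//; split => //.
    by rewrite -(Ev e eE); exact: tight_idm.
  have Eex U : tight_filter U -> U (idm v) -> exists2 e, e \in E & U e.
    move=> tU Uv; have [| |e Ee] := tight_exhaustive tU Uv (E := [set` E]).
    - exact: finite_fset.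
    - by rewrite src_idm.
    - have -> : ccomp (idm v) e = e by rewrite -(Ev e Ee) comp_idl.
      by exists e.
  case EE : (finmap.enum_fset E) => [|e s] //=.
  have eE : e \in E by rewrite -[e \in E]/(e \in finmap.enum_fset E) EE mem_head.
  have sE n : n \in s -> n \in E.
    by move=> ns; rewrite -[n \in E]/(n \in finmap.enum_fset E) EE inE ns orbT.
  apply: bop_eqP => f U; rewrite [RHS]/(0 : R[i]).
  have key (r : seq L) d (Q : set L -> bool) : {subset r <= E} -> diagonal d Q ->
    diagonal (foldl cmul d [seq bdry (idm v) - bdry l ** (bdry l)^† | l <- r])
      (fun U => Q U && all (fun l => `[< tight_filter U /\ U (idm v) >] &&
         ~~ `[< tight_filter U /\ U l >]) r).
    elim: r d Q => [|n r IHr] d Q rE hd /=; first by move=> g W; rewrite hd andbT.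
    move=> g W; rewrite (IHr _ (fun W => Q W && (`[< tight_filter W /\ W (idm v) >] &&
         ~~ `[< tight_filter W /\ W n >]))); first by rewrite -andbA.
      by move=> l lr; apply: rE; rewrite inE lr orbT.
    move=> g' W'; rewrite cmul_bop bop_mulE hd (En n) ?rE ?mem_head//.
    by case: (Q W').
  rewrite (key s _ _ sE (En e eE)); case: ifP => // /andP[/andP[/asboolP[tU Uv] Ue] /allP h].
  exfalso; have [n nE Un] := Eex U tU Uv.
  move: nE; rewrite -[n \in E]/(n \in finmap.enum_fset E) EE inE => /orP[/eqP nE|/h/andP[_]].
    by move: Ue; rewrite -nE asboolT.
  by rewrite asboolT.
Qed.

Lemma bdry_neq0 v (x : gpath L) : is_boundary_path x -> grng x = v -> bdry (idm v) <> 0.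
Proof.
move=> bx xv h.
have := bdry_vertexE v (delta R (segments x)) (segments x).
rewrite h asboolT; last first.
  by split; [exact: tight_segments|rewrite -xv; exact: segment_idm].
by rewrite deltaE eqxx [LHS]/(0 : R[i]) => /esym/eqP; rewrite oner_eq0.
Qed.

End BoundaryRepresentation.

Theorem corollary4p6 (R : realType) (k : nat) (L : kgraph k)
  (hfa : finitely_aligned L)
  (hap : forall v : obj L, exists x : gpath L,
    [/\ is_boundary_path x, grng x = v
      & forall l m : L, src l = v -> src m = v -> l <> m ->
          concat l x <> concat m x]) :
  (exists (A : cstarAlgType R) (t : L -> A),
     CK_family t /\ forall v : obj L, t (idm v) <> 0) /\
  (forall (A B : cstarAlgType R) (t : L -> A) (t' : L -> B),
     CK_family t -> (forall v : obj L, t (idm v) <> 0) ->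
     CK_family t' -> (forall v : obj L, t' (idm v) <> 0) ->
     exists2 phi : A -> B,
       is_cstar_iso (cstar_generated (range t)) (cstar_generated (range t')) phi &
       forall l : L, phi (t l) = t' l).
Proof.
split.
  exists (bop R (set L)), (@bdry R k L hfa); split; first exact: bdry_CK.
  by move=> v; have [x [bx xv _]] := hap v; exact: (bdry_neq0 bx xv).
move=> A B t t' ct t0 ct' t'0; apply: (cstar_iso hfa ct ct') => s ws.
(* Both families have non-zero vertex projections, so the inequality of norms holds in both
   directions. *)
by apply/le_anti; rewrite !(ev_le hfa)//.
Qed.
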